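(* Let $d\ge 1$, let $0<\alpha<1$ and $0<s<1$, let $\Lambda,M\subset\mathbb{R}^d$ be discrete, and set $\beta=\alpha^{-1}$. Assume that at least one of the following holds: (i) $d\ge 1$, and there exist $c_1,c_2>0$ such that $\mathrm{D}^-_{\Phi_{1,c_1}}(\Lambda)>0$ and $\mathrm{D}^-_{\Phi_{\beta,c_2}}(M)>0$; (ii) $d=1$, and there exists $c>0$ such that $\mathrm{D}^-_{\Phi_{1,c}}(\Lambda)>0$ and $\mathrm{D}^-_{G_\alpha}(M)>0$. Then $(\Lambda,M)$ is a uniqueness pair for $(-\Delta)^s$ in $\mathcal{S}(\mathbb{R}^d)$; that is, every $f\in\mathcal{S}(\mathbb{R}^d)$ with $f(\lambda)=0$ for all $\lambda\in\Lambda$ and $(-\Delta)^sf(\mu)=0$ for all $\mu\in M$ is identically zero.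
   Context: $\mathcal{S}(\mathbb{R}^d)$ is the Schwartz space of complex-valued functions. The Fourier transform is $\widehat f(\xi)=\int_{\mathbb{R}^d}f(x)e^{-2\pi i\xi\cdot x}\,dx$, and for $f\in\mathcal{S}(\mathbb{R}^d)$ the function $(-\Delta)^sf$ is defined by $\widehat{(-\Delta)^sf}(\xi)=|\xi|^{2s}\widehat f(\xi)$; it is a smooth function, so its pointwise values make sense. A set in $\mathbb{R}^d$ is discrete if it has no accumulation point in $\mathbb{R}^d$. Densities: for an injective $F:\mathbb{R}^d\to\mathbb{R}^d$ such that $F(\mathbb{R}^d)$ contains balls of arbitrarily large radius, and $\Gamma\subset\mathbb{R}^d$ discrete, put for $r>0$ $$M_F(\Gamma,r)=\Big\{\tfrac{\#(F(\Gamma)\cap B)}{|B|}: B\subset F(\mathbb{R}^d)\text{ a ball},\ |B|=r\Big\},\qquad \mathrm{D}_F^-(\Gamma)=\liminf_{r\to\infty}\inf M_F(\Gamma,r)\in[0,\infty],$$ where $|B|$ is Lebesgue measure. Changes of variables: for $a,c>0$, $G_a:\mathbb{R}\to\mathbb{R}$ is $G_a(y)=\mathrm{sgn}(y)|y|^{1/a}$, and $\Phi_{a,c}:\mathbb{R}^d\to\mathbb{R}^d$ is $\Phi_{a,c}(x)=\frac{x}{|x|}e^{(|x|/c)^{1/a}}$ for $x\ne0$ and $\Phi_{a,c}(0)=0$. *)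

(* Defs.v *)
From HB Require Import structures.
From mathcomp Require Import all_boot all_order all_algebra.
From mathcomp Require Import complex.
From mathcomp Require Import all_classical all_reals all_analysis.

Set Implicit Arguments.
Unset Strict Implicit.
Unset Printing Implicit Defensive.

Import Order.TTheory GRing.Theory Num.Theory.
Import numFieldNormedType.Exports.

Local Open Scope classical_set_scope.
Local Open Scope ring_scope.

(** * Lebesgue measure on R^d

    Points of R^d are row vectors. Beware that the library norm [`|x|] on
    ['rV[R]_d] is the sup norm; the Euclidean norm is [enorm] below. *)

Definition rV_display : measure_display.
Proof. exact: default_measure_display. Qed.

Section measurable_rV.
Variables (R : realType) (d : nat).

Definition rV_coord (i : 'I_d) (v : 'rV[R]_d) : measurableTypeR R := v ord0 i.

Let rV_set0 : g_sigma_preimage rV_coord set0.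
Proof. exact: sigma_algebra0. Qed.

Let rV_setC A : g_sigma_preimage rV_coord A -> g_sigma_preimage rV_coord (~` A).
Proof. exact: sigma_algebraC. Qed.

Let rV_bigcup (F : (set 'rV[R]_d)^nat) :
  (forall i, g_sigma_preimage rV_coord (F i)) ->
  g_sigma_preimage rV_coord (\bigcup_i (F i)).
Proof. exact: sigma_algebra_bigcup. Qed.

(* The sigma-algebra generated by the coordinates, i.e. the Borel sets. *)
HB.instance Definition _ := @isMeasurable.Build rV_display
  'rV[R]_d (g_sigma_preimage rV_coord) rV_set0 rV_setC rV_bigcup.

Lemma measurable_rV_coord (i : 'I_d) : measurable_fun [set: 'rV[R]_d] (rV_coord i).
Proof.
move=> _ Y mY; rewrite setTI; apply: sub_sigma_algebra => /=.
rewrite -bigcup_seq/=; exists i => /=; first by rewrite mem_index_enum.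
by exists Y => //; rewrite setTI.
Qed.

Lemma measurable_fun_rVP d1 (T : measurableType d1) (f : T -> 'rV[R]_d) :
  (forall i, measurable_fun [set: T] (rV_coord i \o f)) ->
  measurable_fun [set: T] f.
Proof.
move=> mf.
have prefS : g_sigma_preimage (fun i => rV_coord i \o f) `<=` measurable.
  apply: smallest_sub; first exact: sigma_algebra_measurable.
  rewrite -bigcup_seq; apply: bigcup_sub => i _.
  by move=> A [B mB <-]; exact: mf.
move=> _ A mA; apply: prefS.
have -> : g_sigma_preimage (fun i => rV_coord i \o f) =
    preimage_set_system [set: T] f (g_sigma_preimage rV_coord).
  exact: (g_sigma_preimage_comp rV_coord f).
by exists A.
Qed.

End measurable_rV.

Section lebesgue_rV.
Variable R : realType.

Definition rV_cons d (p : measurableTypeR R * 'rV[R]_d) : 'rV[R]_d.+1 :=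
  \row_i oapp (fun j => p.2 ord0 j) p.1 (unlift ord0 i).

Definition rV_uncons d (v : 'rV[R]_d.+1) : measurableTypeR R * 'rV[R]_d :=
  (v ord0 ord0, \row_j v ord0 (lift ord0 j)).

Lemma rV_consK d : cancel (@rV_cons d) (@rV_uncons d).
Proof.
move=> [x v]; rewrite /rV_uncons /rV_cons mxE unlift_none/=; congr (_, _).
by apply/rowP => j; rewrite !mxE liftK.
Qed.

Lemma measurable_rV_cons d : measurable_fun setT (@rV_cons d).
Proof.
apply: measurable_fun_rVP => i.
case: (unliftP ord0 i) => [j ->|->].
  rewrite (_ : _ \o _ = @rV_coord R d j \o snd).
    by apply: measurableT_comp => //; exact: measurable_rV_coord.
  by apply/funext => p; rewrite /rV_coord/= mxE liftK.
rewrite (_ : _ \o _ = fst) //.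
by apply/funext => p; rewrite /rV_coord/= mxE unlift_none.
Qed.

Lemma measurable_rV_uncons d : measurable_fun setT (@rV_uncons d).
Proof.
apply: measurable_fun_pair; first exact: (@measurable_rV_coord R d.+1 ord0).
apply: measurable_fun_rVP => j.
rewrite (_ : _ \o _ = @rV_coord R d.+1 (lift ord0 j)).
  exact: measurable_rV_coord.
by apply/funext => v; rewrite /rV_coord/= mxE.
Qed.

(* d-fold product of the one-dimensional Lebesgue measure, transported along
   R x R^d = R^(d+1); R^0 is a point of mass one. *)
Fixpoint lebesgue_rV (d : nat) : set 'rV[R]_d -> \bar R :=
  if d is d'.+1
  then pushforward (@lebesgue_measure R \x @lebesgue_rV d')%E (@rV_cons d')
  else dirac (0 : 'rV[R]_0).

Lemma lebesgue_rV_subproof d :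
  [/\ lebesgue_rV (set0 : set 'rV[R]_d) = 0%E,
      forall A : set 'rV[R]_d, (0 <= lebesgue_rV A)%E,
      semi_sigma_additive (@lebesgue_rV d) &
      sigma_finite setT (@lebesgue_rV d)].
Proof.
elim: d => [|d [m0 mge0 msa msf]].
  split => /=.
  - exact: measure0.
  - by move=> A; exact: measure_ge0.
  - exact: measure_semi_sigma_additive.
  - exact: sigma_finiteT.
pose mM := isMeasure.Build _ _ _ (@lebesgue_rV d) m0 mge0 msa.
pose m1 : {measure set 'rV[R]_d -> \bar R} := HB.pack (@lebesgue_rV d) mM.
pose mS := Measure_isSigmaFinite.Build _ _ _ m1 msf.
pose m : {sigma_finite_measure set 'rV[R]_d -> \bar R} := HB.pack (@lebesgue_rV d) mM mS.
pose p : {measure set _ -> \bar R} :=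
  (@lebesgue_measure R \x m)%E.
have pE A : lebesgue_rV A = p (@rV_cons d @^-1` A) by [].
have mcons (A : set 'rV[R]_d.+1) : measurable A -> measurable (@rV_cons d @^-1` A).
  by move=> mA; rewrite -[X in measurable X]setTI; exact: measurable_rV_cons.
split.
- by rewrite pE preimage_set0 measure0.
- by move=> A; rewrite pE measure_ge0.
- move=> F mF tF mUF; rewrite pE preimage_bigcup.
  apply: measure_semi_sigma_additive.
  + by move=> n; exact: mcons.
  + apply/trivIsetP => /= i j _ _ ij; rewrite -preimage_setI.
    by move/trivIsetP : tF => /(_ _ _ _ _ ij) ->//; rewrite preimage_set0.
  + by rewrite -preimage_bigcup; exact: mcons.
- have /sigma_finiteP[F [TF ndF Foo]] := sigma_finiteT (@lebesgue_measure R).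
  have /sigma_finiteP[H [TH ndH Hoo]] := sigma_finiteT m.
  exists (fun n => @rV_uncons d @^-1` (F n `*` H n)).
    rewrite -preimage_bigcup (_ : \bigcup_i _ = setT) ?preimage_setT//.
    apply/seteqP; split => // -[x v] _.
    have [n _ Fnx] : (\bigcup_n F n) x by rewrite -TF.
    have [k _ Hkv] : (\bigcup_n H n) v by rewrite -TH.
    exists (maxn n k) => //; split => /=.
      by move: x Fnx; exact/subsetPset/ndF/leq_maxl.
    by move: v Hkv; exact/subsetPset/ndH/leq_maxr.
  move=> n; have [mF Fn] := Foo n; have [mH Hn] := Hoo n; split.
    by rewrite -[X in measurable X]setTI; apply: measurable_rV_uncons => //;
      exact: measurableX.
  rewrite pE (_ : _ @^-1` _ = F n `*` H n); last first.
    by apply/funext => x; rewrite /preimage /mkset rV_consK.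
  by rewrite [ltLHS](product_measure1E _ m mF mH) lte_mul_pinfty// ge0_fin_numE.
Qed.

HB.instance Definition _ (d : nat) := isMeasure.Build _ _ _ (@lebesgue_rV d)
  (let: And4 h _ _ _ := lebesgue_rV_subproof d in h)
  (let: And4 _ h _ _ := lebesgue_rV_subproof d in h)
  (let: And4 _ _ h _ := lebesgue_rV_subproof d in h).

HB.instance Definition _ (d : nat) :=
  Measure_isSigmaFinite.Build _ _ _ (@lebesgue_rV d)
  (let: And4 _ _ _ h := lebesgue_rV_subproof d in h).

End lebesgue_rV.
Arguments lebesgue_rV {R d}.

Section euclidean.
Variables (R : realType) (d : nat).
Implicit Types x y : 'rV[R]_d.

Definition dotp x y : R := \sum_(i < d) x ord0 i * y ord0 i.

Definition enorm x : R := Num.sqrt (dotp x x).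

Definition eball x (r : R) : set 'rV[R]_d := [set y | enorm (y - x) < r].

Definition discrete (A : set 'rV[R]_d) : Prop := limit_point A = set0.

End euclidean.

Section density.
Variables (R : realType) (d : nat).
Local Open Scope ereal_scope.

Definition density_quotients (F : 'rV[R]_d -> 'rV[R]_d) (Gamma : set 'rV[R]_d)
    (r : R) : set (\bar R) :=
  [set q | exists (x : 'rV[R]_d) (rho : R), let B := eball x rho in
     [/\ (0 < rho)%R, B `<=` range F, lebesgue_rV B = r%:E &
         q = counting ((F @` Gamma) `&` B) / lebesgue_rV B]].

(* D_F^-(Gamma). Balls are open; closed balls give the same value, since the
   measure of a ball depends continuously on its radius. *)
Definition lower_density (F : 'rV[R]_d -> 'rV[R]_d) (Gamma : set 'rV[R]_d)
    : \bar R :=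
  limf_einf (fun r : R => ereal_inf (density_quotients F Gamma r)) (+oo%R).

End density.

Section changes_of_variables.
Variables (R : realType) (d : nat).

Definition Gscal (a y : R) : R := Num.sg y * `|y| `^ a^-1.

(* Coordinatewise; only meant for [d = 1], where R^1 is identified with R. *)
Definition G (a : R) (x : 'rV[R]_d) : 'rV[R]_d := map_mx (Gscal a) x.

Definition Phi (a c : R) (x : 'rV[R]_d) : 'rV[R]_d :=
  if x == 0 then 0
  else expR ((enorm x / c) `^ a^-1) *: ((enorm x)^-1 *: x).

End changes_of_variables.

Section schwartz.
Variables (R : realType) (d : nat).

(* [partials [:: i1; ...; ik] g] is d_i1 ( ... (d_ik g)). *)
Definition partials (s : seq 'I_d) (g : 'rV[R]_d -> R) : 'rV[R]_d -> R :=
  foldr (fun i h => 'D_(delta_mx ord0 i : 'rV[R]_d) h) g s.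

(* All iterated partial derivatives are (Frechet) differentiable iff the
   function is infinitely differentiable. *)
Definition smooth (g : 'rV[R]_d -> R) : Prop :=
  forall (s : seq 'I_d) (x : 'rV[R]_d), differentiable (partials s g) x.

Definition real_schwartz (g : 'rV[R]_d -> R) : Prop :=
  smooth g /\
  forall (k : 'I_d -> nat) (s : seq 'I_d), exists C : R, forall x : 'rV[R]_d,
    `|(\prod_(i < d) x ord0 i ^+ k i) * partials s g x| <= C.

Definition schwartz (f : 'rV[R]_d -> R[i]) : Prop :=
  real_schwartz (fun x => complex.Re (f x)) /\
  real_schwartz (fun x => complex.Im (f x)).

End schwartz.

Section fractional_laplacian.
Variables (R : realType) (d : nat).
Implicit Types (f : 'rV[R]_d -> R[i]) (x xi : 'rV[R]_d).

Definition cintegral f : R[i] :=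
  ((\int[lebesgue_rV]_x complex.Re (f x)) +i*
   (\int[lebesgue_rV]_x complex.Im (f x)))%C.

Definition expi (t : R) : R[i] := (cos t +i* sin t)%C.

Definition fourier f xi : R[i] :=
  cintegral (fun x => f x * expi (- (2 * pi * dotp xi x))).

Definition inv_fourier f x : R[i] :=
  cintegral (fun xi => f xi * expi (2 * pi * dotp x xi)).

(* For f Schwartz, |xi|^(2s) * fourier f xi is continuous and integrable, so
   the smooth function with this Fourier transform is its inverse Fourier
   integral, which is defined at every point. *)
Definition frac_laplacian (s : R) f : 'rV[R]_d -> R[i] :=
  inv_fourier (fun xi => (enorm xi `^ (2 * s))%:C%C * fourier f xi).

Definition uniqueness_pair (T : ('rV[R]_d -> R[i]) -> 'rV[R]_d -> R[i])
    (Lambda M : set 'rV[R]_d) : Prop :=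
  forall f, schwartz f ->
    (forall x, Lambda x -> f x = 0) -> (forall x, M x -> T f x = 0) ->
    forall x, f x = 0.

End fractional_laplacian.

(* Main.v *)
(* If f vanishes on Lambda, the density of Lambda in the variable Phi_{1,c} puts a zero of f within
   O(exp(- a |x|)) of every x, so the mean value theorem gives f exponential decay. In the same way
   the density of M makes g = (-Delta)^s f rapidly decreasing: for Phi_{beta,c} the gaps between
   zeros decay faster than any power, while for G_alpha they only have size |x|^(1 - beta), and
   Rolle's theorem applied to all derivatives is needed. Hence both hat f and
   hat g = |xi|^(2s) hat f are smooth at 0. As 0 < 2s < 2, comparing Taylor expansions along lines
   forces hat f to vanish to infinite order at 0, i.e. all moments of f vanish; since f decays
   exponentially, hat f is real analytic, so hat f = 0 and f = 0. Real and imaginary parts are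
   treated separately, with the Hartley transform in place of the Fourier transform. *)

From HB Require Import structures.
Require Import Defs.
From mathcomp Require Import all_boot all_order all_algebra.
From mathcomp Require Import complex.
From mathcomp Require Import all_classical all_reals all_analysis.
From mathcomp Require Import measurable_realfun.
From mathcomp Require Import ring lra.

Set Implicit Arguments.
Unset Strict Implicit.
Unset Printing Implicit Defensive.

Import Order.TTheory GRing.Theory Num.Theory.
Import numFieldNormedType.Exports.

Local Open Scope classical_set_scope.
Local Open Scope ring_scope.

(** * Lebesgue measure and integration on R^d *)

(** The set [M] only gives zeros of g, and g is not known to be Schwartz: its transform h =
    |xi|^(2s) hat f may be singular at 0. What comes for free is that h decreases rapidly, so that g
    and all its derivatives are bounded, and both gap arguments for [M] start from this. The working
    class is therefore [nice] (measurable and rapidly decreasing), and differentiability of a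
    transform is obtained from a Taylor formula for the cosine under the integral sign. The identity
    hat g = h is a pointwise inversion formula, proved for continuous functions of this class with
    integrable transform; the summation kernel is exp(- e (|x_1| + ... + |x_d|)), whose transform is
    an elementary product. At 0 the factor |t|^q moves a leading term a_k t^k to order k + q. For q
    other than 1 no power series can match this order; for q = 1 the order fits and the parity is
    wrong. Exponential decay of f is what turns vanishing moments into a vanishing transform: there
    are nonzero Schwartz functions all of whose moments vanish. *)

Definition image_measure d d' (T1 : measurableType d) (T2 : measurableType d')
    (R : realFieldType) (m : {measure set T1 -> \bar R}) (f : T1 -> T2)
    (mf : measurable_fun setT f) : {measure set T2 -> \bar R} :=
  measure_function_pushforward__canonical__measure_function_Measure m mf.

Section affine_line.
Variable R : realType.
Local Open Scope ereal_scope.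

Local Notation leb := (@lebesgue_measure R).

Definition affine (a b : R) (x : measurableTypeR R) : measurableTypeR R :=
  (a * x + b)%R.

Lemma measurable_affine (a b : R) : measurable_fun [set: measurableTypeR R]
    (affine a b).
Proof. by apply: measurable_funD => //; exact: mulrl_measurable. Qed.

(** Lebesgue measure is determined by its values on the intervals []x, y]], so it suffices to check
    |a| times the pushforward there. For negative [a] the preimage of such an interval is closed on
    the left instead, with the same length. *)
Lemma lebesgue_measure_affine (a b : R) (A : set (measurableTypeR R)) :
  (a != 0)%R -> measurable A ->
  pushforward leb (affine a b) A =
  (`|a|^-1)%:E * leb A.
Proof.
move=> a0 mA.
have a1 : (0 < `|a|)%R by rewrite normr_gt0.
pose nu := mscale (NngNum (ltW a1)) (image_measure leb (measurable_affine a b)).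
have E : leb A = nu A.
  apply: lebesgue_measure_unique => // _ [[x y] _ <-].
  have [xy|yx] := ltP x y; last first.
    rewrite set_itv_ge ?bnd_simp -?leNgt//.
    by rewrite !measure0.
  rewrite [RHS](_ : _ = `|a|%:E * leb (affine a b @^-1` `]x, y]))//.
  have [a_gt0|a_le0] := ltP 0%R a.
    have -> : affine a b @^-1` `]x, y] =
        `]((x - b) / a)%R, ((y - b) / a)%R]%classic.
      apply/seteqP; split => t; rewrite /= !in_itv/= ltr_pdivrMr// ler_pdivlMr//;
       by rewrite ltrBlDr lerBrDr mulrC.
    rewrite !lebesgue_measure_itv/= !lte_fin xy. rewrite ltr_pM2r ?invr_gt0// ltrD2r xy.
    by rewrite -!EFinB -EFinM gtr0_norm//; congr EFin; field.
  have a_lt0 : (a < 0)%R by rewrite lt_neqAle a0.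
  have -> : affine a b @^-1` `]x, y] =
      `[((y - b) / a)%R, ((x - b) / a)%R[%classic.
    apply/seteqP; split => t; rewrite /= !in_itv/= ltr_ndivlMr// ler_ndivrMr//;
      rewrite ltrBlDr lerBrDr mulrC => /andP[? ?]; exact/andP.
  rewrite !lebesgue_measure_itv/= !lte_fin xy ltr_nM2r ?invr_lt0// ltrD2r xy.
  by rewrite -!EFinB -EFinM ltr0_norm//; congr EFin; field.
rewrite E [X in _ = _ * X](_ : _ = `|a|%:E * pushforward leb (affine a b) A)// muleA -EFinM mulVf ?mul1e//.
by rewrite normr_eq0.
Qed.

Lemma ge0_integral_affine (a b : R) (f : measurableTypeR R -> \bar R) :
  (a != 0)%R -> measurable_fun setT f -> (forall x, 0 <= f x) ->
  \int[leb]_x f (a * x + b)%R = (`|a|^-1)%:E * \int[leb]_x f x.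
Proof.
move=> a0 mf f0.
have a1 : (0 <= `|a|^-1)%R by rewrite invr_ge0.
have -> : \int[leb]_x f (a * x + b)%R = \int[image_measure leb (measurable_affine a b)]_x f x.
  by rewrite ge0_integral_pushforward//=; exact: measurable_affine.
transitivity (\int[mscale (NngNum a1) leb]_x f x).
  apply: eq_measure_integral => A mA _.
  exact: lebesgue_measure_affine.
by rewrite ge0_integral_mscale.
Qed.

End affine_line.

Section rV_integral.
Variable R : realType.
Local Open Scope ereal_scope.

Lemma ge0_integral_rV_cons d (f : 'rV[R]_d.+1 -> \bar R) :
  measurable_fun setT f -> (forall x, 0 <= f x) ->
  \int[lebesgue_rV]_x f x =
  \int[@lebesgue_measure R]_x \int[lebesgue_rV]_v f (rV_cons (x, v)).
Proof.
move=> mf f0.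
pose mC := @measurable_rV_cons R d.
rewrite [LHS](_ : _ = \int[image_measure (@lebesgue_measure R \x @lebesgue_rV R d)%E
   (@measurable_rV_cons R d)]_x f x)//.
rewrite ge0_integral_pushforward// preimage_setT.
rewrite fubini_tonelli1//=.
exact: measurableT_comp.
Qed.

(** Induction on the dimension: each coordinate that is split off contributes one factor 1/|a|, by
    the one-dimensional rule. *)
Lemma ge0_integral_rV_affine d (a : R) (b : 'rV[R]_d) (f : 'rV[R]_d -> \bar R) :
  (a != 0)%R -> measurable_fun setT f -> (forall x, 0 <= f x) ->
  \int[lebesgue_rV]_x f (a *: x + b)%R =
  (`|a| ^- d)%:E * \int[lebesgue_rV]_x f x.
Proof.
elim: d b f => [|d IH] b f a0 mf f0.
  by rewrite expr0 invr1 mul1e; apply: eq_integral => x _; rewrite [x]thinmx0 !thinmx0.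
have mab d' (c : 'rV[R]_d') : measurable_fun setT (fun x : 'rV[R]_d' => (a *: x + c)%R).
  apply: measurable_fun_rVP => i.
  rewrite (_ : _ \o _ = (fun x => (a * x + c ord0 i)%R) \o @rV_coord R d' i).
    apply: measurableT_comp; first exact: measurable_affine.
    exact: measurable_rV_coord.
  by apply/funext => x; rewrite /rV_coord/= !mxE.
pose b0 := (rV_uncons b).1; pose b1 := (rV_uncons b).2.
have E x v : (a *: rV_cons (x, v) + b)%R = rV_cons (a * x + b0, a *: v + b1)%R.
  apply/rowP => i; rewrite !mxE /=.
  by case: unliftP => [j ->|->]/=; rewrite ?mxE.
have mC := @measurable_rV_cons R d.
have mf' : measurable_fun setT (f \o @rV_cons R d) by exact: measurableT_comp.
have mF : measurable_fun [set: measurableTypeR R]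
    (fun x => \int[lebesgue_rV]_v f (rV_cons (x, v))).
  exact (@measurable_fun_fubini_tonelli_F _ _ _ _ _ lebesgue_rV (f \o @rV_cons R d) mf' (fun z => f0 _)).
rewrite ge0_integral_rV_cons//; last exact: (measurableT_comp mf (mab _ _)).
under eq_integral => x _.
  under eq_integral do rewrite E.
  rewrite (IH b1 (fun v => f (rV_cons (a * x + b0, v)%R)))//; last first.
    exact: measurableT_comp mf' (measurable_pair1 _).
  over.
rewrite ge0_integralZl//; last 2 first.
- exact: measurableT_comp mF (measurable_affine a b0).
- by move=> x _; exact: integral_ge0.
rewrite (@ge0_integral_affine _ _ _ (fun x => \int[lebesgue_rV]_v f (rV_cons (x, v))))//; first last.
- by move=> x; exact: integral_ge0.
rewrite -ge0_integral_rV_cons// muleA; congr (_ * _).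
by rewrite -EFinM; congr EFin; rewrite exprS invfM mulrC.
Qed.

Lemma ge0_integral_rV_prod d (k : R -> R) :
  measurable_fun setT k -> (forall x, (0 <= k x)%R) ->
  \int[lebesgue_rV]_x (\prod_(i < d) k (x ord0 i))%:E =
  \prod_(i < d) \int[@lebesgue_measure R]_x (k x)%:E.
Proof.
move=> mk k0; elim: d => [|d IH].
  rewrite big_ord0; under eq_integral do rewrite big_ord0.
  by rewrite integral_cst//= mul1e diracT.
have mprod d' : measurable_fun setT (fun x : 'rV[R]_d' => \prod_(i < d') k (x ord0 i))%R.
  apply: measurable_prod => i _.
  by apply: measurableT_comp => //; exact: measurable_rV_coord.
have p0 d' (x : 'rV[R]_d') : (0 <= (\prod_(i < d') k (x ord0 i)))%R by exact: prodr_ge0.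
have mprodE d' : measurable_fun setT (fun x : 'rV[R]_d' => (\prod_(i < d') k (x ord0 i))%:E).
  by apply/measurable_EFinP; exact: mprod.
rewrite (ge0_integral_rV_cons (mprodE d.+1)) => [|x]; last by rewrite lee_fin.
rewrite big_ord_recl.
have E x (v : 'rV[R]_d) : (\prod_(i < d.+1) k (rV_cons (x, v) ord0 i) =
     k x * \prod_(i < d) k (v ord0 i))%R.
  rewrite big_ord_recl; congr (k _ * _)%R; first by rewrite mxE unlift_none.
  by apply: eq_bigr => i _; rewrite mxE liftK.
have inner x : \int[lebesgue_rV]_v (\prod_(i < d.+1) k (rV_cons (x, v) ord0 i))%:E =
    (k x)%:E * \prod_(i < d) \int[@lebesgue_measure R]_x (k x)%:E.
  under eq_integral do rewrite E EFinM.
  rewrite -IH; apply: ge0_integralZl ; rewrite ?lee_fin//.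
    exact: mprodE.
  by move=> v _; rewrite lee_fin.
under eq_integral do rewrite inner.
apply: ge0_integralZr => //=.
- exact/measurable_EFinP.
- by move=> x _; rewrite lee_fin.
- by apply: prode_ge0 => i _; apply: integral_ge0 => x _; rewrite lee_fin.
Qed.

End rV_integral.

(** * Euclidean geometry and the Japanese bracket *)

Section euclid.
Variables (R : realType) (d : nat).
Implicit Types x y z : 'rV[R]_d.

Lemma dotpC x y : dotp x y = dotp y x.
Proof. by apply: eq_bigr => i _; rewrite mulrC. Qed.

Lemma dotpDl x y z : dotp (x + y) z = dotp x z + dotp y z.
Proof. by rewrite /dotp -big_split; apply: eq_bigr => i _; rewrite mxE mulrDl. Qed.

Lemma dotpZl (a : R) x z : dotp (a *: x) z = a * dotp x z.
Proof. by rewrite /dotp mulr_sumr; apply: eq_bigr => i _; rewrite mxE mulrA. Qed.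

Lemma dotpNl x z : dotp (- x) z = - dotp x z.
Proof. by rewrite -scaleN1r dotpZl mulN1r. Qed.

Lemma dotpBl x y z : dotp (x - y) z = dotp x z - dotp y z.
Proof. by rewrite dotpDl dotpNl. Qed.

Lemma dotp_delta x i : dotp x (delta_mx ord0 i) = x ord0 i.
Proof.
rewrite /dotp (bigD1 i)//= mxE !eqxx mulr1 big1 ?addr0// => j ji.
by rewrite mxE (negbTE ji) andbF mulr0.
Qed.

Lemma dotp_ge0 x : 0 <= dotp x x.
Proof. by apply: sumr_ge0 => i _; rewrite -expr2 sqr_ge0. Qed.

Lemma enorm_ge0 x : 0 <= enorm x. Proof. exact: sqrtr_ge0. Qed.

Lemma sqr_enorm x : enorm x ^+ 2 = dotp x x.
Proof. by rewrite sqr_sqrtr ?dotp_ge0. Qed.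

Lemma sqr_coord_le_dotp x i : x ord0 i ^+ 2 <= dotp x x.
Proof.
rewrite /dotp (bigD1 i)//= -expr2 lerDl; apply: sumr_ge0 => j _.
by rewrite -expr2 sqr_ge0.
Qed.

Lemma coord_le_enorm x i : `|x ord0 i| <= enorm x.
Proof. by rewrite -sqrtr_sqr ler_sqrt ?sqr_coord_le_dotp ?dotp_ge0. Qed.

Lemma enorm_eq0 x : enorm x = 0 -> x = 0.
Proof.
move=> x0; apply/rowP => i; rewrite mxE; apply/eqP; rewrite -normr_eq0 eq_le normr_ge0 andbT.
by rewrite -x0 coord_le_enorm.
Qed.

Lemma enorm0 : enorm (0 : 'rV[R]_d) = 0.
Proof. by rewrite /enorm /dotp big1 ?sqrtr0// => i _; rewrite mxE mul0r. Qed.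

Lemma enorm_gt0 x : x != 0 -> 0 < enorm x.
Proof.
move=> x0; rewrite lt_neqAle enorm_ge0 andbT eq_sym.
by apply: contra x0 => /eqP /enorm_eq0 ->.
Qed.

Lemma dotp_le_enorm x y : `|dotp x y| <= enorm x * enorm y.
Proof.
have [->|/enorm_gt0 x0] := eqVneq x 0.
  by rewrite enorm0 mul0r -(scale0r 0) dotpZl mul0r normr0.
have [->|/enorm_gt0 y0] := eqVneq y 0.
  by rewrite enorm0 mulr0 dotpC -(scale0r 0) dotpZl mul0r normr0.
(* Cauchy-Schwarz from the nonnegative square norm of [enorm y *: x + (e * enorm x) *: y]; the signs
   1 and -1 of [e] give the two halves of the absolute value. *)
have H (e : R) : e ^+ 2 = 1 -> - (e * dotp x y) <= enorm x * enorm y.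
  move=> e1; have := dotp_ge0 (enorm y *: x + (e * enorm x) *: y).
  rewrite !(dotpDl, dotpZl) ![dotp _ (_ + _)]dotpC !(dotpDl, dotpZl) -!sqr_enorm.
  rewrite (dotpC y x).
  have -> : enorm y * (enorm y * enorm x ^+ 2 + e * enorm x * dotp x y) +
   e * enorm x * (enorm y * dotp x y + e * enorm x * enorm y ^+ 2) =
    (enorm x * enorm y) * (enorm x * enorm y * (1 + e ^+ 2) + 2 * (e * dotp x y)) by ring.
  rewrite e1 pmulr_rge0 ?mulr_gt0//; lra.
rewrite ler_norml; apply/andP; split; last by have := H (-1); rewrite mulN1r opprK; apply; ring.
by have := H 1; rewrite mul1r expr1n => /(_ erefl); lra.
Qed.

Lemma enormZ (a : R) x : enorm (a *: x) = `|a| * enorm x.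
Proof.
rewrite /enorm dotpZl dotpC dotpZl mulrA -expr2 sqrtrM ?sqr_ge0//.
by rewrite sqrtr_sqr.
Qed.

Lemma enormN x : enorm (- x) = enorm x.
Proof. by rewrite -scaleN1r enormZ normrN1 mul1r. Qed.

Lemma enormD x y : enorm (x + y) <= enorm x + enorm y.
Proof.
rewrite -(@ler_pXn2r _ 2) ?nnegrE ?addr_ge0 ?enorm_ge0//.
rewrite sqrrD !sqr_enorm dotpDl ![dotp _ (_ + _)]dotpC !dotpDl (dotpC y x).
have := dotp_le_enorm x y; rewrite ler_norml => /andP[_]; lra.
Qed.

Lemma enormB x y : enorm (x - y) = enorm (y - x).
Proof. by rewrite -opprB enormN. Qed.

Lemma enorm_le_coord x : enorm x <= \sum_(i < d) `|x ord0 i|.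
Proof.
rewrite -(@ler_pXn2r _ 2) ?nnegrE ?enorm_ge0 ?sumr_ge0//.
rewrite sqr_enorm expr2 mulr_suml; apply: ler_sum => i _.
rewrite -expr2 -real_normK ?num_real// expr2 ler_wpM2l//.
by rewrite (bigD1 i)//= lerDl sumr_ge0.
Qed.

Lemma enorm_delta i : enorm (delta_mx ord0 i : 'rV[R]_d) = 1.
Proof. by rewrite /enorm dotp_delta mxE !eqxx sqrtr1. Qed.

(* The square of the Japanese bracket. *)
Definition jap x : R := 1 + dotp x x.

Lemma jap_ge1 x : 1 <= jap x. Proof. by rewrite lerDl dotp_ge0. Qed.

Lemma jap_gt0 x : 0 < jap x. Proof. exact: lt_le_trans (jap_ge1 x). Qed.

Lemma enorm_le_jap x : enorm x <= jap x.
Proof.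
rewrite /jap -sqr_enorm; have := sqr_ge0 (enorm x - 1); rewrite sqrrB1.
have := enorm_ge0 x; lra.
Qed.

(** A form of Peetre's inequality; it makes rapid decrease stable under translation. *)
Lemma japD x y : jap (x + y) <= 2 * jap x * jap y.
Proof.
have h := enormD x y.
rewrite /jap -!sqr_enorm; apply: (@le_trans _ _ (1 + (enorm x + enorm y) ^+ 2)).
  by rewrite lerD2l ler_pXn2r ?nnegrE ?addr_ge0 ?enorm_ge0.
have := sqr_ge0 (enorm x - enorm y).
have := mulr_ge0 (sqr_ge0 (enorm x)) (sqr_ge0 (enorm y)).
move: (enorm x) (enorm y) => a b; nra.
Qed.

End euclid.

Section measurability.
Variables (R : realType) (d : nat).

Lemma measurable_coord (i : 'I_d) :
  measurable_fun [set: 'rV[R]_d] (fun x : 'rV[R]_d => x ord0 i : R).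
Proof. exact: measurable_rV_coord. Qed.

(** The sigma-algebra is generated by the coordinates, so countability has to enter: an open set is
    the union of the boxes with rational centre and radius 1/(n+1) that it contains. *)
Lemma open_measurable_rV (O : set 'rV[R]_d) : open O -> measurable O.
Proof.
move=> oO.
pose box (p : 'rV[rat]_d * nat) : set 'rV[R]_d :=
  \bigcap_(i in [set: 'I_d]) [set x | `|x ord0 i - ratr (p.1 ord0 i)| < p.2.+1%:R^-1].
have mbox p : measurable (box p).
  apply: fin_bigcap_measurable => // i _.
  have /(_ measurableT) := @measurable_rV_coord R d i.
  move=> /(_ (ball (ratr (p.1 ord0 i) : R) (p.2.+1%:R^-1)) (measurable_ball _ _)).
  rewrite setTI; congr measurable; apply/seteqP; split => x /=;
    by rewrite /ball/= distrC.
have -> : O = \bigcup_p (if `[< box p `<=` O >] then box p else set0).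
  apply/seteqP; split => [x Ox|x [p _]]; last by case: asboolP => // h /h.
  have /nbhs_ballP[e /= e0 xe] : nbhs x O by exact: open_nbhs_nbhs.
  (* The box is centred at a rational point near [x], not at [x], so its radius must be below
     [e / 2]. *)
  pose n := Num.truncn (2 / e).
  have ne : n.+1%:R^-1 < e / 2.
    by rewrite invf_plt ?posrE ?divr_gt0// invf_div /n truncnS_gt.
  have /choice[q hq] : forall i, exists q : rat, `|x ord0 i - ratr q| < n.+1%:R^-1.
    move=> i; have : x ord0 i - n.+1%:R^-1 < x ord0 i + n.+1%:R^-1.
      by rewrite ltrD2l gt0_cp// invr_gt0.
    move=> /rat_in_itvoo[q]; rewrite in_itv/= => /andP[q1 q2]; exists q.
    by rewrite ltr_distlC; apply/andP; split => //; rewrite ltrBlDr.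
  exists (\row_i q i, n) => //.
  case: asboolP => [_ i _ /=|h]; first by rewrite mxE.
  exfalso; apply: h => y hy; apply: xe; split => // i j; rewrite (ord1 i).
  have := hy j I; rewrite /= mxE => hyj.
  rewrite /ball/= -(subrKA (ratr (q j))) (le_lt_trans (ler_normD _ _))//.
  by rewrite [in X in _ + X]distrC [ltRHS](splitr e) ltrD// (lt_trans _ ne).
apply: countable_bigcupT_measurable => [|p]; first exact: countableP.
by case: ifP.
Qed.

Lemma continuous_measurable_rV (u : 'rV[R]_d -> R) : continuous u ->
  measurable_fun [set: 'rV[R]_d] u.
Proof.
move=> /continuousP cu; apply: (measurability _ (RGenOpens.measurableE R)).
move=> _ [_ [a [b ->] <-]]; rewrite setTI; apply: open_measurable_rV.
exact/cu/interval_open.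
Qed.

Lemma measurable_dotp (y : 'rV[R]_d) :
  measurable_fun [set: 'rV[R]_d] (fun x : 'rV[R]_d => dotp x y).
Proof.
apply: measurable_sum => i; apply: measurable_funM => //; exact: measurable_coord.
Qed.

Lemma measurable_enorm : measurable_fun [set: 'rV[R]_d] (@enorm R d).
Proof.
apply: (@measurableT_comp _ _ _ _ _ _ (@Num.sqrt R)).
  by apply: continuous_measurable_fun; exact: sqrt_continuous.
apply: measurable_sum => i.
by apply: measurable_funM; exact: measurable_coord.
Qed.

End measurability.

(** * Rapid decrease as a source of integrability *)

Section rapid.
Variables (R : realType) (d : nat).
Implicit Types u v : 'rV[R]_d -> R.

Definition rapid u := forall N, exists C : R, forall x, `|u x| * jap x ^+ N <= C.

Definition igr u := lebesgue_rV.-integrable [set: 'rV[R]_d] (EFin \o u).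

Lemma rapid_le u v (K : R) m : rapid u ->
  (forall x, `|v x| <= K * (`|u x| * jap x ^+ m)) -> rapid v.
Proof.
move=> ru uv N; have [C hC] := ru (N + m)%N; exists (`|K| * C) => x.
have j0 k : 0 <= jap x ^+ k by rewrite exprn_ge0// ltW// jap_gt0.
apply: (@le_trans _ _ (`|K| * (`|u x| * jap x ^+ m) * jap x ^+ N)).
  rewrite ler_wpM2r// (le_trans (uv x))// ler_wpM2r ?ler_norm//.
  by rewrite mulr_ge0.
have -> : `|K| * (`|u x| * jap x ^+ m) * jap x ^+ N =
  `|K| * (`|u x| * jap x ^+ (N + m)) by rewrite exprD; ring.
by rewrite ler_wpM2l.
Qed.

Lemma integral_oneDsqrV :
  (\int[@lebesgue_measure R]_x ((oneDsqr x)^-1)%:E = pi%:E)%E.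
Proof.
rewrite ge0_symfun_integralT.
- rewrite (_ : [set x | _] = `[0, +oo[%classic); last first.
    by apply/seteqP; split => x /=; rewrite in_itv/= andbT.
  by rewrite integral0y_oneDsqr -EFinM; congr EFin; field.
- by move=> x; rewrite invr_ge0.
- exact: continuous_oneDsqrV.
- by move=> x; rewrite /oneDsqr/= sqrrN.
Qed.

Lemma measurable_oneDsqrV : measurable_fun setT (fun x : R => (oneDsqr x)^-1).
Proof. apply: continuous_measurable_fun; exact: continuous_oneDsqrV. Qed.

(** A product of one-variable functions, so that Tonelli yields the finite value [pi ^+ d]. It is
    the integrable majorant for rapidly decreasing functions. *)
Lemma igr_prod_oneDsqrV : igr (fun x : 'rV[R]_d => \prod_(i < d) (oneDsqr (x ord0 i))^-1).
Proof.
apply/integrableP; split.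
  apply/measurable_EFinP; apply: measurable_prod => i _.
  apply: (measurableT_comp measurable_oneDsqrV); exact: measurable_coord.
under eq_integral do rewrite gee0_abs ?lee_fin ?prodr_ge0//.
rewrite (@ge0_integral_rV_prod _ _ (fun x : R => (oneDsqr x)^-1))//; last first.
  exact: measurable_oneDsqrV.
under eq_bigr do rewrite integral_oneDsqrV.
by rewrite prodEFin ltry.
Qed.

Lemma prod_oneDsqr_le_jap (x : 'rV[R]_d) : \prod_(i < d) oneDsqr (x ord0 i) <= jap x ^+ d.
Proof.
rewrite -[X in _ ^+ X]card_ord -prodr_const; apply: ler_prod => i _.
by rewrite lerD2l sqr_coord_le_dotp andbT (le_trans _ (oneDsqr_ge1 _)).
Qed.

Lemma igr_rapid u : measurable_fun setT u -> rapid u -> igr u.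
Proof.
(* The exponent is [d] because each of the [d] factors 1 + x_i^2 is at most [jap x]. *)
move=> mu ru; have [C hC] := ru d.
have P0 (x : 'rV[R]_d) : 0 < \prod_(i < d) oneDsqr (x ord0 i).
  by apply: prodr_gt0 => i _; apply: lt_le_trans (oneDsqr_ge1 _).
apply: (@le_integrable _ _ R lebesgue_rV setT measurableT (EFin \o u)
  (EFin \o fun x => C * \prod_(i < d) (oneDsqr (x ord0 i))^-1)).
- exact/measurable_EFinP.
- move=> x _; rewrite lee_fin /=.
  rewrite prodfV (le_trans _ (ler_norm _))// ler_pdivlMr//.
  apply: le_trans (hC x); rewrite ler_wpM2l//.
  exact: prod_oneDsqr_le_jap.
- exact: integrableZl igr_prod_oneDsqrV.
Qed.

End rapid.

Section integral.
Variables (R : realType) (d : nat).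
Implicit Types u v p : 'rV[R]_d -> R.

Notation I u := (\int[@lebesgue_rV R d]_x u x).

Lemma igr_measurable u : igr u -> measurable_fun setT u.
Proof. by move=> /integrableP[/measurable_EFinP]. Qed.

Lemma igrD u v : igr u -> igr v -> igr (u \+ v).
Proof. by move=> iu iv; exact: integrableD iu iv. Qed.

Lemma igrZ (a : R) u : igr u -> igr (fun x => a * u x).
Proof. by move=> iu; exact: integrableZl iu. Qed.

Lemma igrB u v : igr u -> igr v -> igr (u \- v).
Proof. by move=> iu iv; exact: integrableB iu iv. Qed.

Lemma igr_norm u : igr u -> igr (fun x => `|u x|).
Proof. by move=> iu; exact: integrable_norm. Qed.

Lemma igr_le u v : measurable_fun setT u -> igr v ->
  (forall x, `|u x| <= v x) -> igr u.
Proof.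
move=> mu iv uv; apply: (@le_integrable _ _ R lebesgue_rV setT measurableT (EFin \o u) (EFin \o v)) => //.
  exact/measurable_EFinP.
by move=> x _; rewrite lee_fin (le_trans (uv x))// ler_norm.
Qed.

Lemma igrM u p (B : R) : igr u -> measurable_fun setT p ->
  (forall x, `|p x| <= B) -> igr (fun x => u x * p x).
Proof.
move=> iu mp pB; apply: (igr_le (v := fun x => B * `|u x|)).
- by apply: measurable_funM => //; exact: igr_measurable.
- exact/igrZ/igr_norm.
- by move=> x; rewrite normrM mulrC ler_wpM2r.
Qed.

Lemma eq_I u v : u =1 v -> I u = I v.
Proof. by move=> uv; apply: eq_Rintegral => x _. Qed.

Lemma I_D u v : igr u -> igr v -> I (u \+ v) = I u + I v.
Proof. by move=> iu iv; exact: RintegralD. Qed.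

Lemma I_B u v : igr u -> igr v -> I (u \- v) = I u - I v.
Proof. by move=> iu iv; exact: RintegralB. Qed.

Lemma I_Z (a : R) u : igr u -> I (fun x => a * u x) = a * I u.
Proof. by move=> iu; exact: RintegralZl. Qed.

Lemma I_le u v : igr u -> igr v -> (forall x, u x <= v x) -> I u <= I v.
Proof. by move=> iu iv uv; apply: le_Rintegral => //= x _. Qed.

Lemma I_abs_le u v : measurable_fun setT u -> igr v ->
  (forall x, `|u x| <= v x) -> `|I u| <= I v.
Proof.
move=> mu iv uv; have iu := igr_le mu iv uv.
rewrite (le_trans (le_normr_Rintegral _ iu))//.
by apply: I_le => //; exact: igr_norm.
Qed.

Lemma igr_sum (J : Type) (s : seq J) (w : J -> 'rV[R]_d -> R) :
  (forall j, igr (w j)) -> igr (fun x => \sum_(j <- s) w j x).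
Proof.
move=> iw; have := @integrable_sum _ _ R (@lebesgue_rV R d) setT measurableT _ s predT
  (fun j => EFin \o w j) (fun j _ => iw j).
by apply: eq_integrable => // x _ /=; rewrite sumEFin.
Qed.

Lemma I_sum (J : Type) (s : seq J) (w : J -> 'rV[R]_d -> R) :
  (forall j, igr (w j)) -> I (fun x => \sum_(j <- s) w j x) = \sum_(j <- s) I (w j).
Proof.
move=> iw; elim: s => [|j s IH].
  rewrite big_nil; under eq_I do rewrite big_nil.
  by rewrite Rintegral_cst//= mul0r.
rewrite big_cons -IH -I_D//; last exact: igr_sum.
by apply: eq_I => x; rewrite big_cons.
Qed.

Lemma measurable_rV_affine (a : R) (b : 'rV[R]_d) :
  measurable_fun setT (fun x : 'rV[R]_d => a *: x + b).
Proof.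
apply: measurable_fun_rVP => i.
rewrite (_ : _ \o _ = affine a (b ord0 i) \o @rV_coord R d i).
  apply: measurableT_comp; first exact: measurable_affine.
  exact: measurable_rV_coord.
by apply/funext => x; rewrite /rV_coord/= !mxE.
Qed.

Lemma igr_affine (a : R) (b : 'rV[R]_d) u : a != 0 -> igr u ->
  igr (fun x => u (a *: x + b)).
Proof.
move=> a0 iu; have mu := igr_measurable iu.
have mau := measurableT_comp mu (measurable_rV_affine a b).
apply/integrableP; split; first exact/measurable_EFinP.
rewrite (@ge0_integral_rV_affine _ _ a b (fun x => `|u x|%:E))//; last first.
  by apply/measurable_EFinP; exact: measurableT_comp.
rewrite lte_mul_pinfty ?lee_fin ?invr_ge0 ?exprn_ge0//.
by case/integrableP : iu.
Qed.

Lemma I_affine (a : R) (b : 'rV[R]_d) u : a != 0 -> igr u ->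
  I (fun x => u (a *: x + b)) = `|a| ^- d * I u.
Proof.
move=> a0 iu; have mu := igr_measurable iu.
have iau := igr_affine b a0 iu.
have mE : measurable_fun setT (EFin \o u) by exact/measurable_EFinP.
rewrite /Rintegral integralE.
have -> : (\int[lebesgue_rV]_x ((fun x => (u (a *: x + b))%:E)^\+ x) =
   (`|a| ^- d)%:E * \int[lebesgue_rV]_x ((EFin \o u)^\+ x))%E.
  have E := ge0_integral_rV_affine b a0 (measurable_funepos mE) (funepos_ge0 _).
  rewrite -E (_ : (fun x => (u (a *: x + b))%:E) = (EFin \o u) \o (fun x => a *: x + b))//.
  by rewrite funepos_comp.
have -> : (\int[lebesgue_rV]_x ((fun x => (u (a *: x + b))%:E)^\- x) =
   (`|a| ^- d)%:E * \int[lebesgue_rV]_x ((EFin \o u)^\- x))%E.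
  have E := ge0_integral_rV_affine b a0 (measurable_funeneg mE) (funeneg_ge0 _).
  rewrite -E (_ : (fun x => (u (a *: x + b))%:E) = (EFin \o u) \o (fun x => a *: x + b))//.
  by rewrite funeneg_comp.
rewrite -muleBr//; last first.
  by apply: fin_num_adde_defr; apply: integrable_pos_fin_num.
rewrite -integralE fineM//; exact: integrable_fin_num.
Qed.

Lemma I_odd u : igr u -> (forall x, u (- x) = - u x) -> I u = 0.
Proof.
move=> iu ou; have := @I_affine (-1) 0 u; rewrite oppr_eq0 oner_eq0 => /(_ isT iu).
rewrite normrN1 expr1n invr1 mul1r.
rewrite (@eq_I _ (fun x => -1 * u x)) ?I_Z//; first by lra.
by move=> x; rewrite scaleN1r addr0 ou mulN1r.
Qed.

(** Serves to discard the products of an even and an odd factor when the Fourier inversion integral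
    is compared with its Hartley form. *)
Lemma I_eq_odd u v : igr u -> igr v ->
  (forall x, u (- x) - v (- x) = - (u x - v x)) -> I u = I v.
Proof.
move=> iu iv uv; apply/eqP; rewrite -subr_eq0 -I_B//; apply/eqP.
by apply: I_odd => //; exact: igrB.
Qed.

(** A class without smoothness: it has to contain |xi|^q times a Hartley transform, which need not
    be differentiable at 0. *)
Definition nice u := measurable_fun setT u /\ rapid u.

Lemma nice_igr u : nice u -> igr u.
Proof. by case=> mu ru; exact: igr_rapid. Qed.

Lemma nice_le u v (K : R) m : nice u -> measurable_fun setT v ->
  (forall x, `|v x| <= K * (`|u x| * jap x ^+ m)) -> nice v.
Proof. by move=> [mu ru] mv h; split => //; exact: rapid_le h. Qed.

Lemma niceM u p (K : R) m : nice u -> measurable_fun setT p ->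
  (forall x, `|p x| <= K * jap x ^+ m) -> nice (fun x => u x * p x).
Proof.
move=> nu mp pK; apply: (nice_le (K := K) (m := m) nu).
  by apply: measurable_funM => //; case: nu.
by move=> x; rewrite normrM mulrCA ler_wpM2l.
Qed.

Lemma nice_norm u : nice u -> nice (fun x => `|u x|).
Proof.
move=> nu; apply: (nice_le (K := 1) (m := 0) nu); last by move=> x; rewrite normr_id mul1r mulr1.
by apply: measurableT_comp => //; case: nu.
Qed.

Lemma niceD u v : nice u -> nice v -> nice (u \+ v).
Proof.
move=> [mu ru] [mv rv]; split; first exact: measurable_funD.
move=> N; have [C hC] := ru N; have [C' hC'] := rv N; exists (C + C') => x.
rewrite (le_trans _ (lerD (hC x) (hC' x)))// -mulrDl ler_wpM2r ?ler_normD//.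
by rewrite exprn_ge0// ltW// jap_gt0.
Qed.

Lemma niceN u : nice u -> nice (\- u).
Proof.
move=> nu; apply: (nice_le (K := 1) (m := 0) nu).
  by apply: measurable_funN => //; case: nu.
by move=> x; rewrite /= normrN mulr1 mul1r.
Qed.

Lemma jap_shift (x b : 'rV[R]_d) : jap x <= 2 * jap b * jap (x + b).
Proof.
have := japD (x + b) (- b); rewrite addrK => /le_trans; apply.
rewrite {2}/jap dotpNl dotpC dotpNl opprK -/(jap b).
by rewrite mulrAC.
Qed.

(** The bound is uniform in [b] because the translation will be an intermediate point of a mean
    value theorem, depending on [x] in an uncontrolled way. *)
Lemma rapid_shift u N : rapid u -> exists2 C, 0 <= C & forall x b, enorm b <= 1 ->
   `|u (x + b)| * jap x ^+ N <= C.
Proof.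
move=> ru; have [C hC] := ru N; exists (4 ^+ N * `|C|); first by rewrite mulr_ge0 ?exprn_ge0.
move=> x b b1.
have j0 := ltW (jap_gt0 (x + b)).
have jb : jap b <= 2 by rewrite /jap -sqr_enorm -[leRHS]/(1 + 1) lerD2l expr_le1 ?enorm_ge0.
apply: (@le_trans _ _ (`|u (x + b)| * (4 * jap (x + b)) ^+ N)).
  rewrite ler_wpM2l// lerXn2r ?nnegrE ?mulr_ge0//; first by rewrite ltW ?jap_gt0.
  rewrite (le_trans (jap_shift x b))// ler_wpM2r//; lra.
rewrite exprMn mulrCA ler_wpM2l ?exprn_ge0// (le_trans (hC _))// ler_norm//.
Qed.

End integral.

Local Notation I u := (\int[lebesgue_rV]_x u x).

Section fubini.
Variables (R : realType) (d : nat).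
Implicit Types u v : 'rV[R]_d -> R.

Lemma I_fubini u v (K : 'rV[R]_d * 'rV[R]_d -> R) (B : R) : igr u -> igr v ->
  measurable_fun setT K -> (forall z, `|K z| <= B) ->
  I (fun x => u x * I (fun y => v y * K (x, y))) =
  I (fun y => v y * I (fun x => u x * K (x, y))).
Proof.
move=> iu iv mK KB; have mu := igr_measurable iu; have mv := igr_measurable iv.
have B0 : 0 <= B by apply: le_trans (KB (0, 0)).
pose f (z : 'rV[R]_d * 'rV[R]_d) := u z.1 * (v z.2 * K z).
have mf : measurable_fun setT f.
  apply: measurable_funM; first exact: measurableT_comp mu measurable_fst.
  by apply: measurable_funM => //; exact: measurableT_comp mv measurable_snd.
have iKx x : igr (fun y => v y * K (x, y)).
  apply: (igrM (B := B)) => //.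
  exact: measurableT_comp mK (pair1_measurable _).
have iKy y : igr (fun x => u x * K (x, y)).
  apply: (igrM (B := B)) => //.
  exact: measurableT_comp mK (pair2_measurable _).
have fin1 x : (\int[lebesgue_rV]_y (f (x, y))%:E =
    (u x * I (fun y => v y * K (x, y)))%:E)%E.
  rewrite -I_Z//  /Rintegral fineK//; apply: integrable_fin_num => //.
  exact: igrZ.
have fin2 y : (\int[lebesgue_rV]_x (f (x, y))%:E =
    (v y * I (fun x => u x * K (x, y)))%:E)%E.
  rewrite -I_Z// /Rintegral fineK; last by apply: integrable_fin_num => //; exact: igrZ.
  by apply: eq_integral => x _; rewrite /f/= mulrCA.
(* Integrability on the product space comes from the majorant B |u x| |v y|, integrated first in [y]
   and then in [x]. *)
have iF : (lebesgue_rV \x lebesgue_rV)%E.-integrable setT (EFin \o f).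
  apply/integrable12ltyP; first exact/measurable_EFinP.
  apply: (@le_lt_trans _ _ (\int[lebesgue_rV]_x (`|u x| * (B * I (fun y => `|v y|)))%:E)%E).
    apply: ge0_le_integral => //.
    - by move=> x _; exact: integral_ge0.
    - have mabs : measurable_fun setT (abse \o (EFin \o f)).
        by apply: measurableT_comp => //; exact/measurable_EFinP.
      exact (@measurable_fun_fubini_tonelli_F _ _ _ _ _ lebesgue_rV _ mabs (fun z => abse_ge0 _)).
    - by apply/measurable_EFinP; apply: measurable_funM => //; exact: measurableT_comp.
    move=> x _.
    have -> : (`|u x| * (B * I (fun y => `|v y|)))%:E =
       (\int[lebesgue_rV]_y (`|u x| * B * `|v y|)%:E)%E.
      rewrite mulrA -I_Z ?igr_norm// /Rintegral fineK//; apply: integrable_fin_num => //.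
      exact/igrZ/igr_norm.
    apply: ge0_le_integral => //=.
    - apply/measurable_EFinP; apply: measurableT_comp => //.
      exact: measurableT_comp mf (pair1_measurable _).
    - by apply/measurable_EFinP; apply: measurable_funM => //; exact: measurableT_comp.
    move=> y _; rewrite lee_fin /f/= !normrM -mulrA ler_wpM2l// mulrC ler_wpM2r//.
  under eq_integral do rewrite EFinM.
  have := igrZ (B * I (fun y => `|v y|)) (igr_norm iu).
  move=> /integrableP[_]; apply: le_lt_trans; apply: ge0_le_integral => //=.
  - by move=> x _; rewrite -EFinM lee_fin !mulr_ge0//; apply: Rintegral_ge0.
  - apply/measurable_EFinP; apply: measurable_funM => //; exact: measurableT_comp.
  - by apply/measurable_EFinP; apply: measurableT_comp => //; apply: measurable_funM => //; exact: measurableT_comp.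
  by move=> x _; rewrite -EFinM lee_fin mulrC ler_norm.
have := Fubini iF.
under eq_integral do rewrite fin1.
under [in X in _ = X -> _]eq_integral do rewrite fin2.
by rewrite /Rintegral => ->.
Qed.

End fubini.

(** * Taylor estimates *)

Section calculus.
Variable R : realType.

(** The intermediate point is written as a convex combination, so that no order between [a] and [b]
    has to be fixed. *)
Lemma MVT_param (f f' : R -> R) (a b : R) :
  (forall x : R, is_derive x 1 f (f' x)) ->
  exists2 t, 0 <= t <= 1 & f b - f a = f' (a + t * (b - a)) * (b - a).
Proof.
move=> df; have cf : continuous f.
  by move=> x; apply/differentiable_continuous/derivable1_diffP; have [] := df x.
have main x y : x <= y -> exists2 t, 0 <= t <= 1 & f y - f x = f' (x + t * (y - x)) * (y - x).
  rewrite le_eqVlt => /predU1P[->|xy].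
    by exists 0; rewrite ?lexx ?ler01// !subrr !mulr0.
  have [|c] := @MVT R f f' _ _ xy (fun x _ => df x).
    by apply: continuous_subspaceT => z; exact: cf.
  rewrite in_itv/= => /andP[xc cy] E; exists ((c - x) / (y - x)).
    by rewrite divr_ge0 ?subr_ge0 ?(ltW xc) ?(ltW xy)//= ler_pdivrMr ?subr_gt0// mul1r lerD2r ltW.
  by rewrite divfK ?subr_eq0 ?gt_eqF// subrKC.
have [/main//|/ltW/main[t /andP[t0 t1] E]] := leP a b.
exists (1 - t); first by rewrite subr_ge0 t1 lerBlDr lerDl t0.
rewrite -opprB E -mulrN opprB; congr (f' _ * _); ring.
Qed.

(** For t >= 0, induction on the order: the derivative of the remainder is the remainder one order
    lower for the shifted sequence, and the mean value theorem integrates the bound. Negative [t]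
    follows by reflection. *)
Lemma taylor_bound (c : nat -> R -> R) (B : R) (N : nat) (t : R) :
  (forall j (x : R), is_derive x 1 (c j) (c j.+1 x)) -> (forall j x, `|c j x| <= B) ->
  `|c 0%N t - \sum_(j < N) c j 0 * t ^+ j / j`!%:R| <= B * `|t| ^+ N / N`!%:R.
Proof.
pose p n (e : nat -> R -> R) : {poly R} := \poly_(j < n) (e j 0 / j`!%:R).
pose P n e (x : R) : R := (p n e).[x].
have PE n e x : P n e x = \sum_(j < n) e j 0 * (x ^+ j / j`!%:R).
  by rewrite /P horner_poly; apply: eq_bigr => j _; rewrite mulrAC mulrA.
have dP n (e : nat -> R -> R) (x : R) : is_derive x 1 (P n.+1 e) (P n (fun j => e j.+1) x).
  rewrite /P (_ : p n (fun j => e j.+1) = (p n.+1 e)^`()); first exact: is_derive_poly.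
  apply/polyP => i; rewrite coef_deriv !coef_poly ltnS; case: ifP => _; last by rewrite mul0rn.
  rewrite factS natrM invfM -[RHS]mulr_natr -mulrA; congr (_ * _).
  by rewrite mulrAC mulVf ?mul1r// pnatr_eq0.
have pos n : forall e : nat -> R -> R, (forall j (x : R), is_derive x 1 (e j) (e j.+1 x)) ->
  (forall j x, `|e j x| <= B) -> forall x, 0 <= x -> `|e 0%N x - P n e x| <= B * (x ^+ n / n`!%:R).
  elim: n => [|n IH] e de eB x x0.
    by rewrite PE big_ord0 subr0 expr0 fact0 divr1 mulr1.
  have main (s : R) : `|s| = 1 -> s * (e 0%N x - P n.+1 e x) <= B * (x ^+ n.+1 / n.+1`!%:R).
    move=> s1.
    (* [Q] is the coefficient sequence of B y^(n+1) / (n+1)!, so that [dP] differentiates the bound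
       exactly as it differentiates the Taylor polynomial. *)
    pose Q j (y : R) : R := if j == n.+1 then B else 0.
    have QE m y : (m <= n.+1)%N -> P m.+1 (fun j => Q (n.+1 - m + j)%N) y = B * (y ^+ m / m`!%:R).
      move=> mn; rewrite PE big_ord_recr/= big1 ?add0r; last first.
        move=> j _; rewrite /Q ifF ?mul0r//; apply/negbTE.
        rewrite neq_ltn; apply/orP; left.
        by rewrite -[ltnRHS](subnK mn) ltn_add2l.
      by rewrite /Q subnK// eqxx.
    pose g y := P n.+2 Q y - s * (e 0%N y - P n.+1 e y).
    pose g' y := P n.+1 (fun j => Q j.+1) y - s * (e 1%N y - P n (fun j => e j.+1) y).
    have dg (y : R) : is_derive y 1 g (g' y).
      have -> : g = (P n.+2 Q) - (s *: (e 0%N - P n.+1 e)) by [].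
      by apply: is_deriveB; apply: is_deriveZ; apply: is_deriveB.
    have [r /andP[r0 r1]] := MVT_param 0 x dg.
    have -> : g 0 = 0.
      rewrite /g (_ : P n.+2 Q 0 = 0); last first.
        rewrite PE big_ord_recl/= big1; first by rewrite /Q/= mul0r addr0.
        by move=> j _; rewrite exprS !mul0r mulr0.
      rewrite (_ : P n.+1 e 0 = e 0%N 0) ?subrr ?mulr0 ?subrr//.
      rewrite PE big_ord_recl/= big1 ?addr0 ?expr0 ?fact0 ?divr1 ?mulr1// => j _.
      by rewrite exprS !mul0r mulr0.
    rewrite !subr0 add0r => gE.
    have : 0 <= g x.
      rewrite gE mulr_ge0// /g' subr_ge0.
      have := QE n (r * x) (leqnSn _); rewrite subSnn.
      under eq_fun do rewrite add1n.
      move=> ->; rewrite (le_trans (ler_norm _))// normrM s1 mul1r.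
      by apply: (IH (fun j => e j.+1)) => //; rewrite mulr_ge0.
    by rewrite /g subr_ge0 -(QE n.+1)// subnn.
  rewrite ler_norml; apply/andP; split.
    by have := main (-1); rewrite normrN1 mulN1r lerNl; exact.
  by have := main 1; rewrite normr1 mul1r; exact.
move=> dc cB.
have PNE e x : P N e x = \sum_(j < N) e j 0 * x ^+ j / j`!%:R.
  by rewrite PE; apply: eq_bigr => j _; rewrite mulrA.
have [t0|/ltW t0] := leP 0 t.
  by have := pos N c dc cB t t0; rewrite PNE mulrA (ger0_norm t0).
(* The derivatives of the reflected function x |-> c_0(-x). *)
pose e j (x : R) := (-1) ^+ j * c j (- x).
have de j (x : R) : is_derive x 1 (e j) (e j.+1 x).
  have -> : e j = (-1) ^+ j \*: (c j \o -%R) by [].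
  have H : is_derive x 1 (c j \o -%R) (- c j.+1 (- x)).
    by rewrite -mulrN1; exact: is_derive1_comp.
  rewrite (_ : e j.+1 x = (-1) ^+ j *: (- c j.+1 (- x))); first exact: is_deriveZ.
  by rewrite /e exprS /GRing.scale/=; ring.
have eB j x : `|e j x| <= B by rewrite normrM normrX normrN1 expr1n mul1r.
have := pos N e de eB (- t); rewrite oppr_ge0 => /(_ t0).
rewrite PNE /e expr0 mul1r opprK mulrA (ler0_norm t0).
rewrite (_ : \sum_(j < N) _ = \sum_(j < N) c j 0 * t ^+ j / j`!%:R)//.
apply: eq_bigr => j _; rewrite oppr0 (exprNn t); congr (_ / _).
by rewrite mulrACA -expr2 sqrr_sign mul1r.
Qed.

(** Each derivative of the cosine adds pi/2 to the phase, so all of them are bounded by 1. *)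
Lemma cos_taylor (p t : R) N :
  `|cos (p + t) - \sum_(j < N) cos (p + j%:R * (pi / 2)) * t ^+ j / j`!%:R| <=
  `|t| ^+ N / N`!%:R.
Proof.
have := @taylor_bound (fun j x => cos (p + j%:R * (pi / 2) + x)) 1 N t.
rewrite mul1r mul0r addr0; under eq_bigr do rewrite addr0.
apply => j x; last exact: cos_max.
have -> : cos (p + j.+1%:R * (pi / 2) + x) = - sin (p + j%:R * (pi / 2) + x).
  by rewrite -cosDpihalf; congr cos; rewrite -natr1; ring.
have H : is_derive x 1 (cst (p + j%:R * (pi / 2)) + id) (0 + 1) by exact: is_deriveD.
by have := is_derive1_comp (is_derive_cos _) H; rewrite add0r mulr1.
Qed.

Lemma cos_quad (t : R) : `|cos t - 1| <= t ^+ 2.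
Proof.
have := cos_taylor 0 t 2; rewrite !big_ord_recr big_ord0 /=.
rewrite !(add0r, mul0r, mul1r, cos0, cos_pihalf, addr0, expr0, fact0, divr1).
rewrite real_normK ?num_real// => /le_trans; apply.
by rewrite ler_pdivrMr// ler_peMr ?sqr_ge0// ler1n.
Qed.

Lemma sin_quad (t : R) : `|sin t - t| <= t ^+ 2.
Proof.
have := cos_taylor (- (pi / 2)) t 2; rewrite !big_ord_recr big_ord0 /=.
rewrite (addrC (- (pi / 2)) t) cosBpihalf !(add0r, mul0r, mul1r, cosN, addNr, cos0, cos_pihalf, addr0, expr0, expr1, fact0, divr1).
rewrite real_normK ?num_real// => /le_trans; apply.
by rewrite ler_pdivrMr// ler_peMr ?sqr_ge0// ler1n.
Qed.

Lemma cos_lipschitz (x y : R) : `|cos x - cos y| <= `|x - y|.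
Proof.
have [t _ ->] := @MVT_param cos (fun x => - sin x) y x (fun x => is_derive_cos x).
by rewrite normrM ler_piMl// normrN sin_max.
Qed.

End calculus.

(** * The Fourier transform of a Schwartz function *)

Section directional.
Variables (R : realType) (d : nat).
Implicit Types u : 'rV[R]_d -> R.

Lemma is_derive_line u (x v : 'rV[R]_d) (t : R) :
  differentiable u (x + t *: v) ->
  is_derive t 1 (fun s : R => u (x + s *: v)) ('D_v u (x + t *: v)).
Proof.
move=> du.
have E : (fun h : R => h^-1 *: (((fun s : R => u (x + s *: v)) \o shift t) (h *: 1) -
            (fun s : R => u (x + s *: v)) t)) =
         (fun h : R => h^-1 *: ((u \o shift (x + t *: v)) (h *: v) - u (x + t *: v))).
  apply/funext => h /=; rewrite (_ : h *: 1 = h); last exact: mulr1.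
  by rewrite scalerDl addrCA.
apply: DeriveDef; last by rewrite /derive E.
by rewrite /derivable E; exact: diff_derivable.
Qed.

Lemma derive_row_sum u (x v : 'rV[R]_d) : differentiable u x ->
  'D_v u x = \sum_(i < d) v ord0 i * 'D_(delta_mx ord0 i : 'rV[R]_d) u x.
Proof.
move=> du; rewrite deriveE// {1}[v]row_sum_delta linear_sum; apply: eq_bigr => i _.
by rewrite linearZ /= deriveE.
Qed.

Lemma enorm_lipschitz u (K : R) (x y : 'rV[R]_d) :
  (forall z, differentiable u z) ->
  (forall i z, `|'D_(delta_mx ord0 i : 'rV[R]_d) u z| <= K) ->
  `|u y - u x| <= K *+ d * enorm (y - x).
Proof.
move=> du Ku.
have [t _] := @MVT_param _ (fun s : R => u (x + s *: (y - x))) _ 0 1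
  (fun s => is_derive_line (du _)).
rewrite scale0r scale1r addr0 subrKC => ->.
rewrite subr0 mulr1 derive_row_sum// (le_trans (ler_norm_sum _ _ _))//.
rewrite mulrnAl -[d in _ *+ d]card_ord -sumr_const.
by apply: ler_sum => i _; rewrite normrM mulrC ler_pM// coord_le_enorm.
Qed.

Lemma taylor2_delta u (x : 'rV[R]_d) (i : 'I_d) (t : R) :
  let e : 'rV[R]_d := delta_mx ord0 i in
  (forall z, differentiable u z) -> (forall z, differentiable ('D_e u) z) ->
  exists2 s : R, `|s| <= `|t| &
    `|u (x + t *: e) - u x - t * 'D_e u x| <= t ^+ 2 * `|'D_e ('D_e u) (x + s *: e)|.
Proof.
move=> e du ddu.
have [r /andP[r0 r1]] := @MVT_param _ (fun s : R => u (x + s *: e)) _ 0 t (fun s => is_derive_line (du _)).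
rewrite scale0r addr0 !subr0 add0r => ->.
have [q /andP[q0 q1]] := @MVT_param _ (fun s : R => 'D_e u (x + s *: e)) _ 0 (r * t) (fun s => is_derive_line (ddu _)).
rewrite scale0r addr0 !subr0 add0r => E.
exists (q * (r * t)).
  by rewrite !normrM (ger0_norm q0) (ger0_norm r0) mulrA ler_piMl// mulr_ile1.
set D1 := 'D_e u (x + _); set D2 := 'D_e ('D_e u) _ in E *.
have -> : D1 * t - t * 'D_e u x = r * (t ^+ 2 * D2).
  by rewrite mulrC -mulrBr E; ring.
by rewrite -[X in X * `|_|](ger0_norm (sqr_ge0 t)) -normrM (normrM r) (ger0_norm r0) ler_piMl.
Qed.

End directional.

Section schwartz.
Variables (R : realType) (d : nat).
Implicit Types u : 'rV[R]_d -> R.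

Notation "''d_' i u" := ('D_(delta_mx ord0 i : 'rV[R]_d) u) (at level 10, i at level 0, u at level 9).

Lemma schwartz_partial u i : real_schwartz u -> real_schwartz ('d_i u).
Proof.
move=> [su du]; have E s : partials s ('d_i u) = partials (rcons s i) u.
  by rewrite /partials foldr_rcons.
split => [s x|k s]; first by rewrite E; exact: su.
by have [C hC] := du k (rcons s i); exists C => x; rewrite E.
Qed.

Lemma schwartz_differentiable u : real_schwartz u -> forall x, differentiable u x.
Proof. by move=> [su _] x; exact: (su [::]). Qed.

Lemma schwartz_continuous u : real_schwartz u -> continuous u.
Proof. by move=> su x; apply: differentiable_continuous; exact: schwartz_differentiable. Qed.

(** Induction on the power of [jap]: one more factor is 1 + sum x_i^2, and each function x_i^2 u
    satisfies the same hypothesis, with the i-th exponent raised by 2. *)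
Lemma rapid_monomials u :
  (forall k : 'I_d -> nat, exists C : R, forall x : 'rV[R]_d,
     `|(\prod_(i < d) x ord0 i ^+ k i) * u x| <= C) -> rapid u.
Proof.
move=> hu N; elim: N u hu => [|N IH] u hu.
  have [C hC] := hu (fun _ => 0%N); exists C => x.
  by have := hC x; rewrite big1 ?mul1r ?mulr1.
have [C hC] := IH u hu.
have /choice[D hD] : forall i : 'I_d, exists C : R, forall x : 'rV[R]_d,
    `|x ord0 i ^+ 2 * u x| * jap x ^+ N <= C.
  move=> i; apply: (IH (fun x => x ord0 i ^+ 2 * u x)) => k.
  have [C' hC'] := hu (fun j => if j == i then (k i).+2 else k j).
  exists C' => x; rewrite (le_trans _ (hC' x))// le_eqVlt; apply/orP; left; apply/eqP.
  congr (`|_|); rewrite mulrA; congr (_ * _).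
  rewrite (bigD1 i)//= [RHS](bigD1 i)//= eqxx mulrAC -exprD addn2; congr (_ * _).
  by apply: eq_bigr => j /negbTE ->.
exists (C + \sum_(i < d) D i) => x.
rewrite exprS {1}/jap mulrCA mulrDl mul1r lerD//.
rewrite /dotp mulr_suml; apply: ler_sum => i _.
by apply: le_trans (hD i x); rewrite normrM (ger0_norm (sqr_ge0 _)) expr2 mulrA.
Qed.

Lemma schwartz_nice u : real_schwartz u -> nice u.
Proof.
move=> su; split; first by apply: continuous_measurable_rV; exact: schwartz_continuous.
apply: rapid_monomials => k; have [_ /(_ k [::])[C hC]] := su.
by exists C => x; exact: hC.
Qed.

End schwartz.

Section fourier.
Variables (R : realType) (d : nat).
Implicit Types (u v : 'rV[R]_d -> R) (x xi : 'rV[R]_d).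

Notation "''d_' i u" := ('D_(delta_mx ord0 i : 'rV[R]_d) u) (at level 10, i at level 0, u at level 9).

(* A real form of the Fourier transform of [u]: phase [0] gives its
   cosine part and phase [- pi / 2] its sine part. *)
Definition F u xi (p : R) : R := I (fun x => u x * cos (2 * pi * dotp x xi + p)).

Lemma measurable_cosphase xi (p : R) :
  measurable_fun setT (fun x => cos (2 * pi * dotp x xi + p)).
Proof.
apply: (@measurableT_comp _ _ _ _ _ _ (@cos R)).
  by apply: continuous_measurable_fun; exact: continuous_cos.
apply: measurable_funD => //; apply: measurable_funM => //; exact: measurable_dotp.
Qed.

Lemma igr_cosphase u xi p : igr u -> igr (fun x => u x * cos (2 * pi * dotp x xi + p)).
Proof.
move=> iu; apply: (igrM (B := 1)) => //; first exact: measurable_cosphase.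
by move=> x; exact: cos_max.
Qed.

Lemma F_bound u xi p : igr u -> `|F u xi p| <= I (fun x => `|u x|).
Proof.
move=> iu; apply: I_abs_le; last 1 first.
- by move=> x; rewrite normrM ler_piMr// cos_max.
- by have /igr_measurable := igr_cosphase xi p iu.
- exact: igr_norm.
Qed.

Lemma F_phaseD u xi p q : igr u ->
  F u xi (p + q) = cos q * F u xi p + sin q * F u xi (p + pi / 2).
Proof.
move=> iu; rewrite /F -!I_Z; try exact: igr_cosphase.
rewrite -I_D; try by apply: igrZ; exact: igr_cosphase.
by apply: eq_I => x /=; rewrite !addrA cosDpihalf cosD; ring.
Qed.

Lemma F_shift u xi p b : igr u ->
  F (fun x => u (x + b)) xi p = F u xi (p - 2 * pi * dotp b xi).
Proof.
move=> iu; rewrite /F.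
have := I_affine b (oner_neq0 R) (igr_cosphase xi (p - 2 * pi * dotp b xi) iu).
rewrite normr1 expr1n invr1 mul1r => <-; apply: eq_I => x; rewrite scale1r dotpDl.
by congr (_ * cos _); ring.
Qed.

Lemma le_quadratic_eq0 (a K : R) : (forall t, 0 < t <= 1 -> t * `|a| <= K * t ^+ 2) -> a = 0.
Proof.
move=> h; apply/eqP; rewrite -normr_eq0; apply/negPn/negP => a0.
have {}a0 : 0 < `|a| by rewrite normr_gt0 -normr_eq0.
have K0 : 0 < K.
  by have := h 1; rewrite ltr01 lexx expr1n mulr1 mul1r => /(_ isT); exact: lt_le_trans.
(* Small enough that K t <= |a| / 2, which contradicts |a| <= K t. *)
pose t := Num.min 1 (`|a| / (2 * K)).
have t0 : 0 < t by rewrite /t lt_min ltr01 divr_gt0// mulr_gt0.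
have := h t; rewrite t0 /t ge_min lexx -/t => /(_ isT).
rewrite expr2 mulrCA ler_pM2l// => aKt.
have : K * t <= `|a| / 2.
  rewrite (le_trans (_ : _ <= K * (`|a| / (2 * K))))//.
    by rewrite ler_pM2l// /t ge_min lexx orbT.
  rewrite le_eqVlt; apply/orP; left; apply/eqP; field.
  by rewrite gt_eqF.
lra.
Qed.

(** In place of integration by parts: translating [u] by t e_i changes only the phase ([F_shift]),
    while [taylor2_delta] replaces the translate by u + t d_i u up to t^2 times an integrable
    majorant. Comparing the terms linear in [t] gives the identity. *)
Lemma F_partial u i xi p : real_schwartz u ->
  F ('d_i u) xi p = - (2 * pi * xi ord0 i) * F u xi (p + pi / 2).
Proof.
move=> su; set e : 'rV[R]_d := delta_mx ord0 i.
have nu := schwartz_nice su; have iu := nice_igr nu.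
have su1 : real_schwartz ('D_e u) by exact: schwartz_partial.
have nu1 := schwartz_nice su1; have iu1 := nice_igr nu1.
have [_ ru2] := schwartz_nice (schwartz_partial i su1).
have [C C0 hC] := rapid_shift d ru2.
pose w (x : 'rV[R]_d) := \prod_(j < d) (oneDsqr (x ord0 j))^-1.
pose b := 2 * pi * xi ord0 i.
apply/eqP; rewrite -subr_eq0; apply/eqP.
apply: (@le_quadratic_eq0 _ (C * I w + b ^+ 2 * `|F u xi p| + b ^+ 2 * `|F u xi (p + pi / 2)|)).
move=> t /andP[t0 t1].
pose r x := u (x + t *: e) - u x - t * 'D_e u x.
have ish : igr (fun x => u (x + t *: e)).
  have := igr_affine (t *: e) (oner_neq0 R) iu.
  by under eq_fun do rewrite scale1r.
have ir : igr r by apply: igrB; [exact: igrB|exact: igrZ].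
have rw x : `|r x| <= t ^+ 2 * C * w x.
  have [s st] := @taylor2_delta _ _ u x i t (schwartz_differentiable su) (schwartz_differentiable su1).
  move=> /le_trans; apply; rewrite -mulrA ler_wpM2l ?sqr_ge0//.
  have se : enorm (s *: e) <= 1.
    by rewrite enormZ enorm_delta mulr1 (le_trans st)// ger0_norm// ltW.
  have P0 : 0 < \prod_(j < d) oneDsqr (x ord0 j).
    by apply: prodr_gt0 => j _; apply: lt_le_trans (oneDsqr_ge1 _).
  rewrite /w prodfV ler_pdivlMr// (le_trans _ (hC x _ se))// ler_wpM2l//.
  exact: prod_oneDsqr_le_jap.
have Fr : F r xi p = F u xi (p - t * b) - F u xi p - t * F ('D_e u) xi p.
  rewrite (_ : p - t * b = p - 2 * pi * dotp (t *: e) xi); last first.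
    by rewrite dotpZl dotpC dotp_delta /b; congr (_ - _); ring.
  rewrite -F_shift// /F -I_Z; last exact: igr_cosphase.
  rewrite -I_B; try exact: igr_cosphase.
  rewrite -I_B; [|by apply: igrB; exact: igr_cosphase|by apply: igrZ; exact: igr_cosphase].
  by apply: eq_I => x /=; rewrite /r; ring.
have Frb : `|F r xi p| <= t ^+ 2 * C * I w.
  have iw : igr w by exact: igr_prod_oneDsqrV.
  rewrite -I_Z//; apply: I_abs_le; last 1 first.
  - by move=> x; rewrite normrM (le_trans _ (rw x))// ler_piMr// cos_max.
  - by have /igr_measurable := igr_cosphase xi p ir.
  - exact: igrZ.
have := F_phaseD xi p (- (t * b)) iu; rewrite cosN sinN => Fp.
move: Frb; rewrite Fr Fp.
set A := F u xi p; set B := F u xi (p + pi / 2); set D := F ('D_e u) xi p.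
move=> Frb.
have -> : t * `|D - - (2 * pi * xi ord0 i) * B| = `|t * D + t * b * B|.
  by rewrite -[t in LHS](gtr0_norm t0) -normrM /b; congr (`|_|); ring.
(* Everything on the right is of order t^2: the first bracket is the integrated Taylor remainder,
   the others are errors of cos and sin near 0. *)
have -> : t * D + t * b * B =
  - (cos (t * b) * A + - sin (t * b) * B - A - t * D) + ((cos (t * b) - 1) * A
     - (sin (t * b) - t * b) * B) by ring.
rewrite (le_trans (ler_normD _ _))// normrN.
rewrite [leRHS]mulrDl [X in _ <= X + _]mulrDl -[leRHS]addrA lerD//.
  by rewrite [leRHS]mulrC [leRHS]mulrA.
rewrite (le_trans (ler_normB _ _))// !normrM lerD//.
  rewrite [leRHS]mulrAC ler_wpM2r// (le_trans (cos_quad _))// exprMn mulrC//.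
by rewrite [leRHS]mulrAC ler_wpM2r// (le_trans (sin_quad _))// exprMn mulrC.
Qed.

Lemma F_rapid u N : real_schwartz u ->
  exists C : R, forall xi p, `|F u xi p| * jap xi ^+ N <= C.
Proof.
elim: N u => [|N IH] u su.
  exists (I (fun x => `|u x|)) => xi p; rewrite mulr1.
  exact/F_bound/nice_igr/schwartz_nice.
have [C hC] := IH u su.
have /choice[D hD] : forall i : 'I_d, exists C : R, forall xi p,
    `|F ('d_i ('d_i u)) xi p| * jap xi ^+ N <= C.
  by move=> i; apply: IH; exact/schwartz_partial/schwartz_partial.
exists (C + \sum_(i < d) D i) => xi p.
rewrite exprS {1}/jap mulrCA mulrDl mul1r lerD//.
rewrite /dotp mulr_suml; apply: ler_sum => i _.
(* Two derivatives advance the phase by pi, so starting at [p - pi] lands exactly on [p]. *)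
apply: le_trans (hD i xi (p - pi)).
rewrite F_partial; last exact: schwartz_partial.
rewrite F_partial// -!addrA -splitr addNr addr0.
set z := xi ord0 i; set X := F u xi p.
have -> : - (2 * pi * z) * (- (2 * pi * z) * X) = ((2 * pi) ^+ 2) * (z * z * X) by ring.
rewrite normrM ger0_norm ?sqr_ge0// normrM (ger0_norm (_ : 0 <= z * z)); last by rewrite -expr2 sqr_ge0.
have : 1 <= (2 * pi) ^+ 2 :> R by have := pi_ge2 R; nra.
move: ((2 * pi) ^+ 2) => K K1; rewrite -!mulrA ler_peMl//.
rewrite mulrA -expr2; apply: mulr_ge0; first exact: sqr_ge0.
by apply: mulr_ge0 => //; exact/exprn_ge0/ltW/jap_gt0.
Qed.

Lemma F_lipschitz u p xi eta : nice u ->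
  `|F u xi p - F u eta p| <= 2 * pi * I (fun x => `|u x| * enorm x) * enorm (xi - eta).
Proof.
move=> nu; have iu := nice_igr nu.
have ie : igr (fun x => `|u x| * enorm x).
  apply: nice_igr; apply: (niceM (K := 1) (m := 1)); first exact: nice_norm.
    exact: measurable_enorm.
  by move=> x; rewrite mul1r expr1 ger0_norm ?enorm_ge0// enorm_le_jap.
rewrite mulrAC [leRHS]mulrC mulrC -I_Z// -I_B; try exact: igr_cosphase.
apply: I_abs_le.
- by apply: igr_measurable; apply: igrB; exact: igr_cosphase.
- exact: igrZ.
move=> x /=; rewrite -mulrBr normrM mulrCA ler_wpM2l//.
rewrite (le_trans (cos_lipschitz _ _))// opprD addrACA subrr addr0 -mulrBr normrM.
rewrite ger0_norm ?mulr_ge0 ?pi_ge0// -mulrA ler_wpM2l ?mulr_ge0 ?pi_ge0//.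
by rewrite ![dotp x _]dotpC -dotpBl dotp_le_enorm.
Qed.

Lemma enorm_lipschitz_continuous u (K : R) :
  (forall x y, `|u x - u y| <= K * enorm (x - y)) -> continuous u.
Proof.
move=> hu x s /nbhs_ballP[e /= e0 es].
rewrite [_ s](_ : _ = nbhs x (u @^-1` s))//.
(* Neighbourhoods are taken in the sup norm, and the Euclidean norm is at most [d] times it; [d.+1]
   keeps the final inequality strict and avoids division by 0. *)
pose del := e / (`|K| + 1) / d.+1%:R.
have K0 : 0 < `|K| + 1 by rewrite ltr_wpDl.
have del0 : 0 < del by rewrite !divr_gt0.
apply/nbhs_ballP; exists del => //= y [_ hy]; apply: es; rewrite /ball/=.
rewrite (le_lt_trans (hu x y))//.
apply: (@le_lt_trans _ _ ((`|K| + 1) * (del *+ d))).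
  rewrite (@le_trans _ _ ((`|K| + 1) * enorm (x - y)))//.
    by rewrite ler_wpM2r ?enorm_ge0// (le_trans (ler_norm _))// lerDl.
  rewrite ler_wpM2l ?(ltW K0)//.
  rewrite (le_trans (enorm_le_coord _))// -[d in _ *+ d]card_ord -sumr_const.
  by apply: ler_sum => i _; rewrite !mxE; exact/ltW/hy.
rewrite -mulr_natr /del.
have -> : (`|K| + 1) * (e / (`|K| + 1) / d.+1%:R * d%:R) = e * (d%:R / d.+1%:R).
  by field; rewrite ?gt_eqF//= ?pnatr_eq0.
by rewrite gtr_pMr// ltr_pdivrMr// mul1r ltr_nat.
Qed.

End fourier.

(** * Hartley inversion *)

Section line_kernel.
Variable R : realType.
Local Notation leb := (@lebesgue_measure R).
Variables (e : R).
Hypothesis e0 : 0 < e.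

Let den b := e ^+ 2 + b ^+ 2.

Let den_gt0 b : 0 < den b.
Proof. by rewrite ltr_wpDr ?sqr_ge0// exprn_gt0. Qed.

Let k (x : R) := expR (- e * `|x|).

Lemma is_derive_lin (a t : R) : is_derive t 1 (fun x : R => a * x) a.
Proof. by have := is_deriveZ a (is_derive_id t (1 : R)); rewrite /GRing.scale/= mulr1. Qed.

(** The antiderivative of exp(- e t) (1 + c cos(b t)) that tends to 0 at +oo. *)
Let prim b c (t : R) :=
  expR (- e * t) * (c / den b * (b * sin (b * t) - e * cos (b * t)) - e^-1).

Let is_derive_prim b c (t : R) :
  is_derive t 1 (prim b c) (expR (- e * t) * (1 + c * cos (b * t))).
Proof.
have dE : is_derive t 1 (fun x : R => expR (- e * x)) (expR (- e * t) * - e).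
  exact: is_derive1_comp (is_derive_expR _) (is_derive_lin _ _).
have dS : is_derive t 1 (fun x : R => sin (b * x)) (cos (b * t) * b).
  exact: is_derive1_comp (is_derive_sin _) (is_derive_lin _ _).
have dC : is_derive t 1 (fun x : R => cos (b * x)) (- sin (b * t) * b).
  exact: is_derive1_comp (is_derive_cos _) (is_derive_lin _ _).
have H := is_deriveM dE (is_deriveB (is_deriveZ (c / den b)
  (is_deriveB (is_deriveZ b dS) (is_deriveZ e dC))) (is_derive_cst e^-1 t 1)).
apply: (is_derive_eq H).
rewrite !fctE /GRing.scale/= /GRing.scale/= /den; field.
by rewrite !gt_eqF//= den_gt0.
Qed.

Let cvg_prim b c : prim b c t @[t --> +oo] --> (0 : R).
Proof.
pose K := `|c / den b| * (`|b| + e) + e^-1.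
have ei : 0 < e^-1 by rewrite invr_gt0.
apply/norm_cvg0P; apply: (@squeeze_cvgr _ _ _ _ (cst 0) (fun t => expR (- (e * t)) * K)).
- near=> t; rewrite /= normr_ge0/= /prim normrM ger0_norm ?expR_ge0// mulNr ler_wpM2l ?expR_ge0//.
  rewrite (le_trans (ler_normB _ _))// (gtr0_norm ei) /K lerD2r normrM ler_wpM2l//.
  rewrite (le_trans (ler_normB _ _))// !normrM (ger0_norm (ltW e0)) lerD//.
    by rewrite ler_piMr// sin_max.
  by rewrite ler_piMr ?cos_max// ltW.
- exact: cvg_cst.
- rewrite -(mul0r K); apply: cvgM; last exact: cvg_cst.
  apply: (@cvg_comp _ _ _ (fun t => e * t) (fun t => expR (- t)) _ (pinfty_nbhs R)); last exact: cvgr_expR.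
  exact: gt0_cvgMry.
Unshelve. all: end_near. Qed.

(* The constant [1] and the bound on [c] make the integrand nonnegative, so that products of such
   integrals need no integrability hypothesis. *)
Lemma integral_exp_cos b c : -1 <= c <= 1 ->
  (\int[leb]_x (k x * (1 + c * cos (b * x)))%:E =
   (2 / e + c * (2 * e / (e ^+ 2 + b ^+ 2)))%:E)%E.
Proof.
move=> c1; have f0 x : 0 <= 1 + c * cos (b * x).
  have : `|c * cos (b * x)| <= 1.
    by rewrite normrM mulr_ile1// ?cos_max// ler_norml.
  rewrite ler_norml => /andP[]; lra.
have cc : continuous (fun x : R => 1 + c * cos (b * x)).
  move=> x; apply: cvgD; first exact: cvg_cst.
  apply: cvgM; first exact: cvg_cst.
  apply: continuous_comp; last exact: continuous_cos.
  exact: mulrl_continuous.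
have ce (a : R) : continuous (fun x : R => expR (a * x)).
  by move=> x; apply: continuous_comp; [exact: mulrl_continuous|exact: continuous_expR].
rewrite ge0_symfun_integralT; first last.
- by move=> x; rewrite /= /k normrN mulrN cosN.
- move=> x; apply: cvgM; last exact: cc.
  apply: (cvg_comp (fun y : R => `|y|) (fun y : R => expR (- e * y))); last exact: ce.
  exact: norm_continuous.
- by move=> x; rewrite mulr_ge0 ?expR_ge0.
rewrite (_ : [set x : R | _] = `[0, +oo[%classic); last first.
  by apply/seteqP; split => x /=; rewrite in_itv/= andbT.
have -> : (\int[leb]_(x in `[0%R, +oo[) (k x * (1 + c * cos (b * x)))%:E =
    \int[leb]_(x in `[0%R, +oo[) (expR (- e * x) * (1 + c * cos (b * x)))%:E)%E.
  by apply: eq_integral => x; rewrite inE/= in_itv/= andbT => x0; rewrite /k ger0_norm.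
rewrite (@ge0_continuous_FTC2y _ _ (prim b c) 0 0).
- rewrite -EFinB -EFinM /prim !mulr0 expR0 sin0 cos0; congr EFin.
  rewrite -/(den b); field; rewrite gt_eqF//= gt_eqF//.
- by move=> x _; rewrite mulr_ge0 ?expR_ge0.
- by apply: continuous_subspaceT => x; apply: cvgM; [exact: ce|exact: cc].
- exact: cvg_prim.
- by move=> x _; have [] := is_derive_prim b c x.
- apply: cvg_at_right_filter.
  apply/differentiable_continuous/derivable1_diffP.
  by have [] := is_derive_prim b c 0.
- by move=> x _; rewrite derive1E; have [_ ->] := is_derive_prim b c x.
Qed.

Lemma measurable_line_kernel : measurable_fun setT k.
Proof.
apply: (measurableT_comp (@measurable_expR R)).
by apply: measurable_funM => //; exact: normr_measurable.
Qed.

(** Adding the integral to its image under x |-> -x replaces cos(b x + p) by 2 cos p cos(b x), which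
    reduces the claim to phase 0. The integral is only known to be nonnegative and possibly infinite
    until the sum is computed. *)
Lemma integral_exp_cos_phase b c p : -1 <= c <= 1 ->
  (\int[leb]_x (k x * (1 + c * cos (b * x + p)))%:E =
   (2 / e + c * cos p * (2 * e / (e ^+ 2 + b ^+ 2)))%:E)%E.
Proof.
move=> c1; pose f x := k x * (1 + c * cos (b * x + p)).
have f0 q x : 0 <= 1 + c * cos (b * x + q).
  have : `|c * cos (b * x + q)| <= 1.
    by rewrite normrM mulr_ile1// ?cos_max// ler_norml.
  rewrite ler_norml => /andP[]; lra.
have fe0 x : (0 <= (f x)%:E)%E by rewrite lee_fin mulr_ge0 ?expR_ge0.
have mf : measurable_fun [set: measurableTypeR R] (EFin \o f).
  apply/measurable_EFinP; apply: measurable_funM; first exact: measurable_line_kernel.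
  apply: measurable_funD => //; apply: measurable_funM => //.
  apply: (@measurableT_comp _ _ _ _ _ _ (@cos R)); last exact: measurable_affine.
  by apply: continuous_measurable_fun; exact: continuous_cos.
have N1 : (-1 : R) != 0 by rewrite oppr_eq0 oner_eq0.
have H := ge0_integral_affine 0 N1 mf fe0.
rewrite normrN1 invr1 mul1e in H.
have mfN : measurable_fun [set: measurableTypeR R] (fun x => (f (-1 * x + 0))%:E).
  exact: measurableT_comp mf (measurable_affine (-1) 0).
have : (\int[leb]_x (f x)%:E + \int[leb]_x (f (-1 * x + 0))%:E =
  2%:E * (2 / e + c * cos p * (2 * e / (e ^+ 2 + b ^+ 2)))%:E)%E.
  rewrite -(ge0_integralD leb measurableT (fun x _ => fe0 x) mf (fun x _ => fe0 _) mfN).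
  rewrite -integral_exp_cos; last first.
    rewrite -ler_norml normrM mulr_ile1 ?cos_max// ler_norml//.
  rewrite -ge0_integralZl//=.
  - apply: eq_integral => x _; rewrite -EFinD -EFinM; congr EFin.
    rewrite /f mulN1r addr0 /k normrN mulrN !cosD cosN sinN; ring.
  - apply/measurable_EFinP; apply: measurable_funM; first exact: measurable_line_kernel.
    apply: measurable_funD => //; apply: measurable_funM => //.
    apply: (@measurableT_comp _ _ _ _ _ _ (@cos R)); last exact: mulrl_measurable.
    by apply: continuous_measurable_fun; exact: continuous_cos.
  - move=> x _; rewrite lee_fin mulr_ge0 ?expR_ge0//.
    have : `|c * cos p * cos (b * x)| <= 1.
      by rewrite normrM mulr_ile1 ?cos_max// normrM mulr_ile1 ?cos_max// ler_norml.
    rewrite ler_norml => /andP[]; lra.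
rewrite H; set J := (\int[leb]_x _)%E.
have -> : (J + J = 2%:E * J)%E by rewrite -mule2n -mule_natl.
have J0 : (0 <= J)%E by apply: integral_ge0 => x _; exact: fe0.
case: J J0 => [r| |]//= _; last by rewrite mulry gtr0_sg// mul1e.
by rewrite -!EFinM => -[/(mulfI _) ->].
Qed.

End line_kernel.

Section kernel.
Variable R : realType.
Variables (e : R).
Hypothesis e0 : 0 < e.

(** A summation kernel for the inversion formula. The product form lets its transform be computed
    one coordinate at a time. *)
Definition expker d (x : 'rV[R]_d) : R := \prod_(i < d) expR (- e * `|x ord0 i|).

(** The Poisson kernel: the Fourier transform of exp(- e |x|) on the line. *)
Definition lorentz (w : R) : R := 2 * e / (e ^+ 2 + (2 * pi * w) ^+ 2).

Lemma lorentz_ge0 w : 0 <= lorentz w.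
Proof. by rewrite divr_ge0 ?mulr_ge0 ?(ltW e0)// addr_ge0 ?sqr_ge0. Qed.

Lemma lorentz_le w : lorentz w <= 2 / e.
Proof.
have d0 : 0 < e ^+ 2 + (2 * pi * w) ^+ 2 by rewrite ltr_wpDr ?sqr_ge0// exprn_gt0.
rewrite /lorentz ler_pdivrMr// [leRHS]mulrAC ler_pdivlMr//.
by have := sqr_ge0 (2 * pi * w); lra.
Qed.

Lemma measurable_lorentz : measurable_fun setT lorentz.
Proof.
apply: continuous_measurable_fun => w.
have d0 : e ^+ 2 + (2 * pi * w) ^+ 2 != 0.
  by rewrite gt_eqF// ltr_wpDr ?sqr_ge0// exprn_gt0.
apply: cvgM; first exact: cvg_cst.
apply: cvgV => //; apply: cvgD; first exact: cvg_cst.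
apply: (cvg_comp (fun y : R => 2 * pi * y) (fun y : R => y ^+ 2)).
  exact: mulrl_continuous.
exact: exprn_continuous.
Qed.

Lemma expker_ge0 d (x : 'rV[R]_d) : 0 <= expker x.
Proof. by apply: prodr_ge0 => i _; exact: expR_ge0. Qed.

Lemma expker_le1 d (x : 'rV[R]_d) : expker x <= 1.
Proof.
apply: prodr_ile1 => i _; rewrite expR_ge0/= expR_le1 mulNr oppr_le0.
by rewrite mulr_ge0// ltW.
Qed.

Lemma measurable_expker d : measurable_fun setT (@expker d).
Proof.
apply: measurable_prod => i _; apply: (@measurableT_comp _ _ _ _ _ _ expR).
  exact: measurable_expR.
apply: measurable_funM => //; apply: measurableT_comp => //; exact: measurable_coord.
Qed.

Lemma dotp_cons d (x : R) (v : 'rV[R]_d) (w : 'rV[R]_d.+1) :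
  dotp (rV_cons (x, v)) w = x * w ord0 ord0 + dotp v (rV_uncons w).2.
Proof.
rewrite /dotp big_ord_recl mxE unlift_none; congr (_ + _).
by apply: eq_bigr => i _; rewrite !mxE liftK.
Qed.

Lemma expker_cons d (x : R) (v : 'rV[R]_d) :
  expker (rV_cons (x, v)) = expR (- e * `|x|) * expker v.
Proof.
rewrite /expker big_ord_recl mxE unlift_none; congr (_ * _).
by apply: eq_bigr => i _; rewrite !mxE liftK.
Qed.

(** The parameters [c] and [p] make the induction close: integrating out the last [d] coordinates
    leaves a one-dimensional integral of the same shape, with the first coordinate absorbed in the
    phase and [c] multiplied by a ratio [P / m] of absolute value at most 1. *)
Lemma integral_expker_cos d (c : R) (w : 'rV[R]_d) (p : R) : -1 <= c <= 1 ->
  (\int[lebesgue_rV]_x (expker x * (1 + c * cos (2 * pi * dotp x w + p)))%:E =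
  ((2 / e) ^+ d + c * cos p * \prod_(i < d) lorentz (w ord0 i))%:E)%E.
Proof.
elim: d c w p => [|d IH] c w p c1.
  under eq_integral => x _ do rewrite /expker big_ord0 mul1r /dotp big_ord0 mulr0 add0r.
  by rewrite big_ord0 expr0 mulr1 integral_cst//= diracT mule1.
have f0 (n : nat) (q : R) (v : 'rV[R]_n) (x : 'rV[R]_n) :
    0 <= expker x * (1 + c * cos (2 * pi * dotp x v + q)).
  rewrite mulr_ge0 ?expker_ge0//.
  have : `|c * cos (2 * pi * dotp x v + q)| <= 1.
    by rewrite normrM mulr_ile1// ?cos_max// ler_norml.
  rewrite ler_norml => /andP[]; lra.
have mf (n : nat) (q : R) (v : 'rV[R]_n) : measurable_fun setT (fun x : 'rV[R]_n =>
   (expker x * (1 + c * cos (2 * pi * dotp x v + q)))%:E).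
  apply/measurable_EFinP; apply: measurable_funM; first exact: measurable_expker.
  apply: measurable_funD => //; apply: measurable_funM => //; exact: measurable_cosphase.
rewrite (ge0_integral_rV_cons (mf _ _ _)) => [|x]; last by rewrite lee_fin.
set w' := (rV_uncons w).2; set w0 := w ord0 ord0.
pose P := \prod_(i < d) lorentz (w' ord0 i).
pose m := (2 / e) ^+ d.
have m0 : 0 < m by rewrite exprn_gt0// divr_gt0.
have inner (x : R) : (\int[lebesgue_rV]_v (expker (rV_cons (x, v)) *
    (1 + c * cos (2 * pi * dotp (rV_cons (x, v)) w + p)))%:E =
   m%:E * (expR (- e * `|x|) * (1 + (c * (P / m)) * cos (2 * pi * w0 * x + p)))%:E)%E.
  under eq_integral => v _.
    rewrite expker_cons dotp_cons -/w0 -/w' -mulrA EFinM.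
    rewrite (_ : 2 * pi * (x * w0 + dotp v w') + p = 2 * pi * dotp v w' + (2 * pi * w0 * x + p)); last by ring.
    over.
  rewrite ge0_integralZl//.
  - by rewrite IH// -!EFinM -/P -/m; congr EFin; field; rewrite (gt_eqF m0).
  - exact: mf.
  - by move=> v _; rewrite lee_fin.
under eq_integral do rewrite inner.
have P0 : 0 <= P by apply: prodr_ge0 => i _; exact: lorentz_ge0.
have Pm : `|P / m| <= 1.
  rewrite ger0_norm; last by rewrite divr_ge0// ltW.
  rewrite ler_pdivrMr// mul1r /m -[X in _ ^+ X]card_ord -prodr_const.
  by apply: ler_prod => i _; rewrite lorentz_ge0 lorentz_le.
have cPm : -1 <= c * (P / m) <= 1.
  by rewrite -ler_norml normrM mulr_ile1// ler_norml.
rewrite ge0_integralZl//.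
- rewrite integral_exp_cos_phase// -EFinM; congr EFin.
  rewrite big_ord_recl (exprS _ d) -/m (_ : \prod_(i < d) _ = P); last first.
    by apply: eq_bigr => i _; rewrite mxE.
  rewrite /lorentz -/w0; move: (2 * pi * w0) => W.
  have D0 : 0 < e ^+ 2 + W ^+ 2 by rewrite ltr_wpDr ?sqr_ge0// exprn_gt0.
  by field; rewrite (gt_eqF m0) (gt_eqF e0) (gt_eqF D0).
- apply/measurable_EFinP; apply: measurable_funM; first exact: measurable_line_kernel.
  apply: measurable_funD => //; apply: measurable_funM => //.
  apply: (@measurableT_comp _ _ _ _ _ _ (@cos R)); last exact: measurable_affine.
  by apply: continuous_measurable_fun; exact: continuous_cos.
- move=> x _; rewrite lee_fin mulr_ge0 ?expR_ge0//.
  have : `|c * (P / m) * cos (2 * pi * w0 * x + p)| <= 1.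
    by rewrite normrM mulr_ile1 ?cos_max// ler_norml.
  rewrite ler_norml => /andP[]; lra.
- by rewrite lee_fin ltW.
Qed.

Lemma igr_expker d : igr (@expker d).
Proof.
apply/integrableP; split; first by apply/measurable_EFinP; exact: measurable_expker.
have := @integral_expker_cos d 0 0 0; rewrite lerN10 ler01 => /(_ isT).
under eq_integral do rewrite mul0r addr0 mulr1.
move=> E; under eq_integral do rewrite gee0_abs ?lee_fin ?expker_ge0//.
by rewrite E ltry.
Qed.

Lemma F_expker d (w : 'rV[R]_d) (p : R) :
  F (@expker d) w p = cos p * \prod_(i < d) lorentz (w ord0 i).
Proof.
have H1 : I (@expker d) = (2 / e) ^+ d.
  have := @integral_expker_cos d 0 0 0; rewrite lerN10 ler01 => /(_ isT).
  under eq_integral do rewrite mul0r addr0 mulr1.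
  by rewrite /Rintegral => ->; rewrite /= !mul0r addr0.
have H2 : I (fun x : 'rV[R]_d => expker x * (1 + 1 * cos (2 * pi * dotp x w + p))) =
    (2 / e) ^+ d + cos p * \prod_(i < d) lorentz (w ord0 i).
  have := @integral_expker_cos d 1 w p; rewrite lexx (le_trans (lerN10 _) ler01) => /(_ isT).
  by rewrite /Rintegral => ->; rewrite /= mul1r.
have ik := igr_expker d.
apply: (addrI ((2 / e) ^+ d)); rewrite -H2 -H1 -I_D//; last exact: igr_cosphase.
have E (a c : R) : a + a * c = a * (1 + 1 * c) by ring.
by apply: eq_I => x; exact: E.
Qed.

End kernel.

Section inversion.
Variables (R : realType) (d : nat).
Implicit Types (u v : 'rV[R]_d -> R) (x xi : 'rV[R]_d).

Lemma I_cvg (f_ : nat -> 'rV[R]_d -> R) (f g : 'rV[R]_d -> R) :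
  (forall n, measurable_fun setT (f_ n)) -> measurable_fun setT f -> igr g ->
  (forall x, f_ ^~ x @ \oo --> f x) -> (forall n x, `|f_ n x| <= g x) ->
  (fun n => I (f_ n)) @ \oo --> I f.
Proof.
move=> mf_ mf ig ff fg.
have [|||||_ _ H] := @dominated_convergence _ _ R lebesgue_rV setT measurableT
  (fun n => EFin \o f_ n) (EFin \o f) (EFin \o g).
- by move=> n; apply/measurable_EFinP.
- exact/measurable_EFinP.
- by apply: aeW => x _; apply: cvg_EFin; [exact: nearW|exact: ff].
- exact: ig.
- by apply: aeW => x n _; rewrite lee_fin.
have fgx x : `|f x| <= g x.
  have fx : (fun n => `|f_ n x|) @ \oo --> `|f x| by exact: cvg_norm (ff x).
  rewrite -(cvg_lim _ fx)//.
  apply: limr_le; first exact: cvgP fx.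
  by apply: nearW => n; exact: fg.
have If : igr f by exact: igr_le ig fgx.
apply: fine_cvg; rewrite fineK//; exact: integrable_fin_num.
Qed.

Definition cas (t : R) : R := cos t + sin t.

Lemma cas_max t : `|cas t| <= 2.
Proof.
rewrite (le_trans (ler_normD _ _))// -[leRHS]/(1 + 1) lerD ?cos_max ?sin_max//.
Qed.

Lemma measurable_cas : measurable_fun setT cas.
Proof.
apply: measurable_funD; apply: continuous_measurable_fun.
  exact: continuous_cos.
exact: continuous_sin.
Qed.

(* The Hartley transform: a real substitute for the Fourier transform which is its own inverse. *)
Definition hartley u xi : R := I (fun x => u x * cas (2 * pi * dotp x xi)).

Lemma hartleyE u xi : igr u -> hartley u xi = F u xi 0 + F u xi (- (pi / 2)).
Proof.
move=> iu; rewrite -I_D; try exact: igr_cosphase.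
by apply: eq_I => x /=; rewrite addr0 cosBpihalf mulrDr.
Qed.

Lemma measurable_dotp_pair : measurable_fun setT
  (fun z : 'rV[R]_d * 'rV[R]_d => dotp z.1 z.2).
Proof.
apply: measurable_sum => i; apply: measurable_funM.
  exact: measurableT_comp (measurable_coord i) measurable_fst.
exact: measurableT_comp (measurable_coord i) measurable_snd.
Qed.

Lemma igr_cas u xi : igr u -> igr (fun x => u x * cas (2 * pi * dotp x xi)).
Proof.
move=> iu; apply: (igrM (B := 2)) => // [|x]; last exact: cas_max.
apply: (measurableT_comp measurable_cas); apply: measurable_funM => //; exact: measurable_dotp.
Qed.

(** Total mass 1 makes the rescaled products an approximate identity; in one variable the mass is 2
    pi / (2 pi). *)
Lemma I_prod_lorentz : I (fun z : 'rV[R]_d => \prod_(i < d) lorentz 1 (z ord0 i)) = 1 /\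
  igr (fun z : 'rV[R]_d => \prod_(i < d) lorentz 1 (z ord0 i)).
Proof.
have m1 := @measurable_lorentz R 1 ltr01.
have l0 := @lorentz_ge0 R 1 ltr01.
have p20 : 2 * pi != 0 :> R by rewrite mulf_neq0// gt_eqF// pi_gt0.
have E1 : (\int[@lebesgue_measure R]_x (lorentz 1 x)%:E = 1%:E)%E.
  under eq_integral => x _.
    rewrite (_ : lorentz 1 x = 2 * (oneDsqr (2 * pi * x + 0))^-1); last first.
      by rewrite /lorentz addr0 mulr1 expr1n.
    rewrite EFinM; over.
  rewrite ge0_integralZl//=.
  - rewrite (@ge0_integral_affine _ _ 0 (fun x : R => (oneDsqr x)^-1%:E))//.
    + rewrite integral_oneDsqrV -!EFinM ger0_norm ?mulr_ge0 ?pi_ge0//; congr EFin.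
      by move: pi (pi_gt0 R) => q q0; field; rewrite (gt_eqF q0).
    + by apply/measurable_EFinP; exact: measurable_oneDsqrV.
  - apply/measurable_EFinP; exact: (measurableT_comp (@measurable_oneDsqrV R) (measurable_affine (2 * pi) 0)).
have E : (\int[lebesgue_rV]_z (\prod_(i < d) lorentz 1 ((z : 'rV[R]_d) ord0 i))%:E = 1%:E)%E.
  by rewrite ge0_integral_rV_prod// big1.
split; first by rewrite /Rintegral E.
apply/integrableP; split.
  apply/measurable_EFinP; apply: measurable_prod => i _.
  by apply: (measurableT_comp m1); exact: measurable_coord.
under eq_integral do rewrite gee0_abs ?lee_fin ?prodr_ge0//.
by rewrite E ltry.
Qed.

(* As [e] tends to [0] the left side tends to [hartley (hartley u) x] and the right side to [u x]. *)
Lemma hartley_expker u x (e : R) : 0 < e -> igr u ->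
  I (fun xi => expker e xi * (hartley u xi * cas (2 * pi * dotp xi x))) =
  I (fun z => u (e *: z + x) * \prod_(i < d) lorentz 1 (z ord0 i)).
Proof.
move=> e0 iu; have e_neq0 : e != 0 by rewrite gt_eqF.
pose K (z : 'rV[R]_d * 'rV[R]_d) := cas (2 * pi * dotp z.2 z.1) * cas (2 * pi * dotp z.1 x).
have mK : measurable_fun setT K.
  apply: measurable_funM; apply: (measurableT_comp measurable_cas); apply: measurable_funM => //.
    under eq_fun do rewrite dotpC; exact: measurable_dotp_pair.
  exact: measurableT_comp (measurable_dotp x) measurable_fst.
have KB z : `|K z| <= 2 * 2 by rewrite normrM ler_pM// cas_max.
have ik := igr_expker e0 d.
transitivity (I (fun xi => expker e xi * I (fun y => u y * K (xi, y)))).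
  apply: eq_I => xi; congr (_ * _); rewrite mulrC -I_Z; last exact: igr_cas.
  by apply: eq_I => y; rewrite /K/= mulrC mulrA.
rewrite (I_fubini ik iu mK KB).
transitivity (I (fun y => u y * \prod_(i < d) lorentz e ((y - x) ord0 i))).
  apply: eq_I => y; congr (_ * _).
  (* The product cas(A) cas(B) equals cos(A - B) + sin(A + B). The sine term integrates to 0 against
     the even kernel, leaving a convolution. *)
  transitivity (F (@expker R e d) (y - x) 0 + F (@expker R e d) (y + x) (- (pi / 2))).
    rewrite -I_D; try exact: igr_cosphase.
    apply: eq_I => xi /=; rewrite addr0 cosBpihalf -mulrDr; congr (_ * _).
    rewrite ![dotp _ (_ + _)]dotpC dotpBl dotpDl (dotpC x) /K /=.
    by move: (2 * pi) => c; rewrite mulrBr (mulrDr c) cosB sinD /cas; ring.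
  by rewrite !F_expker// cos0 cosN cos_pihalf mul0r addr0 mul1r.
have ml : measurable_fun setT (fun y : 'rV[R]_d => \prod_(i < d) lorentz e ((y - x) ord0 i)).
  apply: measurable_prod => i _; apply: (measurableT_comp (measurable_lorentz e0)).
  under eq_fun do rewrite !mxE; apply: measurable_funB => //; exact: measurable_coord.
have iul : igr (fun y => u y * \prod_(i < d) lorentz e ((y - x) ord0 i)).
  apply: (igrM (B := (2 / e) ^+ d)) => // y.
  rewrite ger0_norm; last by apply: prodr_ge0 => i _; exact: lorentz_ge0.
  rewrite -[X in _ ^+ X]card_ord -prodr_const.
  by apply: ler_prod => i _; rewrite lorentz_ge0// lorentz_le.
(* The substitution y = e z + x turns the kernel of width [e] into the fixed kernel of width 1, and
   its Jacobian e^d cancels the scaling of the kernel. *)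
have := I_affine x e_neq0 iul; rewrite (gtr0_norm e0) => /(congr1 (fun t => e ^+ d * t)).
rewrite mulrA divff ?expf_neq0// mul1r => <-.
rewrite -I_Z; last by have := igr_affine x e_neq0 iul.
apply: eq_I => z; rewrite mulrCA; congr (_ * _).
rewrite addrK -[X in _ ^+ X]card_ord -prodr_const -big_split; apply: eq_bigr => i _ /=.
rewrite !mxE /lorentz mulr1 expr1n (mulrCA (2 * pi)); move: (2 * pi * _) => W.
have W0 : 1 + W ^+ 2 != 0 by rewrite gt_eqF// ltr_wpDr ?sqr_ge0.
have -> : e ^+ 2 + (e * W) ^+ 2 = e ^+ 2 * (1 + W ^+ 2) by ring.
by move: (1 + W ^+ 2) W0 => D D0; field; rewrite e_neq0 D0.
Qed.

(** Both sides of [hartley_expker] converge by dominated convergence along e = 1/(n+1):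
    integrability of [hartley u] dominates the left one, while boundedness and continuity of [u]
    handle the right one. *)
Lemma hartley_inv u x : nice u -> continuous u -> igr (hartley u) ->
  hartley (hartley u) x = u x.
Proof.
move=> nu cu ih; have iu := nice_igr nu.
have mh := igr_measurable ih.
pose e n : R := n.+1%:R^-1.
have e0 n : 0 < e n by rewrite invr_gt0.
have ecvg : e @ \oo --> 0 by exact: cvg_harmonic.
have mker n := @measurable_expker R (e n) d.
have L1 : (fun n => I (fun xi => expker (e n) xi * (hartley u xi * cas (2 * pi * dotp xi x)))) @ \oo -->
    hartley (hartley u) x.
  have ihc := igr_cas x ih; have mhc := igr_measurable ihc.
  apply: (@I_cvg _ _ (fun xi => `|hartley u xi * cas (2 * pi * dotp xi x)|)).
  - by move=> n; apply: measurable_funM.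
  - exact: mhc.
  - exact: igr_norm.
  - move=> xi; rewrite -[X in _ --> X]mul1r; apply: cvgM; last exact: cvg_cst.
    pose S := \sum_(i < d) `|xi ord0 i|.
    have E n : expker (e n) xi = expR (- e n * S).
      by rewrite /S mulr_sumr expR_sum.
    under eq_fun do rewrite E.
    have -> : (1 : R) = expR (- 0 * S) by rewrite oppr0 mul0r expR0.
    apply: (cvg_comp (fun n => - e n * S) expR); last exact: continuous_expR.
    apply: cvgM; last exact: cvg_cst.
    exact: cvgN.
  - move=> n xi; rewrite normrM ler_piMl// ger0_norm ?expker_ge0//.
    exact: expker_le1.
have [IP iP] := I_prod_lorentz.
have mP := igr_measurable iP.
have L2 : (fun n => I (fun z => u (e n *: z + x) * \prod_(i < d) lorentz 1 (z ord0 i))) @ \oo --> u x.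
  have -> : u x = I (fun z => u x * \prod_(i < d) lorentz 1 (z ord0 i)).
    by rewrite I_Z// IP mulr1.
  have [C hC] := nu.2 0%N.
  apply: (@I_cvg _ _ (fun z => C * \prod_(i < d) lorentz 1 (z ord0 i))).
  - move=> n; apply: measurable_funM => //.
    exact: measurableT_comp nu.1 (measurable_rV_affine _ _).
  - by apply: measurable_funM.
  - exact: igrZ.
  - move=> z; apply: cvgM; last exact: cvg_cst.
    apply: (cvg_comp (fun n => e n *: z + x) u); last exact: cu.
    have : (fun n => e n *: z + x) @ \oo --> 0 *: z + x.
      by apply: cvgD; [exact: cvgZr_tmp|exact: cvg_cst].
    by rewrite scale0r add0r.
  - move=> n z; have P0 : 0 <= \prod_(i < d) lorentz 1 (z ord0 i).
      by apply: prodr_ge0 => i _; exact: lorentz_ge0.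
    rewrite normrM (ger0_norm P0) ler_wpM2r//.
    by have := hC (e n *: z + x); rewrite mulr1.
move: L1; under eq_fun do rewrite hartley_expker//.
by move=> L1; apply: cvg_unique L1 L2; exact: norm_hausdorff.
Qed.

End inversion.

(** * Flatness and moments *)

Section real_asymptotics.
Variable R : realType.

(** Along t = 2^(-n) both error terms are geometric sequences tending to 0. *)
Lemma le_powR_eq0 (b K K' q : R) : 0 < q ->
  (forall t : R, 0 < t <= 1 -> `|b| <= K * t + K' * t `^ q) -> b = 0.
Proof.
move=> q0 h; pose r : R := (2^-1) `^ q.
have r0 : 0 <= r by exact: powR_ge0.
have r1 : r < 1.
  have := @gt0_ltr_powR R q q0 2^-1 1; rewrite !nnegrE powR1; apply => //.
  by rewrite invf_lt1// ltr1n.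
have H n : `|b| <= K * 2^-1 ^+ n + K' * r ^+ n.
  have := h (2^-1 ^+ n); rewrite exprn_gt0 ?invr_gt0//= exprn_ile1 ?invr_ge0 ?invf_le1 ?ler1n//.
  move=> /(_ isT); rewrite -[in X in _ + K' * X]powR_mulrn ?invr_ge0// -powRrM (mulrC n%:R).
  by rewrite powRrM powR_mulrn.
have L : (fun n => K * 2^-1 ^+ n + K' * r ^+ n) @ \oo --> (0 : R).
  have : (fun n => K * 2^-1 ^+ n + K' * r ^+ n) @ \oo --> K * 0 + K' * 0.
    apply: cvgD; (apply: cvgM; [exact: cvg_cst|apply: cvg_expr]).
      by rewrite ger0_norm ?invr_ge0// invf_lt1// ltr1n.
    by rewrite (ger0_norm r0).
  by rewrite !mulr0 addr0.
apply/eqP; rewrite -normr_eq0 eq_le normr_ge0 andbT -(cvg_lim _ L)//.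
by apply: limr_ge; [exact: cvgP L|exact: nearW].
Qed.

(** An asymptotic expansion at 0 to every order; the series itself may diverge. The bounds hold for
    all [t], as a Taylor formula with bounded derivatives provides. *)
Definition expands (A : R -> R) (a : nat -> R) := forall N, exists K : R, forall t,
  `|A t - \sum_(j < N) a j * t ^+ j| <= K * `|t| ^+ N.

(* [|t|^q] times a smooth function is smooth at [0] only if that function is flat there,
   when [q] is not an even integer; the case [q = 1] is settled by parity. *)
Lemma flat_of_powR_mul (A B : R -> R) (a b : nat -> R) (W q : R) :
  0 < q < 2 -> 0 < W -> expands A a -> expands B b ->
  (forall t, B t = W * `|t| `^ q * A t) -> forall k, a k = 0.
Proof.
move=> /andP[q0 q2] W0 eA eB BA k; suff [] : a k = 0 /\ b k = 0 by [].
elim/ltn_ind: k => k IH.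
have sum0 c n t : (forall j, (j < n)%N -> c j = 0) -> \sum_(j < n) c j * t ^+ j = 0 :> R.
  by move=> c0; apply: big1 => j _; rewrite c0 ?mul0r.
have [K0 hK0] := eA k; have [K1 hK1] := eA k.+1.
have [K2 hK2] := eB k.+1; have [K3 hK3] := eB k.+2.
have a0 j : (j < k)%N -> a j = 0 by move=> /IH[].
have b0 j : (j < k)%N -> b j = 0 by move=> /IH[].
(* Since A is of order t^k, B is of order t^(k+q) with q > 0, so it has no term of order k. *)
have bk : b k = 0.
  apply: (@le_powR_eq0 _ K2 (W * K0) q q0) => t /andP[t0 t1].
  have tk : 0 < t ^+ k by rewrite exprn_gt0.
  have := hK2 t; rewrite big_ord_recr/= sum0// add0r BA (gtr0_norm t0) => H2.
  have := hK0 t; rewrite sum0// subr0 (gtr0_norm t0) => H0.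
  rewrite -(ler_pM2r tk) -[X in `|b k| * X](gtr0_norm tk) -normrM.
  have -> : b k * t ^+ k = W * t `^ q * A t - (W * t `^ q * A t - b k * t ^+ k) by ring.
  rewrite (le_trans (ler_normB _ _))// addrC mulrDl lerD//.
    by rewrite -[leRHS]mulrA -exprS.
  rewrite !normrM (gtr0_norm W0) (ger0_norm (powR_ge0 _ _)) -!mulrA ler_wpM2l ?(ltW W0)//.
  by rewrite mulrCA ler_wpM2l ?powR_ge0.
split => //.
apply: (@le_powR_eq0 _ K1 (K3 / W) (2 - q)); first by rewrite subr_gt0.
move=> t /andP[t0 t1].
have tk : 0 < t ^+ k by rewrite exprn_gt0.
have tq : 0 < t `^ q by rewrite powR_gt0.
have H1 u : `|u| = t -> `|A u - a k * u ^+ k| <= K1 * t ^+ k.+1.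
  by move=> ut; have := hK1 u; rewrite big_ord_recr/= sum0// add0r ut.
have H3 u : `|u| = t -> `|B u - b k.+1 * u ^+ k.+1| <= K3 * t ^+ k.+2.
  by move=> ut; have := hK3 u; rewrite !big_ord_recr/= sum0// bk mul0r !add0r ut.
have nt : `|t| = t by rewrite gtr0_norm.
have nnt : `|- t| = t by rewrite normrN.
have {H1}H1p := H1 _ nt; have {}H1n : `|A (- t) - a k * (- t) ^+ k| <= K1 * t ^+ k.+1 by have := hK1 (- t); rewrite big_ord_recr/= sum0// add0r nnt.
have H3p := H3 _ nt; have H3n := H3 _ nnt.
(* The combination B(t) + s B(-t) cancels the term of order k+1 and is of order t^(k+2). The same
   combination of A has leading term 2 a_k t^k; dividing by t^q leaves |a_k| bounded by multiples of
   t and t^(2-q). *)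
pose s : R := (-1) ^+ k.
have s1 : `|s| = 1 by rewrite normrX normrN1 expr1n.
have ss : s * s = 1 by rewrite /s -expr2 sqrr_sign.
have Ep : (- t) ^+ k = s * t ^+ k by rewrite exprNn.
have Ep1 : (- t) ^+ k.+1 = - (s * t ^+ k.+1) by rewrite exprNn exprS mulN1r mulNr.
have BB : `|B t + s * B (- t)| <= 2 * (K3 * t ^+ k.+2).
  have -> : B t + s * B (- t) = (B t - b k.+1 * t ^+ k.+1) + s * (B (- t) - b k.+1 * (- t) ^+ k.+1).
    rewrite Ep1; apply/eqP; rewrite eq_sym -subr_eq0; apply/eqP.
    by transitivity ((s * s - 1) * (b k.+1 * t ^+ k.+1)); [ring|rewrite ss subrr mul0r].
  rewrite (le_trans (ler_normD _ _))// normrM s1 mul1r mulr2n mulrDl !mul1r lerD//.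
have AA : `|2 * (a k * t ^+ k) - (A t + s * A (- t))| <= 2 * (K1 * t ^+ k.+1).
  have -> : 2 * (a k * t ^+ k) - (A t + s * A (- t)) =
     - (A t - a k * t ^+ k) - s * (A (- t) - a k * (- t) ^+ k).
    rewrite Ep; apply/eqP; rewrite -subr_eq0; apply/eqP.
    by transitivity ((1 - s * s) * (a k * t ^+ k)); [ring|rewrite ss subrr mul0r].
  rewrite (le_trans (ler_normB _ _))// normrN normrM s1 mul1r mulr2n mulrDl !mul1r lerD//.
have BE : B t + s * B (- t) = W * t `^ q * (A t + s * A (- t)).
  by rewrite !BA nt nnt; ring.
have AB : `|A t + s * A (- t)| <= 2 * (K3 * t ^+ k.+2) / (W * t `^ q).
  rewrite ler_pdivlMr ?mulr_gt0// mulrC -[W * _](gtr0_norm (mulr_gt0 W0 tq)) -normrM -BE//.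
have : 2 * (`|a k| * t ^+ k) <= 2 * (K1 * t ^+ k.+1) + 2 * (K3 * t ^+ k.+2) / (W * t `^ q).
  rewrite -[X in 2 * (_ * X)](gtr0_norm tk) -normrM -{1}(@ger0_norm _ 2)// -normrM.
  rewrite -[X in `|X|](subrK (A t + s * A (- t))) (le_trans (ler_normD _ _))// lerD//.
have -> : 2 * (K3 * t ^+ k.+2) / (W * t `^ q) = 2 * (K3 / W * (t `^ (2 - q)) * t ^+ k).
  have -> : t `^ (2 - q) = t ^+ 2 / t `^ q.
    rewrite powRD ?(gt_eqF t0) ?implybT// powRN powR_mulrn ?ltW//.
  rewrite (_ : t ^+ k.+2 = t ^+ 2 * t ^+ k); last by rewrite -exprD.
  by field; rewrite (gt_eqF W0) (gt_eqF tq).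
have -> : 2 * (K1 * t ^+ k.+1) = 2 * (K1 * t * t ^+ k) by rewrite exprS; ring.
by rewrite -mulrDr ler_pM2l// -mulrDl ler_pM2r.
Qed.

Lemma expr_fact_le (x : R) n : 0 <= x -> x ^+ n / n`!%:R <= expR x.
Proof.
case: n => [|n] x0; first by rewrite expr0 divr1 -expR0 ler_expR.
by apply: le_trans (expR_ge1Dxn n x0); rewrite lerDr.
Qed.

Lemma poly_le_exp (c : R) N : 0 < c -> exists C : R, forall r, 0 <= r ->
  (1 + r ^+ 2) ^+ N <= C * expR (c * r).
Proof.
(* From the term of order 2N of exp(c (1 + r)), using 1 + r^2 <= (1 + r)^2; the factor [expR c] pays
   for the shift from r to 1 + r. *)
move=> c0; exists ((N * 2)`!%:R / c ^+ (N * 2) * expR c) => r r0.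
have h : (1 + r ^+ 2) ^+ N <= (1 + r) ^+ (N * 2).
  rewrite mulnC exprM lerXn2r ?nnegrE ?addr_ge0 ?sqr_ge0//.
  by rewrite sqrrD expr1n mul1r; have := r0; lra.
rewrite (le_trans h)// -[leRHS]mulrA -expRD -{2}[c]mulr1 -mulrDr.
have r1 : 0 <= c * (1 + r) by rewrite mulr_ge0 ?addr_ge0// ltW.
have := expr_fact_le (N * 2) r1.
rewrite exprMn ler_pdivrMr ?ltr0n ?fact_gt0// => H.
by rewrite [leRHS]mulrAC ler_pdivlMr ?exprn_gt0// mulrC (le_trans H)// mulrC.
Qed.

End real_asymptotics.

#[local] Arguments pi {R} : simpl never.

Section moments.
Variables (R : realType) (d : nat).
Implicit Types (u v : 'rV[R]_d -> R) (x xi o : 'rV[R]_d).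

Lemma dotp_exp_le x o n : `|dotp x o ^+ n| <= enorm o ^+ n * jap x ^+ n.
Proof.
rewrite normrX -exprMn lerXn2r ?nnegrE ?mulr_ge0 ?enorm_ge0 ?(ltW (jap_gt0 _))//.
rewrite (le_trans (dotp_le_enorm _ _))// mulrC ler_wpM2l ?enorm_ge0//.
exact: enorm_le_jap.
Qed.

Lemma measurable_dotp_exp o n : measurable_fun setT (fun x => dotp x o ^+ n).
Proof. by apply: measurable_funX; exact: measurable_dotp. Qed.

Lemma nice_dotp_exp u o n : nice u -> nice (fun x => u x * dotp x o ^+ n).
Proof.
move=> nu; apply: (niceM nu); first exact: measurable_dotp_exp.
by move=> x; exact: dotp_exp_le.
Qed.

(** [cos_taylor] under the integral sign. The free centre [t0] serves both the expansion at 0 and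
    the later propagation along a line. *)
Lemma F_taylor u o (t0 t p : R) N : nice u ->
  `|F u ((t0 + t) *: o) p - \sum_(j < N)
     F (fun x => u x * dotp x o ^+ j) (t0 *: o) (p + j%:R * (pi / 2)) * ((2 * pi * t) ^+ j / j`!%:R)|
  <= I (fun x => `|u x * dotp x o ^+ N|) * (`|2 * pi * t| ^+ N / N`!%:R).
Proof.
move=> nu; have iu := nice_igr nu.
have nud n := nice_dotp_exp o n nu.
have iud n := nice_igr (nud n).
have -> : \sum_(j < N) F (fun x => u x * dotp x o ^+ j) (t0 *: o) (p + j%:R * (pi / 2)) *
     ((2 * pi * t) ^+ j / j`!%:R) = I (fun x => \sum_(j < N) (((2 * pi * t) ^+ j / j`!%:R) *
     (u x * dotp x o ^+ j * cos (2 * pi * dotp x (t0 *: o) + (p + j%:R * (pi / 2)))))).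
  rewrite I_sum; last by move=> j; apply: igrZ; exact: igr_cosphase.
  by apply: eq_bigr => j _; rewrite mulrC I_Z//; exact: igr_cosphase.
have isum : igr (fun x => \sum_(j < N) (((2 * pi * t) ^+ j / j`!%:R) *
     (u x * dotp x o ^+ j * cos (2 * pi * dotp x (t0 *: o) + (p + j%:R * (pi / 2)))))).
  by apply: igr_sum => j; apply: igrZ; exact: igr_cosphase.
rewrite -I_B//; last exact: igr_cosphase.
rewrite [leRHS]mulrC -I_Z; last exact/igr_norm.
apply: I_abs_le.
- by apply: igr_measurable; apply: igrB => //; exact: igr_cosphase.
- exact/igrZ/igr_norm.
move=> x /=.
set th := 2 * pi * dotp x (t0 *: o) + p.
have -> : 2 * pi * dotp x ((t0 + t) *: o) + p = th + 2 * pi * t * dotp x o.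
  by rewrite /th ![dotp x (_ *: _)]dotpC !dotpZl (dotpC o); ring.
have -> : \sum_(j < N) (((2 * pi * t) ^+ j / j`!%:R) *
     (u x * dotp x o ^+ j * cos (2 * pi * dotp x (t0 *: o) + (p + j%:R * (pi / 2))))) =
   u x * \sum_(j < N) cos (th + j%:R * (pi / 2)) * (2 * pi * t * dotp x o) ^+ j / j`!%:R.
  rewrite [RHS]mulr_sumr; apply: eq_bigr => j _; rewrite addrA -/th !exprMn; ring.
rewrite -mulrBr normrM (le_trans (ler_wpM2l (normr_ge0 _) (cos_taylor _ _ _)))//.
rewrite !normrM exprMn normrX le_eqVlt; apply/orP; left; apply/eqP; ring.
Qed.

Lemma F0 u p : igr u -> F u 0 p = cos p * I u.
Proof.
move=> iu; rewrite -I_Z//; apply: eq_I => x.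
by rewrite -(scale0r 0) dotpC dotpZl mul0r mulr0 add0r mulrC.
Qed.

(** The j-th Taylor coefficient at 0 of the Hartley transform on the line through [o]; the
    trigonometric factor is the j-th derivative of [cas] at 0. *)
Definition hartley_coef u o (j : nat) : R :=
  (cos (j%:R * (pi / 2)) + sin (j%:R * (pi / 2))) * ((2 * pi) ^+ j / j`!%:R) *
  I (fun x => u x * dotp x o ^+ j).

Lemma hartley_expands u o : nice u ->
  expands (fun t => hartley u (t *: o)) (hartley_coef u o).
Proof.
move=> nu N; have iu := nice_igr nu.
exists (2 * (I (fun x => `|u x * dotp x o ^+ N|) * ((2 * pi) ^+ N / N`!%:R))) => t.
rewrite hartleyE//.
have H p := F_taylor o 0 t p N nu.
have E p : \sum_(j < N) F (fun x => u x * dotp x o ^+ j) (0 *: o) (p + j%:R * (pi / 2)) *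
   ((2 * pi * t) ^+ j / j`!%:R) =
  \sum_(j < N) cos (p + j%:R * (pi / 2)) * ((2 * pi) ^+ j / j`!%:R) *
     I (fun x => u x * dotp x o ^+ j) * t ^+ j.
  apply: eq_bigr => j _; rewrite scale0r F0; last by apply: nice_igr; exact: nice_dotp_exp.
  rewrite exprMn; ring.
have := H 0; have := H (- (pi / 2)); rewrite !E !add0r => H1 H2.
have -> : \sum_(j < N) hartley_coef u o j * t ^+ j =
  \sum_(j < N) cos (0 + j%:R * (pi / 2)) * ((2 * pi) ^+ j / j`!%:R) *
     I (fun x => u x * dotp x o ^+ j) * t ^+ j +
  \sum_(j < N) cos (- (pi / 2) + j%:R * (pi / 2)) * ((2 * pi) ^+ j / j`!%:R) *
     I (fun x => u x * dotp x o ^+ j) * t ^+ j.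
  rewrite -big_split; apply: eq_bigr => j _ /=.
  rewrite add0r [- (pi / 2) + _]addrC cosBpihalf /hartley_coef; ring.
rewrite opprD addrACA (le_trans (ler_normD _ _))//.
have nE : `|2 * pi * t| ^+ N = (2 * pi) ^+ N * `|t| ^+ N.
  by rewrite normrM exprMn ger0_norm// mulr_ge0 ?pi_ge0.
set X := (\int[lebesgue_rV]_x `|u x * dotp x o ^+ N|) in H1 H2 *.
have -> : 2 * (X * ((2 * pi) ^+ N / N`!%:R)) * `|t| ^+ N =
  X * (`|2 * pi * t| ^+ N / N`!%:R) + X * (`|2 * pi * t| ^+ N / N`!%:R) by rewrite nE; ring.
by rewrite lerD.
Qed.

(* [cos + sin] does not vanish at multiples of [pi / 2], so no moment is lost. *)
Lemma hartley_coef_eq0 u o j : hartley_coef u o j = 0 -> I (fun x => u x * dotp x o ^+ j) = 0.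
Proof.
move=> /eqP; rewrite /hartley_coef !mulf_eq0 => /orP[/orP[/eqP cs|]|/eqP//].
  (* The square of cos + sin at angle j pi/2 is 1 + sin(j pi) = 1. *)
  have : (cos (j%:R * (pi / 2)) + sin (j%:R * (pi / 2))) ^+ 2 = 0 :> R by rewrite cs expr0n.
  have H (x y : R) : (x + y) ^+ 2 = x ^+ 2 + y ^+ 2 + 2 * (x * y) by ring.
  rewrite H cos2Dsin2.
  have sn : sin (j%:R * pi) = 0 :> R.
    elim: j {cs} => [|j IH]; first by rewrite mul0r sin0.
    by rewrite -natr1 mulrDl mul1r sinDpi IH oppr0.
  have -> : 2 * (cos (j%:R * (pi / 2)) * sin (j%:R * (pi / 2))) = sin (j%:R * pi) :> R.
    rewrite (_ : j%:R * pi = j%:R * (pi / 2) + j%:R * (pi / 2)); last first.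
      by rewrite -mulrDr -splitr.
    by rewrite sinD; ring.
  by rewrite sn addr0 => /eqP; rewrite oner_eq0.
rewrite expf_eq0 mulf_eq0 pnatr_eq0/= (gt_eqF (pi_gt0 R)) andbF/= invr_eq0 pnatr_eq0.
by rewrite -leqn0 leqNgt fact_gt0.
Qed.

(* Moments determine an exponentially decaying density: its Fourier transform is analytic in a
   strip, so the Taylor expansions propagate the vanishing along a line in steps of fixed length. *)
Lemma F_eq0_of_moments u o (a C : R) : 0 < a -> nice u ->
  (forall x, `|u x| <= C * expR (- a * enorm x)) ->
  (forall j, I (fun x => u x * dotp x o ^+ j) = 0) ->
  forall t p, F u (t *: o) p = 0.
Proof.
move=> a0 nu uC mom.
(* Chosen so that b |x.o| <= (a/2) |x|: the weight exp(b |x.o|) uses up half of the decay of [u]. *)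
pose b := a / (2 * (enorm o + 1)).
have o1 : 0 < enorm o + 1 by rewrite ltr_wpDl ?enorm_ge0.
have b0 : 0 < b by rewrite divr_gt0// mulr_gt0.
(* The step length for which 2 pi del = b/2, so that the N-th Taylor remainder carries a factor
   2^(-N). *)
pose del := b / (4 * pi).
have del0 : 0 < del by rewrite divr_gt0// mulr_gt0// pi_gt0.
(* All moments [k] and phases [p] at once: up to constants these are all derivatives along the line,
   which is what a Taylor step needs. *)
pose vanishes t := forall k p, F (fun x => u x * dotp x o ^+ k) (t *: o) p = 0.
have nud k := nice_dotp_exp o k nu.
have bo x : b * `|dotp x o| <= a / 2 * enorm x.
  rewrite (le_trans (ler_wpM2l (ltW b0) (dotp_le_enorm _ _)))// mulrCA mulrC ler_wpM2r ?enorm_ge0//.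
  rewrite /b mulrAC ler_pdivrMr ?mulr_gt0//.
  have -> : a / 2 * (2 * (enorm o + 1)) = a * (enorm o + 1) by field.
  by rewrite ler_pM2l// lerDl.
have C0 : 0 <= C.
  by have := uC 0; rewrite enorm0 mulr0 expR0 mulr1; exact: le_trans.
have step t r : vanishes t -> `|r| <= del -> vanishes (t + r).
  move=> vt rd k p.
  (* A majorant independent of N, since (b |x.o|)^N / N! <= exp(b |x.o|). *)
  pose v x := `|u x * dotp x o ^+ k| * expR (b * `|dotp x o|).
  have mv : measurable_fun setT v.
    apply: measurable_funM; first by apply: measurableT_comp => //; exact: (nud k).1.
    apply: (measurableT_comp (@measurable_expR R)); apply: measurable_funM => //.
    by apply: measurableT_comp => //; exact: measurable_dotp.
  have iv : igr v.
    apply: igr_rapid => // N.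
    have a20 : 0 < a / 2 by rewrite divr_gt0.
    have [D hD] := poly_le_exp (k + N) a20.
    exists (C * (enorm o ^+ k * D)) => x.
    rewrite ger0_norm ?mulr_ge0 ?expR_ge0// /v normrM.
    apply: (@le_trans _ _ (C * expR (- a * enorm x) * (enorm o ^+ k * jap x ^+ k) * expR (a / 2 * enorm x) * jap x ^+ N)).
      rewrite ler_wpM2r ?exprn_ge0 ?(ltW (jap_gt0 _))//.
      apply: ler_pM; rewrite ?mulr_ge0 ?expR_ge0// ?ler_expR//.
      by apply: ler_pM => //; exact: dotp_exp_le.
    have -> : C * expR (- a * enorm x) * (enorm o ^+ k * jap x ^+ k) * expR (a / 2 * enorm x) * jap x ^+ N
      = C * (enorm o ^+ k * (jap x ^+ (k + N) * expR (- (a / 2 * enorm x)))).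
      have -> : expR (- a * enorm x) = expR (- (a / 2 * enorm x)) * expR (- (a / 2 * enorm x)).
        by rewrite -expRD; congr expR; field.
      have H : expR (- (a / 2 * enorm x)) * expR (a / 2 * enorm x) = 1.
        by rewrite -expRD addNr expR0.
      rewrite exprD; transitivity (C * (enorm o ^+ k * (jap x ^+ k * jap x ^+ N * expR (- (a / 2 * enorm x)))) *
        (expR (- (a / 2 * enorm x)) * expR (a / 2 * enorm x))); first by ring.
      by rewrite H mulr1.
    rewrite ler_wpM2l// ler_wpM2l ?exprn_ge0 ?enorm_ge0//.
    rewrite expRN ler_pdivrMr ?expR_gt0//.
    by have := hD _ (enorm_ge0 x); rewrite sqr_enorm.
  have bound N : `|F (fun x => u x * dotp x o ^+ k) ((t + r) *: o) p| <= I v * 2^-1 ^+ N.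
    have := F_taylor o t r p N (nud k).
    rewrite big1 ?subr0; last first.
      move=> j _; rewrite (_ : (fun x => _) = (fun x => u x * dotp x o ^+ (k + j))).
        by rewrite vt mul0r.
      by apply/funext => x; rewrite exprD mulrA.
    move=> /le_trans; apply.
    have iN : igr (fun x => `|u x * dotp x o ^+ k * dotp x o ^+ N|).
      by apply: igr_norm; apply: nice_igr; exact: nice_dotp_exp.
    rewrite [leLHS]mulrC [leRHS]mulrC -!I_Z//.
    apply: I_le; first by apply: igrZ; apply: igr_norm; apply: nice_igr; exact: nice_dotp_exp.
      exact: igrZ.
    move=> x; rewrite (normrM (u x * _)) /v [leRHS]mulrCA [leLHS]mulrCA ler_wpM2l//.
    have h1 : `|2 * pi * r| <= b / 2.
      rewrite normrM ger0_norm ?mulr_ge0 ?pi_ge0//.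
      rewrite (le_trans (ler_wpM2l _ rd)) ?mulr_ge0 ?pi_ge0// /del.
      rewrite le_eqVlt; apply/orP; left; apply/eqP.
      by move: pi (pi_gt0 R) => q q0; field; rewrite (gt_eqF q0).
    have h2 : `|2 * pi * r| ^+ N <= (b / 2) ^+ N by rewrite lerXn2r ?nnegrE// divr_ge0// ltW.
    rewrite normrX.
    apply: (@le_trans _ _ ((b / 2) ^+ N / N`!%:R * `|dotp x o| ^+ N)).
      by rewrite ler_wpM2r ?exprn_ge0// ler_wpM2r// invr_ge0.
    have -> : (b / 2) ^+ N / N`!%:R * `|dotp x o| ^+ N = 2^-1 ^+ N * ((b * `|dotp x o|) ^+ N / N`!%:R).
      by rewrite !exprMn; ring.
    rewrite ler_wpM2l ?exprn_ge0 ?invr_ge0// expr_fact_le// mulr_ge0// ltW//.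
  have L : (fun N => I v * 2^-1 ^+ N) @ \oo --> (0 : R).
    rewrite -(mulr0 (I v)); apply: cvgM; first exact: cvg_cst.
    by apply: cvg_expr; rewrite ger0_norm ?invr_ge0// invf_lt1// ltr1n.
  apply/eqP; rewrite -normr_eq0 eq_le normr_ge0 andbT -(cvg_lim _ L)//.
  by apply: limr_ge; [exact: cvgP L|exact: nearW].
have v0 : vanishes 0 by move=> k p; rewrite scale0r F0 ?mom ?mulr0//; exact: nice_igr.
move=> t p; suff : vanishes t.
  by move=> /(_ 0%N p); rewrite (_ : (fun x => _) = u)//; apply/funext => x; rewrite mulr1.
pose n := (Num.truncn (`|t| / del)).+1.
have n0 : 0 < n%:R :> R by rewrite ltr0n.
have tn : `|t / n%:R| <= del.
  rewrite normrM normfV (ger0_norm (ltW n0)) ler_pdivrMr// mulrC -ler_pdivrMr//.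
  by rewrite ltW// truncnS_gt.
suff H m : vanishes (t / n%:R * m%:R).
  by have := H n; rewrite divfK// gt_eqF.
elim: m => [|m IH]; first by rewrite mulr0.
by rewrite -natr1 mulrDr mulr1; exact: step.
Qed.
End moments.

(** * The fractional Laplacian as a Hartley multiplier *)

Section core.
Variables (R : realType) (d : nat).
Implicit Types (u v : 'rV[R]_d -> R) (x xi o : 'rV[R]_d).

Lemma continuous_norm_powR (q : R) : 0 < q -> continuous (fun y : R => `|y| `^ q).
Proof.
move=> q0 y; have [->|y0] := eqVneq y 0.
  rewrite /continuous_at normr0 powR0 ?gt_eqF//.
  apply/cvgrPdist_lt => e e0; near=> z.
  rewrite sub0r normrN ger0_norm ?powR_ge0//.
  have ze : `|z| < e `^ q^-1.
    near: z; apply: (@cvgr0_norm_lt _ _ _ _ _ id); last by rewrite powR_gt0.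
    exact: cvg_id.
  have := @gt0_ltr_powR R q q0 `|z| (e `^ q^-1); rewrite !nnegrE powR_ge0 normr_ge0.
  by move=> /(_ isT isT ze); rewrite -powRrM mulVf ?gt_eqF// powRr1// ltW.
have H : {for `|y|, continuous (fun z : R => z `^ q)}.
  apply: differentiable_continuous; apply/derivable1_diffP.
  by apply: derivable_powR; rewrite in_itv/= andbT normr_gt0.
apply: (cvg_comp (fun y : R => `|y|) (fun z : R => z `^ q)); last exact: H.
exact: norm_continuous.
Unshelve. all: end_near. Qed.

Lemma continuous_enorm : continuous (@enorm R d).
Proof.
apply: (@enorm_lipschitz_continuous _ _ _ 1) => x y; rewrite mul1r.
have := enormD (x - y) y; have := enormD (y - x) x; rewrite !subrK (enormB y x).
by rewrite ler_norml => h1 h2; apply/andP; split; lra.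
Qed.

Lemma continuous_enorm_powR (q : R) : 0 < q -> continuous (fun x => enorm x `^ q).
Proof.
move=> q0; rewrite (_ : (fun x => _) = (fun y : R => `|y| `^ q) \o @enorm R d); last first.
  by apply/funext => x /=; rewrite ger0_norm ?enorm_ge0.
by move=> x; apply: continuous_comp; [exact: continuous_enorm|exact: continuous_norm_powR].
Qed.

Lemma enorm_powR_le_jap (q : R) x : 0 <= q <= 2 -> enorm x `^ q <= jap x.
Proof.
move=> /andP[q0 q2]; have [x1|x1] := leP (enorm x) 1.
  apply: le_trans (jap_ge1 x); have := @ge0_ler_powR R q q0 (enorm x) 1.
  by rewrite !nnegrE enorm_ge0 ler01 powR1 => /(_ isT isT x1).
apply: (@le_trans _ _ (enorm x `^ 2)); first by rewrite ler_powR// ltW.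
by rewrite powR_mulrn ?enorm_ge0// sqr_enorm /jap lerDr.
Qed.

Lemma F_nice u p : real_schwartz u -> nice (fun xi => F u xi p) /\ continuous (fun xi => F u xi p).
Proof.
move=> su; have nu := schwartz_nice su.
have cF : continuous (fun xi => F u xi p).
  by apply: enorm_lipschitz_continuous => x y; exact: F_lipschitz.
split=> //; split; first exact: continuous_measurable_rV.
move=> N; have [C hC] := F_rapid N su; exists C => x; exact: hC.
Qed.

Lemma continuous_hartley u : nice u -> continuous (hartley u).
Proof.
move=> nu; have iu := nice_igr nu.
rewrite (_ : hartley u = (fun xi => F u xi 0 + F u xi (- (pi / 2)))); last first.
  by apply/funext => xi; rewrite hartleyE.
have cF p : continuous (fun xi => F u xi p).
  by apply: enorm_lipschitz_continuous => y z; exact: F_lipschitz.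
by move=> x; exact: continuousD (cF 0 x) (cF (- (pi / 2)) x).
Qed.

Lemma hartley_nice u : real_schwartz u -> nice (hartley u).
Proof.
move=> su; have iu := nice_igr (schwartz_nice su).
rewrite (_ : hartley u = (fun xi => F u xi 0) \+ (fun xi => F u xi (- (pi / 2)))).
  by apply: niceD; apply: (F_nice _ su).1.
by apply/funext => xi; rewrite hartleyE.
Qed.

(* For real [u] this is the fractional Laplacian of order [q / 2]: see [frac_laplacianE]. *)
Definition hartley_multiplier (q : R) u := hartley (fun xi => enorm xi `^ q * hartley u xi).

Lemma nice_enorm_powRM (q : R) u : 0 < q < 2 -> nice u -> nice (fun xi => enorm xi `^ q * u xi).
Proof.
move=> /andP[q0 q2] nu; apply: (nice_le (K := 1) (m := 1) nu).
  apply: measurable_funM; last exact: nu.1.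
  by apply: continuous_measurable_rV; exact: continuous_enorm_powR.
move=> x; rewrite normrM ger0_norm ?powR_ge0// mul1r mulrC expr1 ler_wpM2l//.
by rewrite enorm_powR_le_jap// (ltW q0) ltW.
Qed.

(** Rapid decrease of g = [hartley_multiplier q u] gives [hartley g] an expansion at 0 on every
    line, and inversion identifies [hartley g] with |xi|^q times [hartley u]. Both factors of
    [flat_of_powR_mul] are thus available. *)
Lemma multiplier_uniqueness (q : R) u (a C : R) : (0 < d)%N -> 0 < q < 2 ->
  real_schwartz u -> 0 < a -> (forall x, `|u x| <= C * expR (- a * enorm x)) ->
  rapid (hartley_multiplier q u) -> forall x, u x = 0.
Proof.
move=> d0 q02 su a0 uC rg x.
have nu := schwartz_nice su; have iu := nice_igr nu.
have nH := hartley_nice su.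
set h := fun xi => enorm xi `^ q * hartley u xi.
have nh : nice h by exact: nice_enorm_powRM.
have ch : continuous h.
  have q0 : 0 < q by case/andP : q02.
  by move=> z; exact: (continuousM (@continuous_enorm_powR _ q0 z) (@continuous_hartley u nu z)).
have ng : nice (hartley h).
  by split => //; apply: continuous_measurable_rV; exact: continuous_hartley.
have inv_h z : hartley (hartley h) z = h z by apply: hartley_inv => //; exact: nice_igr.
have mom o : o != 0 -> forall j, I (fun y => u y * dotp y o ^+ j) = 0.
  move=> o0 j; apply: hartley_coef_eq0.
  apply: (@flat_of_powR_mul _ (fun t => hartley u (t *: o)) (fun t => hartley (hartley h) (t *: o))
    (hartley_coef u o) (hartley_coef (hartley h) o) (enorm o `^ q) q) => //.
  - by rewrite powR_gt0// enorm_gt0.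
  - exact: hartley_expands.
  - exact: hartley_expands.
  - by move=> t; rewrite inv_h /h enormZ powRM ?enorm_ge0// [enorm o `^ q * _]mulrC.
have F1 o : o != 0 -> forall t p, F u (t *: o) p = 0.
  by move=> o0; apply: (F_eq0_of_moments a0 nu uC); exact: mom.
have F2 xi p : F u xi p = 0.
  (* The origin is the point t = 0 of a line in any nonzero direction; positivity of [d] provides
     one. *)
  have [->|xi0] := eqVneq xi 0; last by rewrite -(scale1r xi) F1.
  pose e : 'rV[R]_d := delta_mx ord0 (Ordinal d0).
  have e0 : e != 0.
    by apply/eqP => e0; have := enorm_delta R (Ordinal d0); rewrite -/e e0 enorm0 => /esym/eqP; rewrite oner_eq0.
  by rewrite -(scale0r e) F1.
have H0 : hartley u = fun=> 0.
  by apply/funext => xi; rewrite hartleyE// !F2 addr0.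
rewrite -(hartley_inv x nu)//.
- rewrite H0 /hartley (@eq_I _ _ _ (fun y => 0 * (0 : R))); last by move=> y; rewrite !mul0r.
  by rewrite Rintegral_cst// mul0r mul0r.
- exact: schwartz_continuous.
- exact: nice_igr.
Qed.

End core.

Section representation.
Variables (R : realType) (d : nat).
Implicit Types (u v : 'rV[R]_d -> R) (f : 'rV[R]_d -> R[i]).

Lemma F_opp u xi p : F u (- xi) p = F u xi (- p).
Proof.
apply: eq_I => x; rewrite dotpC dotpNl -cosN; congr (_ * cos _).
by rewrite dotpC; ring.
Qed.

Lemma Re_mul_expi (z : R[i]) (t : R) :
  complex.Re (z * expi t) = complex.Re z * cos t - complex.Im z * sin t.
Proof. by case: z. Qed.

Lemma Im_mul_expi (z : R[i]) (t : R) :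
  complex.Im (z * expi t) = complex.Re z * sin t + complex.Im z * cos t.
Proof. by case: z. Qed.

Lemma Re_scale (w : R) (z : R[i]) : complex.Re (w%:C%C * z) = w * complex.Re z.
Proof. by case: z => a b /=; rewrite mul0r subr0. Qed.

Lemma Im_scale (w : R) (z : R[i]) : complex.Im (w%:C%C * z) = w * complex.Im z.
Proof. by case: z => a b /=; rewrite mul0r addr0. Qed.

(** The multiplier is even, the cosine parts [C1], [C2] of the transforms are even in xi and the
    sine parts [S1], [S2] odd. Hence the real and imaginary parts of the inverse Fourier integrand
    differ from the Hartley integrands of Re f and Im f by odd functions, whose integrals vanish. *)
Lemma frac_laplacianE (s : R) f x : 0 < s < 1 -> schwartz f ->
  frac_laplacian s f x =
  (hartley_multiplier (2 * s) (fun y => complex.Re (f y)) x +i*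
   hartley_multiplier (2 * s) (fun y => complex.Im (f y)) x)%C.
Proof.
move=> /andP[s0 s1] [sf1 sf2].
set f1 := fun y => complex.Re (f y); set f2 := fun y => complex.Im (f y).
have i1 : igr f1 by exact: nice_igr (schwartz_nice sf1).
have i2 : igr f2 by exact: nice_igr (schwartz_nice sf2).
have q02 : 0 < 2 * s < 2 by lra.
pose C1 xi := F f1 xi 0; pose S1 xi := F f1 xi (- (pi / 2)).
pose C2 xi := F f2 xi 0; pose S2 xi := F f2 xi (- (pi / 2)).
have fourierE xi : fourier f xi = ((C1 xi + S2 xi) +i* (C2 xi - S1 xi))%C.
  rewrite /fourier /cintegral; congr (_ +i* _)%C.
    rewrite -I_D; try exact: igr_cosphase.
    apply: eq_I => y /=; rewrite Re_mul_expi cosN sinN addr0 cosBpihalf.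
    by rewrite -/(f1 y) -/(f2 y) (dotpC xi); ring.
  rewrite -I_B; try exact: igr_cosphase.
  apply: eq_I => y /=; rewrite Im_mul_expi cosN sinN addr0 cosBpihalf.
  by rewrite -/(f1 y) -/(f2 y) (dotpC xi); ring.
have C1N xi : C1 (- xi) = C1 xi by rewrite /C1 F_opp oppr0.
have C2N xi : C2 (- xi) = C2 xi by rewrite /C2 F_opp oppr0.
have SN (v : 'rV[R]_d -> R) xi : igr v -> F v (- xi) (- (pi / 2)) = - F v xi (- (pi / 2)).
  move=> iv; rewrite F_opp opprK -mulN1r -I_Z; last exact: igr_cosphase.
  by apply: eq_I => y; rewrite cosDpihalf cosBpihalf; ring.
have S1N xi : S1 (- xi) = - S1 xi by exact: SN.
have S2N xi : S2 (- xi) = - S2 xi by exact: SN.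
pose w (xi : 'rV[R]_d) := enorm xi `^ (2 * s).
have wN xi : w (- xi) = w xi by rewrite /w enormN.
pose c xi := cos (2 * pi * dotp xi x); pose sn xi := sin (2 * pi * dotp xi x).
have cN xi : c (- xi) = c xi by rewrite /c dotpNl mulrN cosN.
have snN xi : sn (- xi) = - sn xi by rewrite /sn dotpNl mulrN sinN.
have ic v : nice v -> igr (fun xi => w xi * v xi * c xi).
  move=> nv; have := igr_cosphase x 0 (nice_igr (nice_enorm_powRM q02 nv)).
  by congr igr; apply/funext => xi; rewrite addr0.
have isn v : nice v -> igr (fun xi => w xi * v xi * sn xi).
  move=> nv; have := igr_cosphase x (- (pi / 2)) (nice_igr (nice_enorm_powRM q02 nv)).
  by congr igr; apply/funext => xi; rewrite cosBpihalf.
have n1 p : nice (fun xi => F f1 xi p) by exact: (F_nice p sf1).1.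
have n2 p : nice (fun xi => F f2 xi p) by exact: (F_nice p sf2).1.
have nA := niceD (n1 0) (n2 (- (pi / 2))).
have nB := niceD (n2 0) (niceN (n1 (- (pi / 2)))).
have nH1 := niceD (n1 0) (n1 (- (pi / 2))).
have nH2 := niceD (n2 0) (n2 (- (pi / 2))).
have iH (v : 'rV[R]_d -> R) : igr v -> nice ((fun xi => F v xi 0) \+ (fun xi => F v xi (- (pi / 2)))) ->
    igr (fun xi => enorm xi `^ (2 * s) * hartley v xi * cas (2 * pi * dotp xi x)).
  move=> iv nv; have := igrD (ic _ nv) (isn _ nv); congr igr; apply/funext => xi /=.
  by rewrite hartleyE// -mulrDr.
rewrite /frac_laplacian /inv_fourier /cintegral; congr (_ +i* _)%C.
  transitivity (I (fun xi => w xi * ((C1 xi + S2 xi) * c xi - (C2 xi - S1 xi) * sn xi))).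
    apply: eq_I => xi; rewrite -mulrA Re_scale Re_mul_expi fourierE /= (dotpC x).
    by [].
  apply: I_eq_odd.
  - have := igrB (ic _ nA) (isn _ nB); congr igr; apply/funext => xi /=.
    rewrite /C1 /S2 /C2 /S1; ring.
  - exact: iH.
  move=> xi; rewrite -/(w xi) -/(w (- xi)) !hartleyE// -/(C1 xi) -/(S1 xi) -/(C1 (- xi)) -/(S1 (- xi)).
  rewrite /cas -/(c xi) -/(sn xi) -/(c (- xi)) -/(sn (- xi)) !(wN, cN, snN, C1N, C2N, S1N, S2N).
  ring.
transitivity (I (fun xi => w xi * ((C1 xi + S2 xi) * sn xi + (C2 xi - S1 xi) * c xi))).
  apply: eq_I => xi; rewrite -mulrA Im_scale Im_mul_expi fourierE /= (dotpC x).
  by [].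
apply: I_eq_odd.
- have := igrD (isn _ nA) (ic _ nB); congr igr; apply/funext => xi /=.
  rewrite /C1 /S2 /C2 /S1; ring.
- exact: iH.
move=> xi; rewrite -/(w xi) -/(w (- xi)) !hartleyE// -/(C2 xi) -/(S2 xi) -/(C2 (- xi)) -/(S2 (- xi)).
rewrite /cas -/(c xi) -/(sn xi) -/(c (- xi)) -/(sn (- xi)) !(wN, cN, snN, C1N, C2N, S1N, S2N).
ring.
Qed.

End representation.

(** * From densities to gaps *)

Section volume.
Variables (R : realType) (d : nat).
Implicit Types (x y : 'rV[R]_d).

Lemma measurable_eball x (r : R) : measurable (eball x r).
Proof.
have m : measurable_fun setT (fun y => enorm (y - x)).
  have := measurableT_comp (@measurable_enorm R d) (measurable_rV_affine 1 (- x)).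
  by congr measurable_fun; apply/funext => y /=; rewrite scale1r.
rewrite (_ : eball x r = (fun y => enorm (y - x)) @^-1` `]-oo, r[%classic); last first.
  by apply/seteqP; split => y /=; rewrite in_itv.
rewrite -[X in measurable X]setTI; exact: m.
Qed.

Definition cube x (r : R) : set 'rV[R]_d := [set y | forall i, `|y ord0 i - x ord0 i| <= r].

Let ind (r t : R) : R := \1_(`[- r, r]%classic : set R) t.

Let cube_indic x r y : \1_(cube x r) y = \prod_(i < d) ind r ((y - x) ord0 i) :> R.
Proof.
rewrite /ind indicE; have [yc|yc] := boolP (y \in cube x r).
  rewrite big1// => i _; rewrite indicE mem_set//= in_itv/= -ler_norml !mxE.
  by move: yc; rewrite inE; exact.
have [i hi] : exists i, r < `|y ord0 i - x ord0 i|.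
  apply/not_existsP => h; move/negP : yc; apply; rewrite inE => i.
  by rewrite leNgt; apply/negP; exact: h.
rewrite (bigD1 i)//= indicE memNset ?mul0r//= in_itv/= -ler_norml !mxE.
by rewrite leNgt hi.
Qed.

Lemma measurable_cube x r : measurable (cube x r).
Proof.
rewrite (_ : cube x r = \bigcap_(i in [set: 'I_d]) [set y | `|(y - x) ord0 i| <= r]); last first.
  apply/seteqP; split => y h i; first by move=> _; rewrite /= !mxE; exact: h.
  by have := h i Logic.I; rewrite /= !mxE.
apply: fin_bigcap_measurable => // i _.
rewrite (_ : [set y | _] = (fun y => y ord0 i) @^-1` `[x ord0 i - r, x ord0 i + r]%classic).
  by rewrite -[X in measurable X]setTI; exact: (measurable_coord i).
by apply/seteqP; split => y /=; rewrite !mxE in_itv/= ler_distl.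
Qed.

Lemma lebesgue_cube x (r : R) : 0 <= r -> lebesgue_rV (cube x r) = ((2 * r) ^+ d)%:E.
Proof.
move=> r0; rewrite -(setIT (cube x r)) -integral_indic//; last exact: measurable_cube.
under eq_integral do rewrite cube_indic.
have mi : measurable_fun setT (ind r) by exact: measurable_indic.
have ii t : 0 <= ind r t by rewrite /ind indicE.
have E := @ge0_integral_rV_affine R d 1 (- x) (fun y => (\prod_(i < d) ind r (y ord0 i))%:E) (oner_neq0 _).
rewrite (_ : (fun y => _) = (fun y => (\prod_(i < d) ind r ((1 *: y - x) ord0 i))%:E)); last first.
  by apply/funext => y; rewrite scale1r.
rewrite E; last 2 first.
- apply/measurable_EFinP; apply: measurable_prod => i _.
  by apply: (measurableT_comp mi); exact: measurable_coord.
- by move=> y; rewrite lee_fin prodr_ge0.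
rewrite normr1 expr1n invr1 mul1e ge0_integral_rV_prod//.
have -> : (\int[@lebesgue_measure R]_t (ind r t)%:E = (2 * r)%:E)%E.
  rewrite integral_indic// setIT [LHS]lebesgue_measure_itv/= lte_fin.
  move: r0; rewrite le_eqVlt => /predU1P[<-|r0]; first by rewrite oppr0 ltxx mulr0.
  by rewrite gtrN// -EFinD; congr EFin; ring.
by rewrite prodEFin prodr_const card_ord.
Qed.

(** The ball lies between two cubes. The lower bound lets the volume exceed any threshold and the
    upper one keeps it finite; dividing by [d.+1] puts the closed cube inside the open ball. *)
Lemma lebesgue_eball_bounds x (r : R) : 0 < r ->
  (((2 * (r / d.+1%:R)) ^+ d)%:E <= lebesgue_rV (eball x r) <= ((2 * r) ^+ d)%:E)%E.
Proof.
move=> r0; have rd : 0 <= r / d.+1%:R by rewrite divr_ge0// ltW.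
rewrite -!(lebesgue_cube x)//; last exact: ltW.
apply/andP; split; apply: le_measure; rewrite ?inE; try exact: measurable_cube; try exact: measurable_eball.
- move=> y hy; rewrite /eball /=.
  rewrite (le_lt_trans (enorm_le_coord _))//.
  apply: (@le_lt_trans _ _ (\sum_(i < d) r / d.+1%:R)).
    by apply: ler_sum => i _; rewrite !mxE; exact: hy.
  rewrite sumr_const card_ord -[ltLHS]mulr_natr -mulrA gtr_pMr// mulrC.
  by rewrite ltr_pdivrMr// mul1r ltr_nat.
- move=> y; rewrite /eball /= => h i.
  by rewrite (le_trans _ (ltW h))//; have := coord_le_enorm (y - x) i; rewrite !mxE.
Qed.

End volume.

Section density_gap.
Variables (R : realType) (d : nat).

(** Beyond some volume the infimum of the quotients is positive, so no admissible ball of that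
    volume can miss the image of [Gam]: an empty ball would have quotient 0. *)
Lemma lower_density_gap (Fn : 'rV[R]_d -> 'rV[R]_d) (Gam : set 'rV[R]_d) :
  (0 < d)%N -> (0 < lower_density Fn Gam)%E ->
  exists2 rho : R, 0 < rho & forall x, eball x rho `<=` range Fn ->
    exists2 y, Gam y & enorm (Fn y - x) < rho.
Proof.
move=> d0; rewrite /lower_density limf_einfE => /ereal_sup_gt[_ [V [M [_ MV]] <-] infV].
pose m := Num.max 1 (M + 1).
have m1 : 1 <= m by rewrite le_max lexx.
have mM : M < m by rewrite lt_max ltrDl ltr01 orbT.
(* With this radius the inner cube has volume (2m)^d >= 2m > M, as [d] is positive. *)
pose rho := d.+1%:R * m.
have rho0 : 0 < rho by rewrite mulr_gt0// (lt_le_trans ltr01).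
exists rho => // x xF.
have /andP[v1 v2] := lebesgue_eball_bounds x rho0.
set v := lebesgue_rV (eball x rho) in v1 v2.
have vfin : v \is a fin_num.
  by rewrite ge0_fin_numE ?measure_ge0// (le_lt_trans v2)// ltry.
have vM : M < fine v.
  rewrite -lte_fin fineK// (lt_le_trans _ v1)// lte_fin (lt_le_trans mM)//.
  rewrite /rho mulrAC divff// mul1r.
  have m2 : 1 <= 2 * m by lra.
  rewrite (@le_trans _ _ (2 * m))//; first by lra.
  by case: d d0 => // n _; rewrite exprS ler_peMr ?exprn_ege1// (le_trans ler01).
apply: contrapT => hno.
have E0 : (Fn @` Gam) `&` eball x rho = set0.
  apply/seteqP; split => // _ [[y Gy <-] hy]; apply: hno; exists y => //.
have := infV; apply/negP; rewrite -leNgt.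
apply: (@le_trans _ _ (ereal_inf (density_quotients Fn Gam (fine v)))).
  by apply: ereal_inf_lbound; exists (fine v) => //; exact: MV.
apply: ereal_inf_lbound; exists x, rho; split => //; first by rewrite fineK.
by rewrite E0 measure0 mul0e.
Qed.

End density_gap.

(** * Pulling distances back through powers and exponentials *)

Section real_gaps.
Variable R : realType.

Lemma powR_lipschitz (a p q : R) : 1 <= a -> 0 < p -> p <= q ->
  q `^ a - p `^ a <= a * q `^ (a - 1) * (q - p).
Proof.
move=> a1 p0; rewrite le_eqVlt => /predU1P[->|pq]; first by rewrite !subrr mulr0.
have dP x : x \in `]p, q[ -> is_derive x 1 ((@powR R) ^~ a) (a * x `^ (a - 1)).
  by rewrite in_itv/= => /andP[px _]; apply: is_derive1_powR; exact: lt_trans px.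
have [|c] := MVT pq dP.
  apply: derivable_within_continuous => x; rewrite in_itv/= => /andP[px _].
  by apply: derivable_powR; rewrite in_itv/= andbT (lt_le_trans p0).
rewrite in_itv/= => /andP[pc cq] ->.
rewrite ler_wpM2r ?subr_ge0 ?(ltW pq)// ler_wpM2l ?(le_trans ler01)//.
have c0 := lt_trans p0 pc.
by apply: ge0_ler_powR; rewrite ?nnegrE ?subr_ge0// ltW// (lt_trans c0).
Qed.

(** From q^a = q q^(a-1) >= q p^(a-1). A bounded gap between a-th powers thus becomes a gap of size
    p^(1-a). *)
Lemma powR_gap (a p q : R) : 1 <= a -> 0 < p -> p <= q ->
  q - p <= (q `^ a - p `^ a) * p `^ (1 - a).
Proof.
move=> a1 p0 pq; have q0 := lt_le_trans p0 pq.
have E r : 0 < r -> r `^ a = r * r `^ (a - 1).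
  by move=> r0; rewrite -[X in X * _]powRr1 ?ltW// -powRD ?subrKC// (gt_eqF r0) implybT.
have pp : p `^ (a - 1) * p `^ (1 - a) = 1.
  by rewrite -powRD ?(gt_eqF p0) ?implybT// subrKA subrr powRr0.
rewrite (le_trans (_ : _ <= (q - p) * p `^ (a - 1) * p `^ (1 - a)))//.
  by rewrite -mulrA pp mulr1.
rewrite ler_wpM2r ?powR_ge0// !E// mulrBl lerD2r ler_wpM2l ?(ltW q0)//.
by apply: ge0_ler_powR; rewrite ?nnegrE ?subr_ge0// ltW.
Qed.

Lemma powR_le_exp (a : R) n : 0 <= a ->
  exists2 C : R, 0 <= C & forall L, 0 <= L -> ((1 + L) `^ a) ^+ n <= C * expR (L / 2).
Proof.
move=> a0; pose m := (Num.truncn a).+1.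
exists (2 ^+ (m * n) * (m * n)`!%:R * expR (2^-1)).
  by rewrite !mulr_ge0 ?expR_ge0 ?exprn_ge0.
move=> L L0; have L1 : 1 <= 1 + L by rewrite lerDl.
have h : ((1 + L) `^ a) ^+ n <= (1 + L) ^+ (m * n).
  rewrite exprM lerXn2r ?nnegrE ?powR_ge0 ?exprn_ge0 ?(le_trans ler01)//.
  by rewrite -powR_mulrn ?(le_trans ler01)// ler_powR// ltW// truncnS_gt.
rewrite (le_trans h)// -mulrA -expRD -mulrA.
have L2 : 0 <= (1 + L) / 2 by rewrite divr_ge0// (le_trans ler01).
have := expr_fact_le (m * n) L2; rewrite ler_pdivrMr ?ltr0n ?fact_gt0// expr_div_n.
rewrite ler_pdivrMr ?exprn_gt0// => /le_trans; apply.
rewrite mulrC (mulrC (expR _)) le_eqVlt; apply/orP; left; apply/eqP.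
by congr (_ * (_ * expR _)); field.
Qed.

Lemma ler_expR_diff (x y : R) : x <= y -> expR x * (y - x) <= expR y - expR x.
Proof.
move=> xy; have := expR_ge1Dx (y - x); rewrite expRD expRN => h.
have := ler_wpM2l (expR_ge0 x) h; rewrite mulrDr mulr1 mulrCA divff ?mulr1; last first.
  by rewrite gt_eqF// expR_gt0.
lra.
Qed.

(** The exponential has slope at least the smaller of its two endpoint values; the first hypothesis
    keeps that value above half of exp(l), which accounts for the factor 2. *)
Lemma expR_near (l m rho : R) : 2 * rho <= expR l -> `|expR m - expR l| <= rho ->
  `|l - m| * expR l <= 2 * rho.
Proof.
move=> rl h; have rho0 : 0 <= rho by exact: le_trans (normr_ge0 _) h.
move: h; have [ml|/ltW lm] := leP m l.
  have := ler_expR_diff ml; rewrite distrC.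
  rewrite ger0_norm ?subr_ge0 ?ler_expR// ger0_norm ?subr_ge0//.
  move: (expR l) (expR m) rl => x y xy h1 h2.
  have h3 : x <= 2 * y by lra.
  have h4 := ler_wpM2l (_ : 0 <= l - m) h3.
  by rewrite (le_trans (h4 _)) ?subr_ge0//; lra.
have := ler_expR_diff lm; rewrite ger0_norm ?subr_ge0 ?ler_expR//.
rewrite distrC (ger0_norm (_ : 0 <= m - l)) ?subr_ge0// [(m - l) * _]mulrC.
move: (expR l * _) (expR m - _) => x y h1 h2; lra.
Qed.

Lemma powR_near (a m e p q : R) : 1 <= a -> 1 <= m -> 0 < p <= m -> 0 < q <= m ->
  `|p - q| <= e -> `|p `^ a - q `^ a| <= a * m `^ a * e.
Proof.
move=> a1 m1; have a0 : 0 <= a by exact: le_trans ler01 a1.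
have key r s : 0 < r <= m -> 0 < s <= m -> s <= r -> `|r - s| <= e ->
    `|r `^ a - s `^ a| <= a * m `^ a * e.
  move=> /andP[r0 rm] /andP[s0 sm] sr; rewrite (ger0_norm (_ : 0 <= r - s)) ?subr_ge0// => rse.
  rewrite ger0_norm; last first.
    by rewrite subr_ge0; apply: ge0_ler_powR; rewrite ?nnegrE// ltW.
  rewrite (le_trans (powR_lipschitz a1 s0 sr))//.
  apply: ler_pM; rewrite ?subr_ge0 ?mulr_ge0 ?powR_ge0//.
  rewrite ler_wpM2l// (@le_trans _ _ (m `^ (a - 1)))//.
    by apply: ge0_ler_powR; rewrite ?nnegrE ?subr_ge0// ltW// (lt_le_trans ltr01).
  by rewrite ler_powR// gerBl.
move=> pm qm; have [qp|/ltW pq] := leP q p; first exact: key.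
by rewrite distrC (distrC (p `^ a)); exact: key.
Qed.

End real_gaps.

(** * The exponential change of variables *)

Section Phi_gap.
Variables (R : realType) (d : nat).
Implicit Types (x y : 'rV[R]_d).

Lemma enorm_direction x y : x != 0 -> y != 0 ->
  enorm ((enorm x)^-1 *: x - (enorm y)^-1 *: y) <= 2 * enorm (x - y) / enorm x.
Proof.
move=> x0 y0; have nx := enorm_gt0 x0; have ny := enorm_gt0 y0.
have -> : (enorm x)^-1 *: x - (enorm y)^-1 *: y =
    (enorm x)^-1 *: (x - y) + ((enorm x)^-1 - (enorm y)^-1) *: y.
  by rewrite scalerBr scalerBl addrA subrK.
rewrite (le_trans (enormD _ _))// !enormZ (gtr0_norm (_ : 0 < (enorm x)^-1)) ?invr_gt0//.
have -> : (enorm x)^-1 - (enorm y)^-1 = (enorm y - enorm x) / (enorm x * enorm y).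
  by field; rewrite (gt_eqF nx) (gt_eqF ny).
rewrite normrM normfV (gtr0_norm (mulr_gt0 nx ny)).
have -> : `|enorm y - enorm x| / (enorm x * enorm y) * enorm y = `|enorm y - enorm x| / enorm x.
  by field; rewrite (gt_eqF nx) (gt_eqF ny).
rewrite mulrC -mulrDl ler_wpM2r ?invr_ge0 ?(ltW nx)//.
have -> : 2 * enorm (x - y) = enorm (x - y) + enorm (x - y) by ring.
rewrite lerD2l.
have := enormD (x - y) y; have := enormD (y - x) x; rewrite !subrK (enormB y x).
by rewrite ler_norml => h1 h2; apply/andP; split; lra.
Qed.

Variables (a c : R).
Hypotheses (a1 : 1 <= a) (c0 : 0 < c).

Let L x := (enorm x / c) `^ a^-1.
Let a0 : 0 < a. Proof. exact: lt_le_trans a1. Qed.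

Lemma enorm_Phi x : x != 0 -> enorm (Phi a c x) = expR (L x).
Proof.
move=> x0; rewrite /Phi (negbTE x0) !enormZ gtr0_norm ?expR_gt0//.
rewrite gtr0_norm ?invr_gt0 ?enorm_gt0// mulVf ?mulr1// gt_eqF// enorm_gt0//.
Qed.

Let enormL x : enorm x = c * L x `^ a.
Proof.
rewrite /L -powRrM mulVf ?gt_eqF// powRr1 ?divr_ge0 ?enorm_ge0 ?ltW//.
by field; rewrite (gt_eqF c0).
Qed.

(** Apart from the origin the range is the exterior of the closed unit ball, so the balls fed to the
    density hypothesis must stay outside it. *)
Lemma range_Phi y : 1 < enorm y -> range (Phi a c) y.
Proof.
move=> y1; have y0 : 0 < enorm y by rewrite (lt_trans ltr01).
pose r := c * (ln (enorm y)) `^ a.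
have l0 : 0 < ln (enorm y) by rewrite ln_gt0.
have r0 : 0 < r by rewrite mulr_gt0// powR_gt0.
pose x := r / enorm y *: y.
have ex : enorm x = r.
  by rewrite enormZ gtr0_norm ?divr_gt0// divfK// gt_eqF.
have x0 : x != 0 by apply/eqP => x0; move: r0; rewrite -ex x0 enorm0 ltxx.
exists x => //; rewrite /Phi (negbTE x0) ex.
have -> : r / c = ln (enorm y) `^ a by rewrite /r mulrAC divff ?mul1r// gt_eqF.
rewrite -powRrM divff ?gt_eqF// powRr1 ?(ltW l0)// lnK ?posrE//.
rewrite !scalerA -[RHS]scale1r; congr (_ *: _); field.
by rewrite (gt_eqF r0) (gt_eqF y0).
Qed.

(** A gap rho around [Phi a c x], a point of norm exp(L), pulls back to changes of order rho exp(-L)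
    both in the direction and in L. Since |x| is c L^a, the displacement is of order (1 + L)^a
    exp(-L), and half of the exponent absorbs the power. *)
Lemma Phi_gap (Gam : set 'rV[R]_d) : (0 < d)%N -> (0 < lower_density (Phi a c) Gam)%E ->
  exists L0 K : R, forall x, L0 <= L x ->
    exists2 y, Gam y & enorm (x - y) <= K * expR (- (L x / 2)).
Proof.
move=> d0 /(lower_density_gap d0)[rho rho0 hrho].
have [C C0 hC] := powR_le_exp 1 (ltW a0).
(* The threshold gives exp(L) >= 2 rho + 2, so the ball of radius [rho] avoids the unit ball and
   [expR_near] applies. The two summands of the second witness bound the angular and the radial
   displacement. *)
exists (2 * rho + 2), (2 * c * rho * C + 2 * c * a * rho * C) => x Lx.
have Lx0 : 0 < L x by rewrite (lt_le_trans _ Lx)// addr_gt0// mulr_gt0.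
have eL : 2 * rho + 2 <= expR (L x).
  rewrite (le_trans Lx)// (le_trans _ (expR_ge1Dx _))// lerDr//.
have x0 : x != 0.
  by apply/eqP => x0; move: Lx0; rewrite /L x0 enorm0 mul0r powR0 ?ltxx// invr_neq0// gt_eqF.
have near_gt1 z : enorm (z - Phi a c x) < rho -> 1 < enorm z.
  move=> hz; have := enormD (Phi a c x - z) z; rewrite subrK enorm_Phi// enormB.
  move: (enorm _) (enorm z) (expR _) hz eL => p q r; lra.
have [|y Gy hy] := hrho (Phi a c x).
  by move=> z; rewrite /eball/= => /near_gt1; exact: range_Phi.
exists y => //.
have y0 : y != 0.
  apply/eqP => y0; have := near_gt1 _ hy.
  by rewrite /Phi y0 eqxx enorm0 ltr10.
have Ly0 : 0 < L y by rewrite -ltr_expR expR0 -enorm_Phi// near_gt1.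
have LL : `|L x - L y| * expR (L x) <= 2 * rho.
  apply: expR_near; first by rewrite (le_trans _ eL)// lerDl.
  rewrite -!enorm_Phi//; apply: le_trans (ltW hy).
  have := enormD (Phi a c x - Phi a c y) (Phi a c y).
  have := enormD (Phi a c y - Phi a c x) (Phi a c x).
  rewrite !subrK (enormB (Phi a c x)) ler_norml.
  move: (enorm _) (enorm _) (enorm _) => p q r h1 h2; apply/andP; split; lra.
have [E EE] : exists E, E = expR (L x) by exists (expR (L x)).
rewrite -EE in eL LL.
have E0 : 0 < E by rewrite EE expR_gt0.
have LL1 : `|L x - L y| <= 2 * rho / E by rewrite ler_pdivlMr.
(* Hence 1 + L x bounds both L x and L y, as [powR_near] requires. *)
have LL2 : `|L x - L y| <= 1.
  by rewrite (le_trans LL1)// ler_pdivrMr// mul1r (le_trans _ eL)// lerDl.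
have H1 : `|enorm x - enorm y| <= c * (a * (1 + L x) `^ a * (2 * rho / E)).
  rewrite !enormL -mulrBr normrM (gtr0_norm c0) ler_wpM2l ?(ltW c0)//.
  apply: powR_near => //; first by rewrite lerDl ltW.
    by rewrite Lx0 -lerBlDr subrr ler01.
  rewrite Ly0 -lerBlDr (le_trans _ LL2)// distrC ler_norm//.
pose dir (z : 'rV[R]_d) := (enorm (Phi a c z))^-1 *: Phi a c z.
have dirE (z : 'rV[R]_d) : z != 0 -> z = enorm z *: dir z.
  move=> z0; rewrite /dir enorm_Phi// /Phi (negbTE z0) !scalerA -/(L z).
  rewrite -[LHS]scale1r; congr (_ *: _).
  have := expR_gt0 (L z); have := enorm_gt0 z0.
  move: (expR _) (enorm z) => p q q0 p0.
  by field; rewrite (gt_eqF p0) (gt_eqF q0).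
have eneq0 r : expR r != 0 :> R by rewrite (gt_eqF (expR_gt0 r)).
have dir1 (z : 'rV[R]_d) : z != 0 -> enorm (dir z) = 1.
  by move=> z0; rewrite /dir enormZ enorm_Phi// normfV (gtr0_norm (expR_gt0 _)) mulVf.
have Phi0 (z : 'rV[R]_d) : z != 0 -> Phi a c z != 0.
  move=> z0; apply/eqP => h; have := enorm_Phi z0; rewrite h enorm0.
  by move=> /esym/eqP; rewrite (negbTE (eneq0 _)).
have H2 : enorm (dir x - dir y) <= 2 * rho / E.
  rewrite (le_trans (enorm_direction (Phi0 _ x0) (Phi0 _ y0)))// enorm_Phi// -EE.
  by rewrite ler_wpM2r ?invr_ge0 ?(ltW E0)// ler_wpM2l// enormB ltW.
(* The first summand is the angular displacement, the second the radial one. *)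
have -> : x - y = enorm x *: (dir x - dir y) + (enorm x - enorm y) *: dir y.
  by rewrite scalerBr scalerBl addrA subrK -!dirE.
rewrite (le_trans (enormD _ _))// (enormZ (enorm x)) (enormZ (enorm x - enorm y)) (dir1 _ y0) mulr1.
rewrite (ger0_norm (enorm_ge0 x)).
have H3 : enorm x <= c * (1 + L x) `^ a.
  rewrite enormL ler_wpM2l ?(ltW c0)//; apply: ge0_ler_powR; rewrite ?nnegrE ?lerDr ?ler01 ?(ltW a0) ?(ltW Lx0)//.
  by rewrite addr_ge0 ?ler01 ?(ltW Lx0).
have hCL := hC _ (ltW Lx0); rewrite expr1 in hCL.
have Ehalf : (E^-1) * expR (L x / 2) = expR (- (L x / 2)).
  by rewrite EE -expRN -expRD; congr expR; field.
have P0 : 0 <= (1 + L x) `^ a by exact: powR_ge0.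
have PE : (1 + L x) `^ a / E <= C * expR (- (L x / 2)).
  by rewrite -Ehalf mulrCA [leLHS]mulrC (ler_wpM2l _ hCL)// invr_ge0 (ltW E0).
have PE0 : 0 <= (1 + L x) `^ a / E by rewrite divr_ge0 ?(ltW E0).
rewrite mulrDl; apply: lerD.
  apply: (@le_trans _ _ (c * (1 + L x) `^ a * (2 * rho / E))).
    by apply: ler_pM; rewrite ?enorm_ge0.
  have -> : c * (1 + L x) `^ a * (2 * rho / E) = (2 * c * rho) * ((1 + L x) `^ a / E) by ring.
  apply: (@le_trans _ _ (2 * c * rho * (C * expR (- (L x / 2))))).
    by rewrite ler_wpM2l// !mulr_ge0// ltW.
  by rewrite mulrA.
rewrite (le_trans H1)//.
have -> : c * (a * (1 + L x) `^ a * (2 * rho / E)) = (2 * c * a * rho) * ((1 + L x) `^ a / E) by ring.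
apply: (@le_trans _ _ (2 * c * a * rho * (C * expR (- (L x / 2))))).
  by rewrite ler_wpM2l// !mulr_ge0// ltW.
by rewrite mulrA.
Qed.

End Phi_gap.

(** * From gaps to decay *)

Section decay.
Variables (R : realType) (d : nat).
Implicit Types (u g : 'rV[R]_d -> R) (x y : 'rV[R]_d).

Lemma hartley_lipschitz u : nice u ->
  exists K, forall x y, `|hartley u x - hartley u y| <= K * enorm (x - y).
Proof.
move=> nu; have iu := nice_igr nu.
exists (2 * pi * I (fun x => `|u x| * enorm x) + 2 * pi * I (fun x => `|u x| * enorm x)) => x y.
rewrite !hartleyE// opprD addrACA (le_trans (ler_normD _ _))// [leRHS]mulrDl.
by apply: lerD; exact: F_lipschitz.
Qed.

Lemma hartley_bounded u : nice u -> exists B, forall x, `|hartley u x| <= B.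
Proof.
move=> nu; have iu := nice_igr nu.
exists (I (fun x => `|u x|) + I (fun x => `|u x|)) => x.
by rewrite hartleyE// (le_trans (ler_normD _ _))// lerD// F_bound.
Qed.

Lemma decay_of_Phi_density g (a c K B : R) (Gam : set 'rV[R]_d) :
  (0 < d)%N -> 1 <= a -> 0 < c -> (0 < lower_density (Phi a c) Gam)%E ->
  (forall x y, `|g x - g y| <= K * enorm (x - y)) -> (forall x, `|g x| <= B) ->
  (forall y, Gam y -> g y = 0) ->
  exists C : R, forall x, `|g x| <= C * expR (- ((enorm x / c) `^ a^-1 / 2)).
Proof.
move=> d0 a1 c0 /(Phi_gap a1 c0 d0)[L0 [K' gap]] gK gB g0.
have B0 : 0 <= B by apply: le_trans (gB 0).
(* The first summand serves L >= L0; for L < L0 the trivial bound B suffices, because exp((L0 -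
   L)/2) >= 1. *)
exists (`|K| * `|K'| + B * expR (L0 / 2)) => x; set L := (enorm x / c) `^ a^-1.
rewrite mulrDl; have [Lx|Lx] := leP L0 L.
  have [y Gy xy] := gap _ Lx; rewrite ler_wpDr ?mulr_ge0 ?expR_ge0//.
  have := gK x y; rewrite (g0 y Gy) subr0 => /le_trans; apply.
  rewrite (le_trans (ler_wpM2r (enorm_ge0 _) (ler_norm K)))// -mulrA ler_wpM2l//.
  by rewrite (le_trans xy)// ler_wpM2r ?expR_ge0// ler_norm.
rewrite ler_wpDl ?mulr_ge0 ?expR_ge0// -mulrA -expRD.
rewrite (le_trans (gB x))// ler_peMr// -expR0 ler_expR.
by rewrite -mulrBl divr_ge0// subr_ge0 ltW.
Qed.

(** In terms of L the norm |x| = c L^a has power growth while the bound on [g] decays exponentially.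
    The exponent 2N arises since [jap] is quadratic in |x|. *)
Lemma rapid_of_exp_decay g (a c C : R) : 1 <= a -> 0 < c ->
  (forall x, `|g x| <= C * expR (- ((enorm x / c) `^ a^-1 / 2))) -> rapid g.
Proof.
move=> a1 c0 gC N; have a0 : 0 < a by apply: lt_le_trans a1.
have [D D0 hD] := powR_le_exp (2 * N) (ltW a0).
have C0 : 0 <= C.
  by have := le_trans (normr_ge0 _) (gC 0); rewrite pmulr_lge0// expR_gt0.
exists (C * ((1 + c) ^+ (2 * N) * D)) => x; set L := (enorm x / c) `^ a^-1.
have L0 : 0 <= L by exact: powR_ge0.
have xL : enorm x = c * L `^ a.
  rewrite /L -powRrM mulVf ?gt_eqF// powRr1 ?divr_ge0 ?enorm_ge0 ?ltW//.
  by field; rewrite (gt_eqF c0).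
have LL : L `^ a <= (1 + L) `^ a by apply: ge0_ler_powR; rewrite ?nnegrE; lra.
have L1 : 1 <= (1 + L) `^ a.
  by have := @ge0_ler_powR R a (ltW a0) 1 (1 + L); rewrite !nnegrE powR1; apply; lra.
have j1 : jap x <= ((1 + c) * (1 + L) `^ a) ^+ 2.
  rewrite /jap -sqr_enorm xL.
  have := powR_ge0 L a; move: (L `^ a) ((1 + L) `^ a) LL L1 => p q pq q1 p0.
  have h1 : 1 <= q ^+ 2 by exact: exprn_ege1.
  have h2 : p ^+ 2 <= q ^+ 2 by rewrite lerXn2r ?nnegrE// (le_trans p0).
  have h3 := ler_wpM2l (sqr_ge0 c) h2.
  have h4 : 0 <= c * q ^+ 2 by rewrite mulr_ge0 ?sqr_ge0// ltW.
  rewrite !exprMn (_ : (1 + c) ^+ 2 = 1 + 2 * c + c ^+ 2); last by ring.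
  move: (c ^+ 2) (p ^+ 2) (q ^+ 2) h1 h2 h3 h4 => c2 p2 q2; lra.
have jN : jap x ^+ N <= (1 + c) ^+ (2 * N) * (D * expR (L / 2)).
  apply: (@le_trans _ _ (((1 + c) * (1 + L) `^ a) ^+ 2 ^+ N)).
    by rewrite lerXn2r ?nnegrE ?sqr_ge0// ltW// jap_gt0.
  by rewrite -exprM exprMn ler_wpM2l ?exprn_ge0 ?hD//; lra.
apply: (@le_trans _ _ (C * expR (- (L / 2)) * ((1 + c) ^+ (2 * N) * (D * expR (L / 2))))).
  by apply: ler_pM => //; exact/exprn_ge0/ltW/jap_gt0.
rewrite le_eqVlt; apply/orP; left; apply/eqP.
transitivity (C * ((1 + c) ^+ (2 * N) * D) * (expR (- (L / 2)) * expR (L / 2))); first by ring.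
by rewrite -expRD addNr expR0 mulr1.
Qed.

End decay.

(** * Decay from zeros with polynomially shrinking gaps *)

Section rolle.
Variable R : realType.

Lemma is_derive_quadratic (f : R -> R) (x df K : R) :
  (forall t, `|f (x + t) - f x - t * df| <= K * t ^+ 2) -> is_derive x 1 f df.
Proof.
move=> h.
have H : (fun t : R => t^-1 *: ((f \o shift x) (t *: 1) - f x)) @ 0^' --> df.
  apply/subr_cvg0; apply: (@cvg_to_0_linear _ _ K 1) => // t /andP[t0 _].
  have tn : t != 0 by rewrite -normr_gt0.
  rewrite (_ : t *: 1 = t); last exact: mulr1.
  have -> : t^-1 *: ((f \o shift x) t - f x) - df = t^-1 * (f (x + t) - f x - t * df).
    by rewrite /GRing.scale/= (addrC t); field.
  rewrite normrM normfV mulrC ler_pdivrMr// -mulrA -expr2 real_normK ?num_real//.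
apply: DeriveDef; first exact: cvgP H.
by rewrite /derive; apply/cvg_lim.
Qed.

(* Zeros of [V 0] spaced by less than [del] propagate to every derivative by Rolle's theorem,
   and each order of vanishing gains a factor [del]. *)
Lemma rolle_decay (V : nat -> R -> R) (B : nat -> R) (del : R -> R) (C0 T0 : R) :
  (forall k (t : R), is_derive t 1 (V k) (V k.+1 t)) -> (forall k t, `|V k t| <= B k) ->
  (forall s t, T0 <= s -> s <= t -> 0 < del t <= del s) ->
  (forall t, T0 <= t -> exists2 z, t <= z <= t + C0 * del t & V 0%N z = 0) ->
  forall N, exists C : R, forall t, T0 <= t -> `|V 0%N t| <= C * del t ^+ N.
Proof.
move=> dV VB dd Z0.
have Z k : exists2 C : R, 0 <= C & forall t, T0 <= t -> exists2 z, t <= z <= t + C * del t & V k z = 0.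
  elim: k => [|k [C C1 IH]].
    exists `|C0| => // t /[dup] Tt /Z0[z /andP[tz zC] Vz]; exists z => //.
    rewrite tz (le_trans zC)// lerD2l ler_wpM2r ?ler_norm//.
    by have /andP[/ltW] := dd t t Tt (lexx _).
  (* A zero z within C del(t) of t, then a second one sought from z + del(t) on: the extra del(t)
     makes it strictly larger than z, and monotonicity of del keeps it within (2C + 1) del(t) of
     t. *)
  exists (2 * C + 1); first by rewrite addr_ge0// mulr_ge0.
  move=> t Tt; have /andP[dt _] := dd _ _ Tt (lexx _).
  have [z /andP[tz zC] Vz] := IH _ Tt.
  have Tz : T0 <= z + del t by lra.
  have [y /andP[zy yC] Vy] := IH _ Tz.
  have tzd : t <= z + del t by lra.
  have /andP[_ dzt] := dd _ _ Tt tzd.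
  have zy' : z < y by lra.
  have [| | |w] := @Rolle R (V k) z y zy'.
  - by move=> w _; have [] := dV k w.
  - apply: continuous_subspaceT => w.
    by apply/differentiable_continuous/derivable1_diffP; have [] := dV k w.
  - by rewrite Vz Vy.
  rewrite in_itv/= => /andP[zw wy] dw.
  exists w; last first.
    by have [_ <-] := dV k w; have [_ <-] := dw.
  have := ler_wpM2l C1 dzt; rewrite (le_trans tz (ltW zw))/=.
  lra.
(* All [k] together: the bound of order N+1 for [V k] comes from that of order N for [V k.+1] and a
   zero of [V k] at distance of order del(t). *)
suff H N k : exists C : R, forall t, T0 <= t -> `|V k t| <= C * del t ^+ N by move=> N; exact: H.
elim: N k => [|N IH] k; first by exists (B k) => t _; rewrite mulr1.
have [C hC] := IH k.+1; have [D D0 hD] := Z k.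
exists (D * `|C|) => t Tt; have /andP[dt _] := dd _ _ Tt (lexx _).
have [z /andP[tz zC] Vz] := hD _ Tt.
have [r /andP[r0 r1]] := MVT_param z t (dV k).
rewrite Vz subr0 => ->; rewrite normrM.
set q := z + r * (t - z).
have qt : t <= q by rewrite /q; nra.
have hq := hC q (le_trans Tt qt).
have /andP[dq0 dq] := dd _ _ Tt qt.
have h1 : `|V k.+1 q| <= `|C| * del t ^+ N.
  rewrite (le_trans hq)// (le_trans (ler_wpM2r _ (ler_norm C))) ?exprn_ge0 ?(ltW dq0)//.
  by rewrite ler_wpM2l// lerXn2r ?nnegrE ?(ltW dq0) ?(ltW dt).
have h2 : `|t - z| <= D * del t by rewrite distrC ger0_norm ?subr_ge0//; lra.
rewrite (le_trans (ler_pM _ _ h1 h2))// exprS le_eqVlt; apply/orP; left; apply/eqP; ring.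
Qed.

End rolle.

Section line_decay.
Variable R : realType.

Lemma is_derive_F d (u : 'rV[R]_d -> R) (o : 'rV[R]_d) (p t : R) : nice u ->
  is_derive t 1 (fun s : R => F u (s *: o) p)
    (2 * pi * F (fun x => u x * dotp x o) (t *: o) (p + pi / 2)).
Proof.
move=> nu; apply: (@is_derive_quadratic _ _ _ _
  (I (fun x => `|u x * dotp x o ^+ 2|) * ((2 * pi) ^+ 2 / 2))) => r.
have := F_taylor o t r p 2 nu; rewrite !big_ord_recr big_ord0 /=.
rewrite (_ : (fun x => u x * dotp x o ^+ 0) = u); last by apply/funext => x; rewrite mulr1.
rewrite !(add0r, mul0r, addr0, mul1r, expr0, fact0, divr1, mulr1) opprD addrA.
rewrite (_ : r * (2 * pi * _) = F (fun x => u x * dotp x o) (t *: o) (p + pi / 2) * (2 * pi * r)); last by ring.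
move=> /le_trans; apply; rewrite real_normK ?num_real// exprMn (_ : 2`!%:R = 2 :> R)//.
by rewrite le_eqVlt; apply/orP; left; apply/eqP; ring.
Qed.

Lemma GscalK (a y : R) : a != 0 -> Gscal a (Gscal a^-1 y) = y.
Proof.
move=> a0; rewrite /Gscal invrK; have [->|y0] := eqVneq y 0.
  by rewrite sgr0 !mul0r sgr0 mul0r.
have yp : 0 < `|y| `^ a by rewrite powR_gt0// normr_gt0.
rewrite sgrM (gtr0_sg yp) mulr1 sgr_id normrM (gtr0_norm yp) normr_sg y0 mul1r.
by rewrite -powRrM divff// powRr1// -numEsg.
Qed.

Let o : 'rV[R]_1 := delta_mx ord0 ord0.

Let rV1E (x : 'rV[R]_1) : x = x ord0 ord0 *: o.
Proof. by apply/rowP => i; rewrite !mxE (ord1 i) !eqxx mulr1. Qed.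

(** [G alpha] maps the line onto itself, so every ball is admissible; the interval of length 2 rho
    that must contain an image point pulls back by [powR_gap]. The sign [s] treats both half-lines
    at once. *)
Lemma G_gap (alpha : R) (Gam : set 'rV[R]_1) : 0 < alpha < 1 ->
  (0 < lower_density (G alpha) Gam)%E ->
  exists C : R, forall s t, `|s| = 1 -> 1 <= t ->
    exists2 z, t <= z <= t + C * t `^ (1 - alpha^-1) & Gam ((s * z) *: o).
Proof.
move=> /andP[al0 al1] /(lower_density_gap (ltn0Sn 0))[rho rho0 hrho].
have b1 : 1 <= alpha^-1 by rewrite invf_ge1// ltW.
have b0 : 0 < alpha^-1 by rewrite invr_gt0.
exists (2 * rho) => s t s1 t1; have t0 : 0 < t by rewrite (lt_le_trans ltr01).
have ss : s * s = 1 by rewrite -expr2 -[s ^+ 2]real_normK ?num_real// s1 expr1n.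
(* Centring the ball [rho] beyond t^beta forces the zero to lie at or after [t], as [rolle_decay]
   expects. *)
have [|y Gy hy] := hrho ((s * (t `^ alpha^-1 + rho)) *: o).
  move=> z _; exists (G alpha^-1 z) => //.
  by apply/rowP => i; rewrite !mxE GscalK// gt_eqF.
pose y0 := y ord0 ord0.
have h1 : `|s * Gscal alpha y0 - (t `^ alpha^-1 + rho)| < rho.
  apply: le_lt_trans hy; apply: le_trans (coord_le_enorm _ ord0).
  rewrite !mxE !eqxx mulr1 -/y0 -[leLHS]mul1r -s1 -normrM mulrBr mulrA ss mul1r//.
have tb : 0 < t `^ alpha^-1 by rewrite powR_gt0.
have h2 : t `^ alpha^-1 < s * Gscal alpha y0 < t `^ alpha^-1 + 2 * rho.
  move: h1; rewrite ltr_norml; move: (s * _) (t `^ _) => p q /andP[? ?].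
  by apply/andP; split; lra.
have y00 : y0 != 0.
  apply/eqP => y00; move: h2; rewrite y00 /Gscal sgr0 mul0r mulr0 => /andP[h _].
  by move: (lt_trans tb h); rewrite ltxx.
pose z := `|y0|; have z0 : 0 < z by rewrite normr_gt0.
have zb : 0 < z `^ alpha^-1 by rewrite powR_gt0.
have sg1 : s * Num.sg y0 = 1.
  have : 0 < s * Num.sg y0.
    move: h2 => /andP[h _]; have := lt_trans tb h.
    by rewrite /Gscal mulrA (pmulr_lgt0 _ zb).
  by move=> sp; rewrite -(gtr0_norm sp) normrM s1 normr_sg y00 mul1r.
have zE : s * Gscal alpha y0 = z `^ alpha^-1 by rewrite /Gscal mulrA sg1 mul1r.
rewrite zE in h2; move: h2 => /andP[tz zt].
have {}tz : t <= z.
  rewrite leNgt; apply/negP => zlt; move: tz; rewrite ltNge => /negP; apply.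
  by apply: ge0_ler_powR; rewrite ?nnegrE ltW.
exists z.
  rewrite tz/= -lerBlDl (le_trans (powR_gap b1 t0 tz))//.
  by rewrite ler_wpM2r ?powR_ge0// lerBlDl ltW.
suff -> : (s * z) *: o = y by [].
rewrite [RHS]rV1E -/y0; congr (_ *: _).
by rewrite [RHS]numEsg -/z -[Num.sg y0]mul1r -ss -mulrA sg1 mulr1.
Qed.

(** [rolle_decay] is applied on each half-line; its derivative bounds hold because differentiating
    [hartley h] multiplies [h] by powers of the coordinate, which rapid decrease absorbs. *)
Lemma rapid_of_G_density (h : 'rV[R]_1 -> R) (alpha : R) (Gam : set 'rV[R]_1) :
  0 < alpha < 1 -> nice h -> (0 < lower_density (G alpha) Gam)%E ->
  (forall y, Gam y -> hartley h y = 0) -> rapid (hartley h).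
Proof.
move=> al nh dG hG; have ih := nice_igr nh.
have [C0 gap] := G_gap al dG; move: al => /andP[al0 al1].
have gam0 : 0 < alpha^-1 - 1 by rewrite subr_gt0 invf_gt1.
pose u k (x : 'rV[R]_1) := h x * dotp x o ^+ k.
have nu k : nice (u k) by exact: nice_dotp_exp.
(* The k-th derivative of t |-> [hartley h (t *: o)]. *)
pose V k t := (2 * pi) ^+ k * (F (u k) (t *: o) (k%:R * (pi / 2)) +
   F (u k) (t *: o) (- (pi / 2) + k%:R * (pi / 2))).
have dV k (t : R) : is_derive t 1 (V k) (V k.+1 t).
  have dF p := is_derive_F o p t (nu k).
  have := is_deriveZ ((2 * pi) ^+ k) (is_deriveD (dF (k%:R * (pi / 2))) (dF (- (pi / 2) + k%:R * (pi / 2)))).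
  rewrite (_ : (fun x => u k x * dotp x o) = u k.+1); last first.
    by apply/funext => x; rewrite /u exprSr mulrA.
  move=> H; apply: is_derive_eq H _; rewrite /V /GRing.scale/= exprS.
  have -> : k.+1%:R * (pi / 2) = k%:R * (pi / 2) + pi / 2 :> R by rewrite -natr1 mulrDl mul1r.
  by rewrite [- (pi / 2) + (_ + _)]addrA; ring.
have V0 t : V 0%N t = hartley h (t *: o).
  rewrite /V expr0 mul1r mul0r addr0 hartleyE//.
  by rewrite (_ : u 0%N = h)//; apply/funext => x; rewrite /u mulr1.
pose B k := (2 * pi) ^+ k * (I (fun x => `|u k x|) + I (fun x => `|u k x|)).
have VB k t : `|V k t| <= B k.
  have p0 : 0 <= (2 * pi) ^+ k :> R by rewrite exprn_ge0// mulr_ge0 ?pi_ge0.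
  rewrite normrM (ger0_norm p0) ler_wpM2l// (le_trans (ler_normD _ _))// lerD//; apply: F_bound; exact: nice_igr.
pose del (t : R) := t `^ (1 - alpha^-1).
have dd (s t : R) : 1 <= s -> s <= t -> 0 < del t <= del s.
  move=> s1 st; have s0 : 0 < s by rewrite (lt_le_trans ltr01).
  have t0 : 0 < t by rewrite (lt_le_trans s0).
  rewrite powR_gt0//= /del -opprB !powRN lef_pV2 ?posrE ?powR_gt0//.
  by apply: ge0_ler_powR; rewrite ?nnegrE ?(ltW gam0) ?(ltW s0) ?(ltW t0).
have main s : `|s| = 1 -> forall N, exists C : R, forall t, 1 <= t ->
    `|hartley h ((s * t) *: o)| <= C * del t ^+ N.
  move=> s1 N.
  pose Vs k t := s ^+ k * V k (s * t).
  have dVs k (t : R) : is_derive t 1 (Vs k) (Vs k.+1 t).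
    have H := is_deriveZ (s ^+ k) (is_derive1_comp (dV k (s * t)) (is_derive_lin s t)).
    by apply: is_derive_eq H _; rewrite /Vs /GRing.scale/= exprS; ring.
  have VBs k t : `|Vs k t| <= B k by rewrite normrM normrX s1 expr1n mul1r.
  have Z0 t : 1 <= t -> exists2 z, t <= z <= t + C0 * del t & Vs 0%N z = 0.
    move=> t1; have [z tz Gz] := gap _ _ s1 t1; exists z => //.
    by rewrite /Vs V0 hG// mulr0.
  have [C hC] := rolle_decay dVs VBs dd Z0 N; exists C => t t1.
  by have := hC t t1; rewrite /Vs expr0 mul1r V0.
move=> N.
(* With beta = 1/alpha, (beta - 1) m >= 2N: m factors del(t) = t^(1-beta) beat t^(2N), hence
   [jap x ^+ N] up to 2^N. *)
pose m := (Num.truncn ((2 * N)%:R / (alpha^-1 - 1))).+1.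
have mN : (2 * N)%:R <= (alpha^-1 - 1) * m%:R.
  by rewrite mulrC -ler_pdivrMr// ltW// truncnS_gt.
have [C1 hC1] := main 1 (normr1 _) m; have [C2 hC2] := main (-1) (normrN1 _) m.
have [B1 hB1] := hartley_bounded nh.
have B10 : 0 <= B1 by exact: le_trans (hB1 0).
exists ((`|C1| + `|C2| + B1) * 2 ^+ N) => x.
set r := x ord0 ord0; have xE : x = r *: o by exact: rV1E.
have jx : jap x = 1 + `|r| ^+ 2.
  by rewrite /jap /dotp big_ord1 real_normK ?num_real// -expr2.
have far C (t : R) : 1 <= t -> t = `|r| -> `|hartley h x| <= C * del t ^+ m ->
    `|hartley h x| * jap x ^+ N <= `|C| * 2 ^+ N.
  move=> t1 tr hC; have t0 : 0 < t by rewrite (lt_le_trans ltr01).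
  have j2 : jap x ^+ N <= 2 ^+ N * t ^+ (2 * N).
    have j1 : jap x <= 2 * t ^+ 2.
      by rewrite jx -tr; have := exprn_ege1 2 t1; move: (t ^+ 2) => w; lra.
    rewrite exprM -exprMn; apply: lerXn2r => //; rewrite nnegrE.
      exact/ltW/jap_gt0.
    by rewrite mulr_ge0 ?sqr_ge0.
  have dm : del t ^+ m * t ^+ (2 * N) <= 1.
    rewrite /del -!powR_mulrn ?powR_ge0 ?(ltW t0)// -powRrM -powRD; last by rewrite (gt_eqF t0) implybT.
    rewrite -[leRHS](powRr0 t) ler_powR//; move: mN; move: (m%:R) ((2 * N)%:R) (alpha^-1) => p q b; lra.
  have h1 : `|hartley h x| <= `|C| * del t ^+ m.
    by rewrite (le_trans hC)// ler_wpM2r ?exprn_ge0 ?powR_ge0// ler_norm.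
  apply: (@le_trans _ _ (`|C| * del t ^+ m * (2 ^+ N * t ^+ (2 * N)))).
    by apply: ler_pM => //; exact/exprn_ge0/ltW/jap_gt0.
  have -> : `|C| * del t ^+ m * (2 ^+ N * t ^+ (2 * N)) = `|C| * 2 ^+ N * (del t ^+ m * t ^+ (2 * N)) by ring.
  by rewrite ler_piMr// mulr_ge0// exprn_ge0.
have N2 : 0 <= 2 ^+ N :> R by rewrite exprn_ge0.
have [r1|r1] := leP 1 `|r|; last first.
  apply: (@le_trans _ _ (B1 * 2 ^+ N)).
    apply: ler_pM => //; first exact/exprn_ge0/ltW/jap_gt0.
    apply: lerXn2r; rewrite ?nnegrE//; first exact/ltW/jap_gt0.
    by rewrite jx -[leRHS]/(1 + 1) lerD2l exprn_ile1 ?(ltW r1).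
  by rewrite ler_wpM2r// lerDr addr_ge0.
have [r0|r0] := leP 0 r.
  rewrite (le_trans (far C1 _ r1 erefl _))//.
    by have := hC1 _ r1; rewrite mul1r (ger0_norm r0) -xE.
  by rewrite ler_wpM2r// -addrA lerDl addr_ge0.
rewrite (le_trans (far C2 _ r1 erefl _))//.
  by have := hC2 _ r1; rewrite mulN1r (ltr0_norm r0) opprK -xE.
by rewrite ler_wpM2r// addrAC lerDr addr_ge0.
Qed.

End line_decay.

Theorem theorem1p1 (R : realType) (d : nat) (alpha s : R)
    (Lambda M : set 'rV[R]_d) :
  (0 < d)%N -> 0 < alpha < 1 -> 0 < s < 1 ->
  discrete Lambda -> discrete M ->
  let beta := alpha^-1 in
  (exists c1 c2 : R, [/\ 0 < c1, 0 < c2,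
      (0 < lower_density (Phi 1 c1) Lambda)%E &
      (0 < lower_density (Phi beta c2) M)%E]) \/
  (d = 1%N /\ exists c : R, [/\ 0 < c,
      (0 < lower_density (Phi 1 c) Lambda)%E &
      (0 < lower_density (G alpha) M)%E]) ->
  uniqueness_pair (frac_laplacian s) Lambda M.
Proof.
move=> d0 al s01 _ _ beta cases f sf fL fM x.
have q02 : 0 < 2 * s < 2 by lra.
have b1 : 1 <= beta by rewrite invf_ge1; case/andP : al => // ? /ltW.
(* By [frac_laplacianE] both vanishing conditions split into real and imaginary parts, so a real
   function can be treated alone. *)
suff H u : real_schwartz u -> (forall y, Lambda y -> u y = 0) ->
    (forall y, M y -> hartley_multiplier (2 * s) u y = 0) -> forall y, u y = 0.
  have fM' y : M y -> hartley_multiplier (2 * s) (fun z => complex.Re (f z)) y = 0 /\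
      hartley_multiplier (2 * s) (fun z => complex.Im (f z)) y = 0.
    by move=> /fM; rewrite (frac_laplacianE _ s01 sf) => -[-> ->].
  case: sf => sf1 sf2.
  suff : complex.Re (f x) = 0 /\ complex.Im (f x) = 0.
    by case: (f x) => p q /= [-> ->].
  split.
    by apply: (H _ sf1) => y; [move=> Ly; rewrite fL | case/fM'].
  by apply: (H _ sf2) => y; [move=> Ly; rewrite fL | case/fM'].
move=> su uL gM.
have nu := schwartz_nice su.
have nh := nice_enorm_powRM q02 (hartley_nice su).
have [K gK] := hartley_lipschitz nh.
have [B gB] := hartley_bounded nh.
(* For a = 1 the logarithmic radius is |x|/c, and the halved exponent of [decay_of_Phi_density]
   gives the rate 1/(2c). *)
have expdecay c : 0 < c -> (0 < lower_density (Phi 1 c) Lambda)%E ->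
    exists C : R, forall x, `|u x| <= C * expR (- (2 * c)^-1 * enorm x).
  move=> c0 dL.
  have [D hD] : exists D, forall i z, `|'D_(delta_mx ord0 i : 'rV[R]_d) u z| <= D.
    have /choice[D hD] : forall i, exists D, forall z, `|'D_(delta_mx ord0 i : 'rV[R]_d) u z| <= D.
      move=> i; have [_ /(_ 0%N)[D hD]] := schwartz_nice (schwartz_partial i su).
      by exists D => z; have := hD z; rewrite mulr1.
    exists (\sum_i `|D i|) => i z; rewrite (le_trans (hD i z))// (bigD1 i)//=.
    by rewrite (le_trans (ler_norm _))// lerDl sumr_ge0.
  have [B0 hB0] := nu.2 0%N.
  have [|y|y|y Ly|C hC] := @decay_of_Phi_density R d u 1 c (D *+ d) B0 Lambda d0 _ c0 dL.
  - exact: lexx.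
  - move=> z; rewrite distrC enormB; apply: enorm_lipschitz => //; exact: schwartz_differentiable.
  - by have := hB0 y; rewrite mulr1.
  - exact: uL.
  exists C => y; have := hC y; rewrite invr1 powRr1 ?divr_ge0 ?enorm_ge0 ?(ltW c0)//.
  by congr (_ <= _ * expR _); field; rewrite (gt_eqF c0).
case: cases => [[c1 [c2 [c10 c20 dL dM]]]|[d1 [c [c0 dL dM]]]].
  have [C uC] := expdecay _ c10 dL.
  apply: (multiplier_uniqueness d0 q02 su _ uC); first by rewrite invr_gt0 mulr_gt0.
  have [C' gC'] := decay_of_Phi_density d0 b1 c20 dM gK gB gM.
  exact: rapid_of_exp_decay b1 c20 gC'.
have [C uC] := expdecay _ c0 dL.
apply: (multiplier_uniqueness d0 q02 su _ uC); first by rewrite invr_gt0 mulr_gt0.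
(* Stated for a fresh dimension, so that substituting [d' = 1] leaves the surrounding context
   untouched. *)
have rG d' (h : 'rV[R]_d' -> R) (M' : set 'rV[R]_d') : d' = 1%N -> nice h ->
    (0 < lower_density (G alpha) M')%E -> (forall y, M' y -> hartley h y = 0) ->
    rapid (hartley h).
  by move=> d1'; subst d'; exact: rapid_of_G_density.
exact: rG dM gM.
Qed.
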